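(* Every complete Riemannian plane is quasi-isometric to a locally finite planar graph.
   Context: A complete Riemannian plane is a smooth surface homeomorphic to $\mathbb{R}^2$ equipped with a complete Riemannian metric, viewed as a metric space with its Riemannian distance. A graph is locally finite if every vertex has finite degree; it carries its shortest-path metric (edges of length 1). Metric spaces $X,Y$ are quasi-isometric if there is $f:X\to Y$ and constants $A\ge1$, $B,C\ge 0$ with $\frac1A d(x,x')-B\le d(f(x),f(x'))\le A d(x,x')+B$ for all $x,x'$ and every point of $Y$ within distance $C$ of $f(X)$. *)

(* Defs.v *)
From HB Require Import structures.
From mathcomp Require Import all_boot all_order all_algebra.
From mathcomp Require Import all_classical all_reals all_analysis.

Set Implicit Arguments.
Unset Strict Implicit.
Unset Printing Implicit Defensive.

Import Order.TTheory GRing.Theory Num.Theory.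
Import numFieldNormedType.Exports.

Local Open Scope classical_set_scope.
Local Open Scope ring_scope.

(* Only meaningful for open U: derivatives are two-sided. *)
Fixpoint Ck_on (R : realType) (V W : normedModType R) (k : nat)
    (U : set V) (f : V -> W) : Prop :=
  match k with
  | 0 => forall x, U x -> {for x, continuous f}
  | k'.+1 => (forall x, U x -> differentiable f x) /\
             (forall v : V, Ck_on k' U (fun x => 'D_v f x))
  end.

Definition smooth_on (R : realType) (V W : normedModType R)
    (U : set V) (f : V -> W) : Prop := forall k, Ck_on k U f.

Definition homeomorphic (X Y : topologicalType) : Prop :=
  exists (f : X -> Y) (g : Y -> X),
    [/\ cancel f g, cancel g f, continuous f & continuous g].

(* A C^oo atlas (not assumed maximal) with values in R^2.  The functions
   [coord i] and [param i] are total, but only their restrictions to [dom i]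
   and [coord i @` dom i] are meaningful. *)
Record smooth_atlas (R : realType) (M : topologicalType) := SmoothAtlas {
  chart : Type ;
  dom : chart -> set M ;
  coord : chart -> M -> 'rV[R]_2 ;
  param : chart -> 'rV[R]_2 -> M ;
  dom_cover : forall p, exists i, dom i p ;
  dom_open : forall i, open (dom i) ;
  cod_open : forall i, open (coord i @` dom i) ;
  coordK : forall i p, dom i p -> param i (coord i p) = p ;
  coord_continuous : forall i p, dom i p -> {for p, continuous (coord i)} ;
  param_continuous : forall i p, dom i p ->
    {for coord i p, continuous (param i)} ;
  transition_smooth : forall i j,
    smooth_on (coord i @` (dom i `&` dom j)) (coord j \o param i)
}.

Definition bilin (R : realType) (G : 'M[R]_2) (v w : 'rV[R]_2) : R :=
  (v *m G *m w^T) 0 0.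

(* [gram i x] is the matrix (g_{kl}) of the metric tensor in the chart i, at
   the point with coordinates x; [gram_compat] is the transformation law of
   covariant 2-tensors. *)
Record riemannian_metric (R : realType) (M : topologicalType)
    (A : smooth_atlas R M) := RiemannianMetric {
  gram : chart A -> 'rV[R]_2 -> 'M[R]_2 ;
  gram_smooth : forall i, smooth_on (coord i @` dom i) (gram i) ;
  gram_sym : forall i p, dom i p ->
    (gram i (coord i p))^T = gram i (coord i p) ;
  gram_posdef : forall i p, dom i p ->
    forall v, v != 0 -> 0 < bilin (gram i (coord i p)) v v ;
  gram_compat : forall i j p, dom i p -> dom j p ->
    forall v w : 'rV[R]_2,
      let x := coord i p in
      let tau : 'rV[R]_2 -> 'rV[R]_2 := coord j \o param i in
      bilin (gram i x) v w = bilin (gram j (tau x)) ('D_v tau x) ('D_w tau x)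
}.

Definition chart_at (R : realType) (M : topologicalType)
    (A : smooth_atlas R M) (p : M) : chart A := sval (cid (dom_cover A p)).

(* Piecewise C^1 curves on [0, 1], read in charts.  Off a finite set the curve
   is C^1; everywhere its velocity has one-sided limits, which (the curve being
   continuous) amounts to being C^1 on each closed piece of the subdivision. *)
Definition piecewise_C1 (R : realType) (M : topologicalType)
    (A : smooth_atlas R M) (c : R -> M) : Prop :=
  {within `[0, 1], continuous c} /\
  exists s : seq R,
    forall (t : R) (i : chart A), 0 <= t <= 1 -> dom i (c t) ->
      let u : R -> 'rV[R]_2 := coord i \o c in
      [/\ 0 < t < 1 -> t \notin s ->
            derivable u t 1 /\ {for t, continuous (derive1 u)},
          0 < t -> cvg (derive1 u x @[x --> t^'-]) &
          t < 1 -> cvg (derive1 u x @[x --> t^'+])].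

(* By [gram_compat], the choice of the chart is irrelevant wherever the curve
   is differentiable. *)
Definition speed (R : realType) (M : topologicalType) (A : smooth_atlas R M)
    (g : riemannian_metric A) (c : R -> M) (t : R) : R :=
  let i := chart_at A (c t) in
  let u : R -> 'rV[R]_2 := coord i \o c in
  Num.sqrt (bilin (gram g i (u t)) (derive1 u t) (derive1 u t)).

Definition curve_length (R : realType) (M : topologicalType)
    (A : smooth_atlas R M) (g : riemannian_metric A) (c : R -> M) : R :=
  \int[@lebesgue_measure R]_(t in `[0, 1]) speed g c t.

Definition riemannian_dist (R : realType) (M : topologicalType)
    (A : smooth_atlas R M) (g : riemannian_metric A) (p q : M) : R :=
  inf [set curve_length g c |
        c in [set c | [/\ piecewise_C1 A c, c 0 = p & c 1 = q]]].

Definition complete_dist (R : realType) (X : Type) (d : X -> X -> R) : Prop :=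
  forall u : nat -> X,
    (forall e, 0 < e ->
      exists N, forall m n, (N <= m)%N -> (N <= n)%N -> d (u m) (u n) < e) ->
    exists x, forall e, 0 < e ->
      exists N, forall n, (N <= n)%N -> d (u n) x < e.

Definition quasi_isometric (R : realType) (X Y : Type)
    (dX : X -> X -> R) (dY : Y -> Y -> R) : Prop :=
  exists (f : X -> Y) (A B C : R),
    [/\ 1 <= A, 0 <= B, 0 <= C,
        forall x x', A^-1 * dX x x' - B <= dY (f x) (f x') <= A * dX x x' + B &
        forall y, exists x, dY y (f x) <= C].

Record graph := Graph {
  vertex : Type ;
  adj : vertex -> vertex -> Prop ;
  adj_sym : forall u v, adj u v -> adj v u ;
  adj_irrefl : forall v, ~ adj v v
}.

Definition walk (G : graph) (n : nat) (u v : vertex G) : Prop :=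
  exists w : nat -> vertex G,
    [/\ w 0%N = u, w n = v & forall k, (k < n)%N -> adj (w k) (w k.+1)].

Definition connected_graph (G : graph) : Prop :=
  forall u v : vertex G, exists n, walk n u v.

Definition locally_finite_graph (G : graph) : Prop :=
  forall v : vertex G, finite_set [set w | adj v w].

(* Junk value 0 between distinct components: only used for connected graphs. *)
Definition graph_dist (R : realType) (G : graph) (u v : vertex G) : R :=
  inf [set n%:R | n in [set n | walk n u v]].

(* A drawing in R^2: each edge uv is an arc from [pos u] to [pos v], traversed
   backwards by [arc v u], whose interior contains no vertex and no point of
   another edge. *)
Definition planar_graph (R : realType) (G : graph) : Prop :=
  exists (pos : vertex G -> 'rV[R]_2)
         (arc : vertex G -> vertex G -> R -> 'rV[R]_2),
    [/\ injective pos,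
        forall u v, adj u v ->
          [/\ {within `[0, 1], continuous (arc u v)},
              {in `[0, 1] &, injective (arc u v)},
              arc u v 0 = pos u, arc u v 1 = pos v &
              forall t : R, 0 <= t <= 1 -> arc v u t = arc u v (1 - t)],
        forall u v w (t : R), adj u v -> 0 < t < 1 -> arc u v t <> pos w &
        forall u v u' v' (s t : R),
          adj u v -> adj u' v' -> 0 < s < 1 -> 0 < t < 1 ->
          arc u v s = arc u' v' t -> (u = u' /\ v = v') \/ (u = v' /\ v = u')].

(* Main.v *)
Require Import Defs.
From HB Require Import structures.
From mathcomp Require Import all_boot all_order all_algebra.
From mathcomp Require Import all_classical all_reals all_analysis.
From mathcomp Require Import measurable_realfun.
From mathcomp Require Import zify ring lra.

(** Transport the plane to R^2 by the homeomorphism, followed by a radial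
    stretching that makes every square of side 2 have diameter at most 1 for the
    Riemannian distance.  Points are then recorded by their cell in the grid Z^2;
    call a grid-connected set of cells small if its diameter is at most 3.  By
    Hopf-Rinow the balls are bounded, so the cells within distance 3 of a given
    one are finitely many, and a curve of length at most 1 runs through a small
    set.  The grid has no K5 minor; a buffered cop decomposition, in which each
    new supernode is built from at most three geodesic chains of small sets and
    then grown so as to absorb whatever comes close to the older supernodes,
    partitions the grid into connected clusters of bounded radius such that every
    small set is crossed by boundedly many steps from cluster to adjacent cluster.
    Contracting the clusters gives a graph quasi-isometric to the plane.  It is
    planar: a spanning tree of each cluster routes disjoint strands from its root
    to all of its boundary, without crossing inside the unit squares. *)

Set Implicit Arguments.
Unset Strict Implicit.
Unset Printing Implicit Defensive.

Import Order.TTheory GRing.Theory Num.Theory.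
Import numFieldNormedType.Exports.
Import Defs.

Local Open Scope classical_set_scope.

(** * Chains of small sets *)

(** The obstacle is that cells alone do not measure distance: adjacent cells are close for [d], but
    a curve of length 1 may run through arbitrarily many of them, while joining the points of a net
    by short curves would lose planarity. Contracting connected sets of cells keeps planarity, so
    everything rests on making short curves meet few clusters in succession. The excluded minor
    enters through a single count: supernodes touching a common free component are pairwise
    adjacent, so four of them and the component would form a K5. Hence there are at most three,
    which bounds the chains of a new supernode, the centers competing for a vertex, and the depth of
    the recursion that counts crossings. For that recursion to work, an older supernode that is
    merely close to a free component must actually touch it; younger supernodes are grown as a
    buffer until no closeness without contact remains. A cluster next to a component grows only in a
    round that removes an older supernode from those close to the component, and these number at
    most three: this potential keeps the radii bounded. *)

Section GridConnectivity.
Variables (V : choiceType) (adj : V -> V -> Prop).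
Hypothesis adj_symm : forall x y, adj x y -> adj y x.

Inductive conn (D : set V) (x : V) : V -> Prop :=
| conn_refl : D x -> conn D x x
| conn_step y z : conn D x y -> adj y z -> D z -> conn D x z.

Lemma conn_l D x y : conn D x y -> D x.
Proof. by elim. Qed.

Lemma conn_r D x y : conn D x y -> D y.
Proof. by elim. Qed.

Lemma conn_trans D x y z : conn D x y -> conn D y z -> conn D x z.
Proof. by move=> xy; elim=> // u v _ xu uv Dv; apply: conn_step xu uv Dv. Qed.

Lemma conn_adj D x y : D x -> D y -> adj x y -> conn D x y.
Proof. by move=> Dx Dy xy; apply: conn_step (conn_refl Dx) xy Dy. Qed.

Lemma conn_sym D x y : conn D x y -> conn D y x.
Proof.
elim=> [|u v _ ux uv Dv]; first exact: conn_refl.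
apply: (conn_trans _ ux); apply: conn_adj => //; last exact: adj_symm.
exact: conn_l ux.
Qed.

Lemma conn_sub (D E : set V) x y : D `<=` E -> conn D x y -> conn E x y.
Proof.
move=> DE; elim=> [/DE|u v _ xu uv /DE Ev]; first exact: conn_refl.
exact: conn_step xu uv Ev.
Qed.

Lemma conn_self D x y : conn D x y -> conn (conn D x) x y.
Proof.
elim=> [Dx|u v xu xu' uv Dv]; first by apply/conn_refl/conn_refl.
by apply: (conn_step xu' uv); apply: (conn_step xu uv Dv).
Qed.

Lemma conn_ext D x y : conn D x y -> conn D x = conn D y.
Proof.
move=> xy; apply/seteqP; split=> z; apply: conn_trans => //.
exact: conn_sym.
Qed.

Definition connected_set (D : set V) := forall x y, D x -> D y -> conn D x y.

Lemma connected_comp D x : connected_set (conn D x).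
Proof.
move=> y z xy xz.
rewrite (conn_ext xy); apply: conn_self.
by apply: (conn_trans _ xz); apply: conn_sym.
Qed.

Lemma conn_center D o : (forall x, D x -> conn D o x) -> connected_set D.
Proof. by move=> Do x y /Do/conn_sym xo /Do; apply: conn_trans. Qed.

Definition attached (D T : set V) x t :=
  x = t \/ exists2 x1, conn (D `\` T) x x1 & adj x1 t.

(** The witnesses [t] and [t'] are the first and the last points of [T] on the walk. What happens
    between them is forgotten, which later lets the hop count jump over a whole cluster. *)
Lemma conn_split D (T : set V) x y : conn D x y ->
  conn (D `\` T) x y \/
  exists t t', [/\ (D `&` T) t, (D `&` T) t', attached D T x t & attached D T y t'].
Proof.
elim=> [Dx|u v xu [IH|[t [t' [Tt Tt' xt ut']]]] uv Dv].
- case: (pselect (T x)) => Tx; last by left; apply: conn_refl.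
  by right; exists x, x; split=> //; left.
- case: (pselect (T v)) => Tv.
    right; exists v, v; split=> //; [|by left].
    by right; exists u.
  by left; apply: (conn_step IH uv).
- right; case: (pselect (T v)) => Tv.
    by exists t, v; split=> //; left.
  case: (pselect (T u)) => Tu.
    exists t, u; split=> //; first by split=> //; apply: conn_r xu.
    by right; exists v; [apply: conn_refl|apply: adj_symm].
  exists t, t'; split=> //; right.
  case: ut' => [ut'|[x1 ux1 x1t']]; first by case: Tt'; rewrite -ut'.
  exists x1 => //; apply: (conn_trans _ ux1); apply: conn_adj => //.
    by split=> //; apply: conn_r xu.
  exact: adj_symm.
Qed.

Lemma conn_exit D (T : set V) x y : conn D x y -> ~ T x -> T y ->
  exists x' t, [/\ conn (D `\` T) x x', adj x' t, D t & T t].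
Proof.
move=> xy Tx Ty; case: (conn_split T xy) => [/conn_r[]//|[t [t' [[Dt Tt] _]]]].
by case=> [xt|[x1 xx1 x1t] _]; [move: Tx; rewrite xt|exists x1, t].
Qed.

End GridConnectivity.

(** * The distance that counts small sets, inside a given domain *)

Section StringMetric.
Variables (V : choiceType) (adj cl : V -> V -> Prop).
Hypothesis adj_symm : forall x y, adj x y -> adj y x.
Hypothesis cl_refl : forall x, cl x x.
Hypothesis cl_symm : forall x y, cl x y -> cl y x.
Hypothesis adj_cl : forall x y, adj x y -> cl x y.
Hypothesis cl_finite : forall x, finite_set [set y | cl x y].

Local Notation conn := (conn adj).
Local Notation connected_set := (connected_set adj).

Definition small (K : set V) :=
  connected_set K /\ forall x y, K x -> K y -> cl x y.

(** A small set plays the role of a curve of length 1. As for an intrinsic metric it must stay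
    inside [D]; [dle D] then bounds the graph distance for these steps. *)
Definition st (D : set V) x y := exists K, [/\ K `<=` D, small K, K x & K y].

Fixpoint dle (D : set V) n x y :=
  if n is n'.+1 then exists2 z, dle D n' x z & st D z y else x = y.

Lemma small_sub (K L : set V) : small K -> L `<=` K -> connected_set L -> small L.
Proof. by move=> [_ cK] LK cL; split=> // x y /LK Kx /LK; apply: cK. Qed.

Lemma small1 x : small [set x].
Proof. by split=> [y z /= -> ->|y z -> ->//]; apply: conn_refl. Qed.

Lemma st_refl (D : set V) x : D x -> st D x x.
Proof. by move=> Dx; exists [set x]; split=> // [y ->//|]; apply: small1. Qed.

Lemma st_sym D x y : st D x y -> st D y x.
Proof. by move=> [K [KD sK Kx Ky]]; exists K. Qed.

Lemma st_sub (D E : set V) x y : D `<=` E -> st D x y -> st E x y.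
Proof. by move=> DE [K [KD sK Kx Ky]]; exists K; split=> // z /KD/DE. Qed.

Lemma st_adj (D : set V) x y : D x -> D y -> adj x y -> st D x y.
Proof.
move=> Dx Dy xy; exists [set z | z = x \/ z = y]; split; try by [left|right].
- by move=> z [->|->].
- split.
    apply: (conn_center adj_symm (o := x)) => z [->|->].
      by apply: conn_refl; left.
    by apply: conn_adj => //; [left|right].
  move=> u v [->|->] [->|->] //; first exact: adj_cl.
  by apply: cl_symm; apply: adj_cl.
Qed.

Lemma st_cl D x y : st D x y -> cl x y.
Proof. by move=> [K [_ [_ cK] Kx Ky]]; apply: cK. Qed.

Lemma st_conn D x y : st D x y -> conn D x y.
Proof. by move=> [K [KD [cK _] Kx Ky]]; apply: conn_sub KD _; apply: cK. Qed.

Lemma dle_conn (D : set V) n x y : D x -> dle D n x y -> conn D x y.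
Proof.
move=> Dx; elim: n y => [y <-|n IHn y [z /IHn xz /st_conn zy]].
  exact: conn_refl.
exact: conn_trans xz zy.
Qed.

Lemma dle_r (D : set V) n x y : D x -> dle D n x y -> D y.
Proof. by move=> Dx /(dle_conn Dx)/conn_r. Qed.

Lemma dle_trans D m n x y z : dle D m x y -> dle D n y z -> dle D (m + n) x z.
Proof.
move=> xy; elim: n z => [z <-|n IHn z [t /IHn yt tz]]; first by rewrite addn0.
by rewrite addnS; exists t.
Qed.

Lemma dle_st (D : set V) n x y z : dle D n x y -> st D y z -> dle D n.+1 x z.
Proof. by move=> xy yz; exists y. Qed.

Lemma dle_sym (D : set V) n x y : dle D n x y -> dle D n y x.
Proof.
elim: n y => [y ->//|n IHn y [z xz /st_sym yz]].
by have /dle_trans/(_ (IHn _ xz)) : dle D 1 y z by exists y.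
Qed.

Lemma dle_leq (D : set V) m n x y : D x -> (m <= n)%N -> dle D m x y -> dle D n x y.
Proof.
move=> Dx /subnK <-; elim: (n - m)%N => // k IHk xy; rewrite addSn.
by exists y; [apply: IHk|apply: st_refl; apply: (dle_r Dx xy)].
Qed.

Lemma dle_finite D n x : finite_set [set y | dle D n x y].
Proof.
elim: n => [|n IHn].
  by apply: sub_finite_set (finite_set1 x) => y /= ->.
apply: (@sub_finite_set _ _ (\bigcup_(z in [set z | dle D n x z]) [set y | cl z y])).
  by move=> y [z xz /st_cl zy]; exists z.
exact: bigcup_finite.
Qed.

Lemma conn_dle (D : set V) x y : conn D x y -> exists n, dle D n x y.
Proof.
elim=> [Dx|u v xu [n IHn] uv Dv]; first by exists 0.
by exists n.+1; exists u => //; apply: st_adj => //; apply: conn_r xu.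
Qed.

Lemma dle_chain (D : set V) n x y : dle D n x y ->
  exists (p : nat -> V) (K : nat -> set V),
  [/\ p 0 = x, p n = y &
      forall j, (j < n)%N -> [/\ K j `<=` D, small (K j), K j (p j) & K j (p j.+1)]].
Proof.
elim: n y => [y <-|n IHn y [z xz [L [LD sL Lz Ly]]]].
  by exists (fun=> x), (fun=> setT).
have [p [K [p0 pn pK]]] := IHn _ xz.
exists (fun j => if (j <= n)%N then p j else y),
  (fun j => if (j < n)%N then K j else L).
rewrite leq0n ltnn; split=> // j; rewrite ltnS leq_eqVlt => /orP[/eqP->|jn].
  by rewrite eqxx !ltnn pn.
by rewrite jn orbT; apply: pK.
Qed.

(** In a shortest chain a point of link [j] closer than [j] to [x] would give a shortcut, so link
    [j] only has points at distance [j] or [j + 1] from [x]. Links whose indices differ by at least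
    2 are thus disjoint, which is how chains are cut into disjoint clusters. *)
Lemma geodesic_chain (D : set V) x y : D x -> conn D x y ->
  exists (n : nat) (p : nat -> V) (K : nat -> set V),
  [/\ p 0 = x, p n = y,
      forall j, (j < n)%N -> [/\ K j `<=` D, small (K j), K j (p j) & K j (p j.+1)],
      forall i j, (i <= j <= n)%N -> dle D (j - i) (p i) (p j) &
      forall j z, (j < n)%N -> K j z ->
        dle D j.+1 x z /\ forall k, (k < j)%N -> ~ dle D k x z].
Proof.
move=> Dx xy.
have Pex : exists n, `[< dle D n x y >].
  by have [n xyn] := conn_dle xy; exists n; apply/asboolP.
case: (ex_minnP Pex) => n /asboolP xyn nmin.
have [p [K [p0 pn pK]]] := dle_chain xyn.
have pij i j : (i <= j <= n)%N -> dle D (j - i) (p i) (p j).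
  move=> /andP[/subnK <-]; rewrite addnK.
  elim: (j - i)%N => // k IHk kn; have kn' : (k + i < n)%N by [].
  exists (p (k + i)%N); first exact/IHk/ltnW.
  by have [KD sK Kj Kj1] := pK _ kn'; exists (K (k + i)%N).
exists n, p, K; split=> // j z jn Kz; have [KD sK Kj Kj1] := pK _ jn; split.
  exists (p j); last by exists (K j).
  by have := pij 0 j; rewrite subn0 p0; apply; rewrite leq0n ltnW.
move=> k kj xz.
have : dle D (k.+1 + (n - j.+1)) x y.
  apply: (dle_trans (y := p j.+1)); first by exists z => //; exists (K j).
  by rewrite -pn; apply: pij; rewrite jn leqnn.
by move/asboolP/nmin; lia.
Qed.

End StringMetric.

(** * Clusters *)

Section Absorption.
Variables (V : choiceType) (adj cl : V -> V -> Prop).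
Hypothesis adj_symm : forall x y, adj x y -> adj y x.
Hypothesis cl_refl : forall x, cl x x.
Hypothesis cl_symm : forall x y, cl x y -> cl y x.
Hypothesis adj_cl : forall x y, adj x y -> cl x y.
Local Notation conn := (conn adj).
Local Notation small := (small adj cl).
Local Notation st := (st adj cl).
Local Notation dle := (dle adj cl).

(* [asg x = Some (c, o)]: the vertex [x] lies in the cluster of center [o] of
   the supernode number [c]. *)
Definition assignment := V -> option (nat * V).
Implicit Types asg : assignment.

Definition extends asg asg' := forall x p, asg x = Some p -> asg' x = Some p.
Definition clu asg c o : set V := [set x | asg x = Some (c, o)].

Lemma extends_trans asg1 asg2 asg3 :
  extends asg1 asg2 -> extends asg2 asg3 -> extends asg1 asg3.
Proof. by move=> h12 h23 x p /h12/h23. Qed.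

Lemma extends_None asg asg' x : extends asg asg' -> asg' x = None -> asg x = None.
Proof. by move=> h; case E: (asg x) => [p|//]; rewrite (h _ _ E). Qed.

Variables (Dm : nat -> set V) (asg0 : assignment).
Variables (el : V -> nat -> Prop) (rb : V -> nat -> nat) (K : nat).
Hypothesis conn0 : forall w c o, asg0 w = Some (c, o) -> conn (clu asg0 c o) o w.
Hypothesis dom0 : forall c o, asg0 o = Some (c, o) -> Dm c o.
Hypothesis cand_fin : finite_set [set x | exists c o,
  [/\ el x c, asg0 o = Some (c, o) & dle (Dm c) (rb x c + 4 * K) o x]].

(** Growth creates no center: a new vertex joins the cluster of a center of [asg0], at a distance
    measured in the domain of the supernode, with an allowance that increases by 4 in each round. *)
Definition grown k asg := extends asg0 asg /\
  forall x c o, asg0 x = None -> asg x = Some (c, o) ->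
  [/\ el x c, asg0 o = Some (c, o), dle (Dm c) (rb x c + 4 * k) o x &
      conn (clu asg c o) o x].

Definition saturated k asg := forall x c o w,
  asg x = None -> el x c -> asg0 o = Some (c, o) -> asg w = Some (c, o) ->
  adj w x -> ~ dle (Dm c) (rb x c + 4 * k) o x.

Lemma clu_extends asg asg' c o : extends asg asg' -> clu asg c o `<=` clu asg' c o.
Proof. by move=> h x /h. Qed.

(** Vertices are added one at a time, and only the finitely many candidates of [cand_fin] can ever
    be added. *)
Lemma saturate k asg : (k <= K)%N -> grown k asg ->
  exists asg', [/\ extends asg asg', grown k asg' & saturated k asg'].
Proof.
move=> kK; have /finite_seqP[s sE] := cand_fin.
have [n] := ubnP (count (fun x => asg x == None) s).
elim: n asg => // n IHn asg sz [e0 gr].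
case: (pselect (saturated k asg)) => [|nsat]; first by exists asg; split=> // x p.
have [x [c [ o [w [xN elx oo wo [wx dx]]]]]] : exists x c o w,
    [/\ asg x = None, el x c, asg0 o = Some (c, o), asg w = Some (c, o) &
        adj w x /\ dle (Dm c) (rb x c + 4 * k) o x].
  apply: contrapT => nex; apply: nsat => x c o w xN elx oo wo wx dx; apply: nex.
  by exists x, c, o, w.
pose asg' z := if z == x then Some (c, o) else asg z.
have ext' : extends asg asg'.
  by move=> z p zp; rewrite /asg'; case: eqP => // zx; rewrite zx xN in zp.
have gr' : grown k asg'.
  split=> [|z c' o' zN]; first exact: extends_trans ext'.
  rewrite /asg'; case: eqP => [-> [<- <-]|_ /gr[]//]; last first.
    by move=> h1 h2 h3 h4; split=> //; apply: conn_sub h4; apply: clu_extends.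
  split=> //; apply: (@conn_step _ _ _ _ w) => //; last by rewrite /clu/= /asg' eqxx.
  apply: conn_sub (clu_extends ext') _.
  case: (asg0 w =P None) => [wN|]; first by have [] := gr _ _ _ wN wo.
  case E: (asg0 w) => [[c1 o1]|//] _; move: (e0 _ _ E); rewrite wo => -[c1E o1E].
  apply: conn_sub (clu_extends e0) _; apply: conn0.
  by rewrite E -c1E -o1E.
case: (IHn asg' _ gr') => [|asg2 [h1 h2 h3]]; last first.
  by exists asg2; split=> //; apply: extends_trans h1.
have xs : x \in s.
  have : [set` s] x.
    rewrite -sE; exists c, o; split=> //; apply: dle_leq dx => //; last lia.
    exact: dom0.
  by [].
have : (count (fun z => asg' z == None) s < count (fun z => asg z == None) s)%N.
  have /permP ps := perm_to_rem xs.
  rewrite !ps /= xN eqxx /asg' eqxx /= add0n add1n ltnS.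
  by apply: sub_count => z /=; case: (z =P x).
by move=> lt; apply: leq_trans lt _; rewrite -ltnS.
Qed.

(** If [x] survived the rounds 0 to [K], each round [j] would exhibit a center whose distance to [x]
    lies between [rb x c + 4 * j] and [rb x c + 4 * j + 2], the lower bound coming from saturation.
    A center determines its [c], and these windows are disjoint for distinct [j], so [K + 1]
    distinct centers would lie near [x], against the last hypothesis. *)
Lemma absorption : exists asg', grown K asg' /\
  forall x (P : set V), P x -> small P ->
  (forall z, P z -> asg0 z = None) ->
  (forall z c, P z -> el z c -> el x c) ->
  (forall z c, P z -> el x c -> [/\ el z c, rb z c = rb x c & Dm c z]) ->
  (exists z0 w0 c0 o0, [/\ P z0, adj z0 w0, asg0 w0 = Some (c0, o0) & el x c0] /\
     asg0 o0 = Some (c0, o0) /\ dle (Dm c0) (rb x c0) o0 w0) ->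
  (forall s : seq V, uniq s ->
     (forall o, o \in s -> exists c, [/\ asg0 o = Some (c, o), el x c &
        dle (Dm c) (rb x c + 4 * K + 2) o x]) -> (size s <= K)%N) ->
  asg' x <> None.
Proof.
have [F [Fgr Fext Fsat]] : exists F : nat -> assignment,
    [/\ forall j, (j <= K)%N -> grown j (F j),
        forall j, (j < K)%N -> extends (F j) (F j.+1) &
        forall j, (j <= K)%N -> saturated j (F j)].
  suff H k : (k <= K)%N -> exists F : nat -> assignment,
    [/\ forall j, (j <= k)%N -> grown j (F j),
        forall j, (j < k)%N -> extends (F j) (F j.+1) &
        forall j, (j <= k)%N -> saturated j (F j)] by apply: H.
  elim: k => [_|k IHk kK].
    have [||asg [_ h2 h3]] := @saturate 0 asg0; rewrite //.
      by split=> // x c o ->.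
    by exists (fun=> asg); split=> // [[]|[]].
  have [F [Fgr Fext Fsat]] := IHk (ltnW kK).
  have [||asg [h1 h2 h3]] := @saturate k.+1 (F k); rewrite //.
    have [e0 gr] := Fgr k (leqnn k); split=> // x c o xN xo.
    have [g1 g2 g3 g4] := gr x c o xN xo; split=> //.
    by apply: dle_leq g3 => //; [apply: dom0|lia].
  exists (fun j => if (j <= k)%N then F j else asg); split=> j.
  - rewrite leq_eqVlt ltnS => /orP[/eqP->|jk]; first by rewrite ltnn.
    by rewrite jk; apply: Fgr.
  - rewrite ltnS => jk; rewrite jk; case: (ltnP j k) => [/Fext//|kj].
    by have -> : j = k by lia.
  - rewrite leq_eqVlt ltnS => /orP[/eqP->|jk]; first by rewrite ltnn.
    by rewrite jk; apply: Fsat.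
have FK j : (j <= K)%N -> extends (F j) (F K).
  move=> jK; have [k kE] : exists k, K = (j + k)%N by exists (K - j)%N; lia.
  elim: k j jK kE => [|k IHk] j jK kE; first by have -> : j = K by lia.
  by apply: (extends_trans (asg2 := F j.+1)); [apply: Fext; lia|apply: IHk; lia].
exists (F K); split; first exact: Fgr.
move=> x P Px [Pconn Psm] PN Pel1 Pel2 [z0 [w0 [c0 [ o0 [[Pz0 zw0 w0E el0] [ o0E d0]]]]]] cnt xN.
have win j : (j <= K)%N -> exists o c, [/\ asg0 o = Some (c, o), el x c,
    dle (Dm c) (rb x c + 4 * j + 2) o x &
    forall r, (r < rb x c + 4 * j)%N -> ~ dle (Dm c) r o x].
  move=> jK; have [e0 gr] := Fgr _ jK.
  (* A free [w'] of [P] next to an assigned [w]. The steps from [w] to [w'] and, inside [P], from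
     [w'] to [x] give the [+ 2]. Saturation refused [w'], which is one step from [x], hence the
     lower bound. *)
  suff [w' [w [c [ o [Pw' w'N ww' wo [elc oo dw]]]]]] : exists w' w c o,
      [/\ P w', F j w' = None, adj w w', F j w = Some (c, o) &
       [/\ el x c, asg0 o = Some (c, o) & dle (Dm c) (rb x c + 4 * j) o w]].
    have [elw' rbE Dw'] := Pel2 _ _ Pw' elc.
    have ndw' : ~ dle (Dm c) (rb x c + 4 * j) o w'.
      by rewrite -rbE; apply: (Fsat _ jK) wo ww'.
    have Do := dom0 oo; have Dw := dle_r Do dw.
    have w'x : st (Dm c) w' x.
      by exists P; split=> // z Pz; have [] := Pel2 _ _ Pz elc.
    exists o, c; split=> // [|r rj rx].
      rewrite addn2; exists w' => //; exists w => //.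
      exact: st_adj.
    apply: ndw'; apply: (@dle_leq _ _ _ cl_refl _ r.+1) => //.
    by exists x => //; apply: st_sym.
  case E: (F j z0) => [[c1 o1]|]; last first.
    exists z0, w0, c0, o0; split=> //; first exact: adj_symm.
      exact: e0.
    by split=> //; apply: dle_leq d0 => //; [apply: dom0|lia].
  have Fx : F j x = None by apply: extends_None (FK _ jK) xN.
  have nTx : ~ [set z | F j z <> None] x by rewrite /= Fx.
  have Tz0 : [set z | F j z <> None] z0 by rewrite /= E.
  have [w' [w [cw' w'w Pw Fw]]] := conn_exit adj_symm (Pconn _ _ Px Pz0) nTx Tz0.
  case Ew: (F j w) Fw => [[c o]|//] _.
  have [g1 g2 g3 g4] := gr _ _ _ (PN _ Pw) Ew.
  have elx := Pel1 _ _ Pw g1.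
  have [Pw' nw'] := conn_r cw'.
  exists w', w, c, o; split=> //.
  - by apply: contrapT.
  - exact: adj_symm.
  - by split=> //; have [_ <- _] := Pel2 _ _ Pw elx.
have {win} /choice[g gP] : forall j, exists o, (j <= K)%N -> exists c,
    [/\ asg0 o = Some (c, o), el x c,
    dle (Dm c) (rb x c + 4 * j + 2) o x &
    forall r, (r < rb x c + 4 * j)%N -> ~ dle (Dm c) r o x].
  move=> j; case: (leqP j K) => jK; last by exists x.
  by have [ o [c h]] := win j jK; exists o => _; exists c.
have : (size [seq g j | j <- iota 0 K.+1] <= K)%N.
  apply: cnt => [|o /mapP[j]]; last first.
    rewrite mem_iota add0n ltnS => /= jK ->; have [c [h1 h2 h3 _]] := gP _ jK.
    by exists c; split=> //; apply: dle_leq h3 => //; [apply: dom0|lia].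
  rewrite map_inj_in_uniq ?iota_uniq // => i j.
  rewrite !mem_iota !add0n !ltnS /= => iK jK gij.
  wlog ij : i j iK jK gij / (i < j)%N => [H|].
    by case: (ltngtP i j) => // ij; [apply: H|symmetry; apply: H].
  have [c [h1 h2 h3 _]] := gP _ iK; have [c' [h1' _ _ h4']] := gP _ jK.
  move: h1'; rewrite -gij h1 => -[cE]; rewrite -cE -gij in h4'.
  by case: (h4' (rb x c + 4 * i + 2)%N) => //; lia.
by rewrite size_map size_iota ltnn.
Qed.
End Absorption.

Lemma size_colors (T : eqType) (f : T -> nat) (l : seq nat) (m : nat) (s : seq T) :
  (forall x, x \in s -> f x \in l) ->
  (forall c, c \in l -> (count (fun x => f x == c) s <= m)%N) ->
  (size s <= size l * m)%N.
Proof.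
elim: l s => [|c l IHl] s fl cnt.
  by case: s fl {cnt} => // x s /(_ x); rewrite mem_head => /(_ isT).
rewrite -(count_predC (fun x => f x == c)) /= mulSn leq_add ?cnt ?mem_head //.
rewrite -size_filter; apply: IHl => [x|d dl].
  by rewrite mem_filter => /andP[/= /negPf fx /fl]; rewrite inE fx.
rewrite count_filter; apply: leq_trans (cnt d _); last by rewrite inE dl orbT.
by apply: sub_count => x /= /andP[].
Qed.

(** * Supernodes and the invariants of the decomposition *)

Section Supernodes.
Variables (V : choiceType) (adj cl : V -> V -> Prop).
Hypothesis adj_symm : forall x y, adj x y -> adj y x.
Hypothesis cl_refl : forall x, cl x x.
Hypothesis cl_symm : forall x y, cl x y -> cl y x.
Hypothesis adj_cl : forall x y, adj x y -> cl x y.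
Hypothesis cl_finite : forall x, finite_set [set y | cl x y].
Local Notation conn := (conn adj).
Local Notation connected_set := (connected_set adj).
Local Notation small := (small adj cl).
Local Notation st := (st adj cl).
Local Notation dle := (dle adj cl).
Hypothesis noK5 : forall A : nat -> set V,
  (forall i, (i < 5)%N -> connected_set (A i)) ->
  (forall i j x, (i < j < 5)%N -> A i x -> A j x -> False) ->
  (forall i j, (i < j < 5)%N -> exists x y, [/\ A i x, A j y & adj x y]) -> False.

(* The spacing [W] of the centers on a skeleton dominates the total growth
   [4 * G] of a cluster, which is what keeps the number of centers near a
   point below [m] while [3 * m + 1] rounds of absorption take place. *)
Variables (m K G W : nat).
Hypothesis mE : m = 22.
Hypothesis KE : K = (3 * m)%N.
Hypothesis GE : G = (4 * K + 4)%N.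
Hypothesis WE : W = (4 * G)%N.
(** Radius after [g] growth rounds: a fresh cluster has radius at most [W + 12 * K], which is below
    [2 * W], and a round adds [4 * K], which is below [G]. *)
Definition Rad g := (2 * W + g * G)%N.

Local Notation assignment := (assignment V).
Implicit Types (asg : assignment) (Dm : nat -> set V).

Definition un asg : set V := [set x | asg x = None].
Definition eta asg i : set V := [set x | exists o, asg x = Some (i, o)].
Definition Wge asg i : set V :=
  [set x | forall j o, asg x = Some (j, o) -> (i <= j)%N].
Definition sees asg i u :=
  exists x y, [/\ eta asg i x, adj x y & conn (un asg) u y].
(** All that supernode [i] may ever own: later growth stays within the free components that it
    touches. *)
Definition terr asg i : set V :=
  [set x | eta asg i x \/ un asg x /\ sees asg i x].
Definition Wd asg Dm i : set V := Dm i `&` Wge asg i.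
(** Closeness, as opposed to the contact expressed by [sees]: some small set avoiding the supernodes
    older than [i] joins the possible future of [i] to the component of [u]. *)
Definition live asg Dm i u := Dm i u /\ exists x y,
  [/\ terr asg i x, conn (un asg) u y & st (Wd asg Dm i) x y].
(** The potential of the construction: how many older supernodes may still force the clusters of [c]
    to grow into the component of [u]. *)
Definition kap asg Dm c u := count (fun i => `[< live asg Dm i u >]) (iota 0 c).

(** By [b_cls], [Dm i] cannot be left without crossing a supernode older than [i]. By [b_adj], the
    supernodes around one free component touch each other, which is what produces a K5. By [b_rad],
    a cluster of [c] bordering the component of [u] has there at most the radius of [3 - kap]
    rounds, so it can afford one more for each older supernode live on that component. *)
Record basic n asg Dm : Prop := Basic {
  b_idx : forall x i o, asg x = Some (i, o) ->
    [/\ (i < n)%N, Dm i x, asg o = Some (i, o), conn (clu asg i o) o x &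
        dle (Dm i) (Rad 3) o x] ;
  b_fin : finite_set [set x | asg x <> None] ;
  b_eta : forall i, connected_set (eta asg i) ;
  b_cls : forall i x y, (i < n)%N -> Dm i x -> adj x y -> Wge asg i y -> Dm i y ;
  b_mult : forall i x (s : seq V), uniq s ->
    (forall o, o \in s -> asg o = Some (i, o) /\ dle (Dm i) (Rad 4) o x) ->
    (size s <= m)%N ;
  b_adj : forall i j u, (i < j)%N -> sees asg i u -> sees asg j u ->
    exists x y, [/\ eta asg i x, eta asg j y & adj x y] ;
  b_rad : forall u c y o y', asg y = Some (c, o) -> adj y y' ->
    conn (un asg) u y' -> dle (Dm c) (Rad (3 - kap asg Dm c u)) o y ;
  b_kap : forall u c, un asg u -> (c < n)%N -> (kap asg Dm c u <= 3)%N }.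

(** Closeness entails contact; by the K5 count, at most three supernodes are then live on a free
    component. *)
Definition good n asg Dm := basic n asg Dm /\
  forall i u, (i < n)%N -> un asg u -> live asg Dm i u -> sees asg i u.

Lemma un_Wge asg i : un asg `<=` Wge asg i.
Proof. by move=> x xN j o; rewrite (xN : asg x = None). Qed.

Lemma eta_un asg i x : eta asg i x -> un asg x -> False.
Proof. by move=> [ o xo] /=; rewrite /un/= xo. Qed.

Lemma sees_conn asg i u v : conn (un asg) u v -> sees asg i u -> sees asg i v.
Proof.
move=> uv [x [y [ix xy uy]]]; exists x, y; split=> //.
by apply: conn_trans uy; apply: conn_sym.
Qed.

Section BasicTheory.
Variables (n : nat) (asg : assignment) (Dm : nat -> set V).
Hypothesis B : basic n asg Dm.

Lemma eta_lt i x : eta asg i x -> (i < n)%N.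
Proof. by move=> [ o /(b_idx B)[]]. Qed.

Lemma eta_dom i x : eta asg i x -> Dm i x.
Proof. by move=> [ o /(b_idx B)[]]. Qed.

Lemma sees_lt i u : sees asg i u -> (i < n)%N.
Proof. by move=> [x [y [/eta_lt]]]. Qed.

Lemma center_dom i o : asg o = Some (i, o) -> Dm i o.
Proof. by move/(b_idx B)=> []. Qed.

Lemma conn_dom i u v : (i < n)%N -> conn (un asg) u v -> Dm i u -> Dm i v.
Proof.
move=> ni uv Du; elim: uv => // y z _ Dy yz uz.
exact: (b_cls B ni Dy yz (un_Wge _ uz)).
Qed.

Lemma sees_dom i u : sees asg i u -> Dm i u.
Proof.
move=> iu; have ni := sees_lt iu; move: iu => [x [y [ix xy uy]]].
apply: (conn_dom ni (conn_sym adj_symm uy)).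
by apply: (b_cls B ni (eta_dom ix) xy); apply: un_Wge; apply: conn_r uy.
Qed.

Lemma live_conn i u v : (i < n)%N -> conn (un asg) u v ->
  live asg Dm i u -> live asg Dm i v.
Proof.
move=> ni uv [Du [x [y [ix uy xy]]]]; split; first exact: conn_dom uv Du.
by exists x, y; split=> //; apply: conn_trans uy; apply: conn_sym.
Qed.

Lemma live_ext i u v : (i < n)%N -> conn (un asg) u v ->
  live asg Dm i u <-> live asg Dm i v.
Proof.
by move=> ni uv; split; apply: live_conn => //; apply: conn_sym.
Qed.

Lemma kap_ext c u v : (c <= n)%N -> conn (un asg) u v ->
  kap asg Dm c u = kap asg Dm c v.
Proof.
move=> cn uv; apply: eq_in_count => i; rewrite mem_iota add0n => /= ic.
by apply: asbool_equiv_eq; apply: (live_ext (leq_trans ic cn) uv).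
Qed.

(** Four supernodes around a component are pairwise adjacent by [b_adj], and the component itself is
    the fifth branch set of a K5 minor. *)
Lemma bag_le3 u (s : seq nat) : un asg u -> uniq s ->
  (forall i, i \in s -> sees asg i u) -> (size s <= 3)%N.
Proof.
move=> uN us sP; rewrite leqNgt; apply/negP => s4.
have nthP i : (i < 4)%N -> sees asg (nth 0 s i) u.
  by move=> i4; apply/sP/mem_nth/(leq_trans i4).
have nthne i j : (i < j < 4)%N -> nth 0 s i <> nth 0 s j.
  move=> /andP[ij j4] /eqP.
  have [is_ js] : (i < size s)%N /\ (j < size s)%N by lia.
  by rewrite nth_uniq // => /eqP; lia.
apply: (noK5 (A := fun i => if (i < 4)%N then eta asg (nth 0 s i)
                           else conn (un asg) u)).
- move=> i _; case: ifP => _; first exact: (b_eta B).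
  exact: connected_comp.
- move=> i j x /andP[ij j5]; have -> : (i < 4)%N by lia.
  case: ifP => [j4|_] ix; last by move/conn_r; apply: eta_un ix.
  move: ix => [ o xo] [ o']; rewrite xo => -[E _].
  by apply: (nthne i j) => //; rewrite ij.
- move=> i j /andP[ij j5]; have i4 : (i < 4)%N by lia.
  rewrite i4; case: ifP => [j4|_]; last first.
    by have [x [y [ix xy uy]]] := nthP _ i4; exists x, y.
  have := nthne i j; rewrite ij j4 => /(_ isT).
  case: (ltngtP (nth 0 s i) (nth 0 s j)) => // lt _.
    exact: (b_adj B lt (nthP _ i4) (nthP _ j4)).
  have [x [y [h1 h2 h3]]] := b_adj B lt (nthP _ j4) (nthP _ i4).
  by exists y, x; split=> //; apply: adj_symm.
Qed.

End BasicTheory.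

(** * Behaviour of the notions when supernodes grow inside their territories *)

Section Monotonicity.
Variables (n : nat) (asg asg' : assignment) (Dm Dm' : nat -> set V).
Hypothesis B : basic n asg Dm.
Hypothesis ext : extends asg asg'.
Hypothesis ext_terr : forall i x, (i < n)%N -> eta asg' i x -> terr asg i x.
Hypothesis DmE : forall i, (i < n)%N -> Dm' i = Dm i.

Lemma un_mono : un asg' `<=` un asg.
Proof. by move=> x; apply: extends_None. Qed.

Lemma eta_mono i : eta asg i `<=` eta asg' i.
Proof. by move=> x [ o /ext]; exists o. Qed.

Lemma Wge_mono i : Wge asg' i `<=` Wge asg i.
Proof. by move=> x h j o /ext/h. Qed.

Lemma sees_mono i u : (i < n)%N -> sees asg' i u -> sees asg i u.
Proof.
move=> ni [x [y [ix xy uy]]]; have uy' := conn_sub un_mono uy.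
case: (ext_terr ni ix) => [ix'|[xN xs]]; first by exists x, y.
apply: sees_conn xs; apply: conn_trans (conn_sym adj_symm uy').
by apply: conn_adj => //; apply: conn_r uy'.
Qed.

Lemma terr_mono i : (i < n)%N -> terr asg' i `<=` terr asg i.
Proof.
move=> ni x [/(ext_terr ni)//|[xN xs]]; right.
by split; [apply: un_mono|apply: sees_mono].
Qed.

Lemma live_mono i u : (i < n)%N -> live asg' Dm' i u -> live asg Dm i u.
Proof.
move=> ni [Du [x [y [ix uy xy]]]]; rewrite /live -DmE //; split=> //.
exists x, y; split; [exact: terr_mono|exact: conn_sub un_mono uy|].
by apply: st_sub xy => z [Dz Wz]; split; [rewrite -DmE|apply: Wge_mono].
Qed.

Lemma kap_mono c u : (c <= n)%N -> (kap asg' Dm' c u <= kap asg Dm c u)%N.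
Proof.
move=> cn; rewrite /kap -!size_filter; apply: uniq_leq_size.
  by rewrite filter_uniq // iota_uniq.
move=> i; rewrite !mem_filter => /andP[/asboolP h]; rewrite mem_iota => /andP[_ ic].
rewrite ic !andbT; apply/asboolP.
by apply: live_mono h; lia.
Qed.

End Monotonicity.

Lemma Rad_mono g h : (g <= h)%N -> (Rad g <= Rad h)%N.
Proof. by rewrite /Rad => gh; rewrite leq_add2l leq_mul2r gh orbT. Qed.

(* One growth round: in every component which is close to the territory of
   some [i] without touching supernode [i], the vertices close to that territory
   are absorbed by the younger supernodes that the component sees. *)
Lemma growth_round n asg Dm b : basic n asg Dm ->
  (forall u, un asg u -> (exists i, [/\ (i < n)%N, live asg Dm i u & ~ sees asg i u]) ->
     (kap asg Dm n u <= b.+1)%N) ->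
  exists asg', [/\ extends asg asg',
    forall i x, eta asg' i x -> terr asg i x, basic n asg' Dm &
    forall u, un asg' u ->
     (exists i, [/\ (i < n)%N, live asg' Dm i u & ~ sees asg' i u]) ->
     (kap asg' Dm n u <= b)%N].
Proof.
move=> B Hb.
pose bad u := [set i | [/\ (i < n)%N, live asg Dm i u & ~ sees asg i u]].
(* The choice goes through the set [bad u], so it is constant on a component. The default 0 only
   appears when nothing is bad. *)
pose ib u := xget 0 (bad u).
have badE u v : conn (un asg) u v -> bad u = bad v.
  move=> uv; apply/seteqP; split=> i [ni li si]; split=> //.
  - exact: (live_conn B ni uv li).
  - by move/(sees_conn (conn_sym adj_symm uv)).
  - exact: (live_conn B ni (conn_sym adj_symm uv) li).
  - by move/(sees_conn uv).
have ibP u i : bad u i -> bad u (ib u) by move=> h; apply: (xgetPex 0); exists i.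
pose el x c := [/\ un asg x, exists i, bad x i, (ib x < c)%N & sees asg c x].
pose rb x c := Rad (3 - kap asg Dm c x).
have elE x z c : conn (un asg) x z -> el x c -> el z c /\ rb z c = rb x c /\ Dm c z.
  move=> xz [xN [i bi] ic sc].
  have cn := sees_lt B sc.
  rewrite /rb (kap_ext B (ltnW cn) xz); split; last first.
    by split=> //; apply: (sees_dom B); apply: sees_conn sc.
  split; [exact: conn_r xz|by exists i; rewrite -(badE _ _ xz)| |exact: sees_conn sc].
  by rewrite /ib -(badE _ _ xz).
have rb3 x c : (rb x c <= Rad 3)%N by apply: Rad_mono; lia.
have candF : finite_set [set x | exists c o,
    [/\ el x c, asg o = Some (c, o) & dle (Dm c) (rb x c + 4 * K) o x]].
  apply: (@sub_finite_set _ _ (\bigcup_(o in [set o | asg o <> None])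
     \bigcup_(c in [set c | (c < n)%N]) [set x | dle (Dm c) (Rad 3 + 4 * K) o x])).
    move=> x [c [ o [_ oo ox]]]; exists o; first by rewrite /= oo.
    have [cn Do _ _ _] := b_idx B oo.
    by exists c => //=; apply: dle_leq ox => //; rewrite leq_add2r.
  apply: bigcup_finite; first exact: (b_fin B).
  move=> o _; apply: bigcup_finite => [|c _]; last exact: dle_finite.
  exact: finite_II.
have conn0 w c o : asg w = Some (c, o) -> conn (clu asg c o) o w.
  by move/(b_idx B) => [].
have [asg' [[ext gr] abs]] := absorption adj_symm cl_refl cl_symm adj_cl conn0
  (center_dom B) candF.
have e2 i x : eta asg' i x -> terr asg i x.
  move=> [ o xo]; case E: (asg x) => [[j o']|].
    by left; exists o; rewrite E -xo (ext _ _ E).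
  by right; split=> //; have [[_ _ _ si] _ _ _] := gr _ _ _ E xo.
have e2' i x : (i < n)%N -> eta asg' i x -> terr asg i x by move=> _; apply: e2.
have Dm0 i : (i < n)%N -> Dm i = Dm i by [].
have old u : un asg' u -> un asg u by apply: (un_mono ext).
have oldc u v : conn (un asg') u v -> conn (un asg) u v.
  by apply: conn_sub; apply: (un_mono ext).
(* If [ib u] were still live, a small set [L] would join its territory to a free [y]. The free part
   of [L] around [y] borders a younger supernode, so [y] should have been absorbed. *)
have kill u : un asg' u -> bad u (ib u) -> ~ live asg' Dm (ib u) u.
  move=> uN bu [Du [a [y [ta uy [L [LW sL La Ly]]]]]].
  have yN := conn_r uy; have uy' := oldc _ _ uy.
  have ibE : ib u = ib y by rewrite /ib (badE _ _ uy').
  have by_ : bad y (ib y) by rewrite -(badE _ _ uy') -ibE.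
  have [ni _ nsee] := by_; rewrite ibE in ta LW.
  have PL : conn (L `&` un asg) y `<=` L `&` un asg by move=> z /conn_r.
  have Py : conn (L `&` un asg) y y by apply: conn_refl; split=> //; apply: old.
  have Pun : conn (L `&` un asg) y `<=` conn (un asg) y.
    by move=> z; apply: conn_sub => t [].
  have yN' := yN; apply: (abs y (conn (L `&` un asg) y)) yN' => //.
  - by apply: small_sub sL _ _; [move=> z /PL[]|apply: connected_comp].
  - by move=> z /PL[].
  - by move=> z c /Pun zy zc; have [] := elE _ _ _ (conn_sym adj_symm zy) zc.
  - by move=> z c /Pun zy zc; have [? []] := elE _ _ _ zy zc.
  - have [cL _] := sL.
    (* Follow [L] from [y] towards the territory. If the walk stays free, [y] sees [ib y], which is
       excluded. Otherwise its first assigned vertex belongs to a supernode that is not older than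
       [ib y], as [L] avoids those, and that is not [ib y], which is unseen. *)
    case: (conn_split adj_symm [set z | asg z <> None] (cL _ _ Ly La)).
      move=> ya; exfalso; apply: nsee.
      have ya' : conn (un asg) y a.
        by apply: conn_sub ya => z [_ /= /contrapT].
      case: (terr_mono ext e2' ni ta) => [ia|[_ ia]].
        by exfalso; apply: (eta_un ia); apply: conn_r ya'.
      by apply: sees_conn ia; apply: conn_sym.
    move=> [t [_ [[Lt Tt] _ at_ _]]]; case Et: (asg t) Tt => [[c o]|//] _.
    case: at_ => [yt|[x1 yx1 x1t]].
      by have := old _ yN; rewrite /un/= yt Et.
    have yx1' : conn (L `&` un asg) y x1.
      by apply: conn_sub yx1 => z [Lz /= /contrapT].
    have sc : sees asg c y.
      exists t, x1; split; [by exists o|exact: adj_symm|exact: Pun].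
    have cn := sees_lt B sc.
    have [_ Wt] := LW _ Lt; have := Wt c o (ext _ _ Et).
    rewrite leq_eqVlt => /orP[/eqP ic|ic]; first by case: nsee; rewrite ic.
    exists x1, t, c, o; split; first split=> //.
      by split=> //; [apply: old|exists (ib y)].
    split; first by have [] := b_idx B Et.
    exact: (b_rad B Et (adj_symm x1t) (Pun _ yx1')).
  (* At most three supernodes see [y], and each has at most [m] centers within [Rad 4]: this is the
     origin of [K = 3 * m]. *)
  - move=> s us sP.
    pose col o := if asg o is Some (c, _) then c else 0.
    have sE o : o \in s -> exists c, [/\ asg o = Some (c, o), sees asg c y &
        dle (Dm c) (Rad 4) o y].
      move=> /sP[c [oo [_ _ _ sc] d]]; exists c; split=> //.
      apply: dle_leq d => //; first exact: (center_dom B oo).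
      by have := rb3 y c; rewrite /Rad; lia.
    have : (size s <= size (undup (map col s)) * m)%N.
      apply: (@size_colors _ col) => [x xs|c].
        by rewrite mem_undup map_f.
      rewrite mem_undup => /mapP[ o0 _ cE]; rewrite -size_filter.
      apply: (b_mult B (i := c) (x := y)); first exact: filter_uniq.
      move=> o; rewrite mem_filter => /andP[/eqP oc os].
      have [c' [oo sc d]] := sE _ os.
      by move: oc; rewrite /col oo => <-.
    have : (size (undup (map col s)) <= 3)%N.
      apply: (bag_le3 B (old _ yN)); first exact: undup_uniq.
      move=> c; rewrite mem_undup => /mapP[ o os ->].
      by have [c' [oo sc d]] := sE _ os; rewrite /col oo.
    by rewrite KE; nia.
have kapS u c : un asg' u -> bad u (ib u) -> (ib u < c <= n)%N ->
    (kap asg' Dm c u < kap asg Dm c u)%N.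
  move=> uN bu /andP[ic cn]; have nl := kill _ uN bu.
  rewrite /kap -!size_filter.
  have -> : (size [seq i <- iota 0 c | `[< live asg' Dm i u >]]).+1 =
    size (ib u :: [seq i <- iota 0 c | `[< live asg' Dm i u >]]) by [].
  apply: uniq_leq_size => [|i]; rewrite /= ?filter_uniq ?iota_uniq // ?andbT.
    by rewrite mem_filter; apply/negP => /andP[/asboolP].
  rewrite inE !mem_filter !mem_iota !add0n /= => /orP[/eqP->|/andP[/asboolP li ic']].
    by rewrite ic andbT; apply/asboolP; have [] := bu.
  rewrite ic' andbT; apply/asboolP.
  by apply: (live_mono ext e2' Dm0) li; lia.
exists asg'; split=> //; last first.
  move=> u uN [i [ni li nsi]].
  have [[i0 bi0]|nbad] := pselect (exists i0, bad u i0).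
    have bu := ibP _ _ bi0; have [ibn _ _] := bu.
    have := kapS _ n uN bu; rewrite ibn leqnn => /(_ isT).
    have := Hb u (old _ uN); move=> /(_ (ex_intro _ i0 bi0)); lia.
  exfalso; apply: (nbad); exists i; split=> //.
    exact: (live_mono ext e2' Dm0 ni li).
  move=> [x [y [ix xy uy]]]; apply: nsi.
  exists x, y; split=> //; first exact: (eta_mono ext).
  elim: uy {xy} => [_|z t uz IH zt tN]; first exact: conn_refl.
  apply: (conn_step IH zt); case E: (asg' t) => [[c o]|]; rewrite /un/= ?E //.
  have [[_ [i0 bi0] _ _] _ _ _] := gr _ _ _ tN E; exfalso; apply: nbad; exists i0.
  by rewrite (badE _ _ (conn_step uz zt tN)).
have lt' i u : sees asg' i u -> (i < n)%N.
  by move=> [x [y [/e2[/(eta_lt B)//|[_ /(sees_lt B)]]]]].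
constructor.
- move=> x i o xo; case E: (asg x) => [[j o']|].
    move: (ext _ _ E); rewrite xo => -[jE oE]; rewrite -jE -oE in E.
    have [h1 h2 h3 h4 h5] := b_idx B E; split=> //; first exact: ext.
    by apply: conn_sub h4; apply: clu_extends.
  have [[xN [i0 bi0] ibi si] oo d cc] := gr _ _ _ E xo.
  split=> //; [exact: (sees_lt B si)|exact: (sees_dom B si)|exact: ext|].
  apply: dle_leq d => //; first exact: (center_dom B oo).
  (* The supernode [ib x] is live and older than [i], so [kap] is positive and the growth started
     from radius at most [Rad 2]. *)
  have [ni0 lib _] := ibP _ _ bi0.
  have : (0 < kap asg Dm i x)%N.
    rewrite /kap -has_count; apply/hasP; exists (ib x); last exact/asboolP.
    by rewrite mem_iota add0n ibi.
  by rewrite /rb /Rad; nia.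
- apply: (@sub_finite_set _ _ ([set x | asg x <> None] `|` [set x | exists c o,
    [/\ el x c, asg o = Some (c, o) & dle (Dm c) (rb x c + 4 * K) o x]])).
    move=> x /=; case E: (asg x) => [p|] xN; [by left|right].
    case E': (asg' x) xN => [[c o]|//] _.
    by have [h1 h2 h3 _] := gr _ _ _ E E'; exists c, o.
  by rewrite finite_setU; split=> //; exact: (b_fin B).
- move=> i x y [ o xo] [ o' yo].
  have cenP z oz : asg' z = Some (i, oz) -> asg oz = Some (i, oz) /\
      conn (eta asg' i) oz z.
    move=> zE; case E: (asg z) => [[j o2]|].
      move: (ext _ _ E); rewrite zE => -[jE oE]; rewrite -jE -oE in E.
      have [_ _ h3 h4 _] := b_idx B E; split=> //.
      by apply: conn_sub h4 => t /ext tE; exists oz.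
    have [_ oo _ cc] := gr _ _ _ E zE; split=> //.
    by apply: conn_sub cc => t tE; exists oz.
  have [oo cx] := cenP _ _ xo; have [oo' cy] := cenP _ _ yo.
  apply: conn_trans (conn_sym adj_symm cx) _; apply: conn_trans cy.
  apply: conn_sub (eta_mono ext (i := i)) _.
  by apply: (b_eta B); [exists o|exists o'].
- move=> i x y ni Dx xy Wy; apply: (b_cls B ni Dx xy).
  exact: (Wge_mono ext).
- move=> i x s us sP; apply: (b_mult B (i := i) (x := x) us) => o os.
  have [oo d] := sP _ os; split=> //.
  case E: (asg o) => [[j o']|]; first by rewrite -(ext _ _ E) in oo *.
  by have [_ h _ _] := gr _ _ _ E oo; rewrite E in h.
- move=> i j u ij si sj.
  have [x [y [hx hy xy]]] := b_adj B ij
    (sees_mono ext e2' (ltn_trans ij (lt' _ _ sj)) si) (sees_mono ext e2' (lt' _ _ sj) sj).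
  by exists x, y; split=> //; apply: (eta_mono ext).
- move=> u c y o y' yo yy' uy'.
  have uN := conn_l uy'; have cn : (c < n)%N by apply: (lt' _ u); exists y, y'; split=> //; exists o.
  have kle := kap_mono ext e2' Dm0 u (ltnW cn).
  case E: (asg y) => [[j o']|].
    move: (ext _ _ E); rewrite yo => -[jE oE]; rewrite -jE -oE in E.
    have := b_rad B E yy' (oldc _ _ uy'); apply: dle_leq => //.
      by have [_ _ /(center_dom B)] := b_idx B E.
    by apply: Rad_mono; lia.
  have [[_ [i0 bi0] iby sy] oo d cc] := gr _ _ _ E yo.
  have yu : conn (un asg) y u.
    apply: conn_sym => //; apply: conn_trans (oldc _ _ uy') _.
    by apply: conn_adj => //; [apply: old; apply: conn_r uy'|apply: adj_symm].
  have ibE : ib y = ib u by rewrite /ib (badE _ _ yu).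
  have bu : bad u (ib u) by rewrite (badE _ _ yu) in bi0; apply: ibP bi0.
  (* The drop of [kap] raises the allowance [Rad (3 - kap)] by at least [G], which pays for the
     [4 * K] of this round. *)
  have := kapS u c uN bu; rewrite -ibE iby (ltnW cn) => /(_ isT) klt.
  have := b_kap B (old _ uN) cn => k3.
  apply: dle_leq d => //; first exact: (center_dom B oo).
  by rewrite /rb (kap_ext B (ltnW cn) yu) /Rad; nia.
- move=> u c uN cn; apply: leq_trans (b_kap B (old _ uN) cn).
  exact: (kap_mono ext e2' Dm0 u (ltnW cn)).
Qed.

(** A round lowers [kap] on every component that stays bad, and a bad component has positive [kap];
    starting from 4, four rounds leave none. *)
Lemma growth n asg Dm : basic n asg Dm ->
  (forall u, un asg u -> (kap asg Dm n u <= 4)%N) ->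
  exists asg', [/\ extends asg asg',
    forall i x, eta asg' i x -> terr asg i x & good n asg' Dm].
Proof.
move=> B H.
have {}H : forall u, un asg u ->
    (exists i, [/\ (i < n)%N, live asg Dm i u & ~ sees asg i u]) ->
     (kap asg Dm n u <= 4)%N by move=> u /H.
move: 4 H => b; elim: b asg B => [|b IHb] asg B H.
  exists asg; split=> //; first by move=> i x; left.
  split=> // i u ni uN li; apply: contrapT => nsi.
  have : (0 < kap asg Dm n u)%N.
    rewrite /kap -has_count; apply/hasP; exists i; last exact/asboolP.
    by rewrite mem_iota add0n ni.
  by have := H u uN (ex_intro _ i (And3 ni li nsi)); lia.
have [asg1 [e1 t1 B1 H1]] := growth_round B H.
have [asg2 [e2 t2 B2]] := IHb _ B1 H1.
exists asg2; split=> //; first exact: extends_trans e2.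
move=> i x /t2 h.
case: (ltnP i n) => ni; first exact: (terr_mono e1 (fun i x _ => @t1 i x) ni).
case: h => [/t1//|[_ /(sees_lt B1)]]; lia.
Qed.

Lemma size_window (s : seq nat) d : uniq s ->
  (forall a b, a \in s -> b \in s -> (b <= a + d)%N) -> (size s <= d.+1)%N.
Proof.
case: s => // a0 s us h.
have ex : exists a, a \in a0 :: s by exists a0; apply: mem_head.
case: (ex_minnP ex) => a aP amin; rewrite -(size_iota a d.+1).
apply: uniq_leq_size => // b bs; rewrite mem_iota amin //= addnS ltnS.
exact: h.
Qed.

(** * Creation of a supernode *)

Section Skeleton.
Variables (n : nat) (asg : assignment) (Dm : nat -> set V) (v : V).
Hypothesis B : basic n asg Dm.
Hypothesis vN : un asg v.
Let H := conn (un asg) v.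
Let Dm1 i := if i == n then H else Dm i.

(** State after [j] chains. Each chain costs one absorption, hence [4 * K] on the radius, and brings
    at most seven centers near a given point; the center [v] and three chains give
    [m = 1 + 7 * 3]. *)
Record partial j asg1 : Prop := Partial {
  p_ext : extends asg asg1 ;
  p_new : forall x c o, asg x = None -> asg1 x = Some (c, o) ->
    [/\ c = n, H x, asg1 o = Some (n, o), conn (clu asg1 n o) o x &
        dle H (W + 4 * K * j) o x] ;
  p_fin : finite_set [set x | asg1 x <> None] ;
  p_eta : connected_set (eta asg1 n) ;
  p_v : eta asg1 n v ;
  p_mult : forall x (s : seq V), uniq s ->
    (forall o, o \in s -> asg1 o = Some (n, o) /\ dle H (Rad 4) o x) ->
    (size s <= 1 + 7 * j)%N }.

Lemma H_un x : H x -> asg x = None.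
Proof. by move/conn_r. Qed.

Lemma Hv : H v.
Proof. exact: conn_refl. Qed.

Lemma eta_new asg1 j x : partial j asg1 -> eta asg1 n x -> H x.
Proof.
move=> P [ o xo]; case E: (asg x) => [[c o']|]; last by have [] := p_new P E xo.
have := p_ext P E; rewrite xo => -[cE _].
by have [] := b_idx B E; rewrite -cE ltnn.
Qed.

Lemma H_assigned asg1 j x : partial j asg1 -> H x -> asg1 x <> None -> eta asg1 n x.
Proof.
move=> P Hx; case E: (asg1 x) => [[c o]|//] _.
by have [cE _ _ _ _] := p_new P (H_un Hx) E; exists o; rewrite E cE.
Qed.

Lemma partial0 : exists asg1, partial 0 asg1.
Proof.
pose asg1 x := if x == v then Some (n, v) else asg x.
have v1 : asg1 v = Some (n, v) by rewrite /asg1 eqxx.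
have new x c o : asg x = None -> asg1 x = Some (c, o) -> x = v /\ (c, o) = (n, v).
  by rewrite /asg1; case: eqP => [->|_ ->//] _ [<- <-].
have etav x : eta asg1 n x -> x = v.
  move=> [ o]; rewrite /asg1; case: eqP => // _ /(b_idx B)[].
  by rewrite ltnn.
exists asg1; constructor.
- by move=> x p; rewrite /asg1; case: eqP => // ->; rewrite (vN : asg v = None).
- move=> x c o xN /(new _ _ _ xN)[-> [-> ->]]; split=> //; first exact: Hv.
    by apply: conn_refl.
  exact: (@dle_leq _ _ _ cl_refl H 0 _ _ _ Hv).
- apply: (@sub_finite_set _ _ ([set v] `|` [set x | asg x <> None])).
    by move=> x /=; rewrite /asg1; case: eqP => [->|_]; [left|right].
  by rewrite finite_setU; split; [apply: finite_set1|apply: (b_fin B)].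
- by move=> x y /etav -> /etav ->; apply: conn_refl; exists v.
- by exists v.
- move=> x s us sP; rewrite muln0 addn0.
  apply: (@uniq_leq_size _ s [:: v]) => // o /sP[oo _].
  by rewrite inE; apply/eqP/etav; exists o.
Qed.

(** The part of the geodesic chain beyond the old skeleton is cut into blocks of [W] links, each the
    core of a cluster centered at its first point. Gaps keep the cores disjoint; the vertices of the
    gaps, and the free ones of the last link that meets the old skeleton, are then absorbed. *)
Lemma add_path j asg1 y : (j < 3)%N -> partial j asg1 -> H y ->
  exists asg2, [/\ partial j.+1 asg2, extends asg1 asg2 & eta asg2 n y].
Proof.
move=> j3 P Hy; case: (pselect (asg1 y = None)) => [yN|ya]; last first.
  exists asg1; split=> //; last exact: H_assigned P Hy ya.
  case: P => h1 h2 h3 h4 h5 h6; constructor=> //.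
    move=> x c o xN xo; have [g1 g2 g3 g4 g5] := h2 _ _ _ xN xo; split=> //.
    have oo : H o by apply: (eta_new (asg1 := asg1) (j := j)) => //; exists o.
    by apply: dle_leq g5 => //; rewrite leq_add2l leq_mul2l leqnSn orbT.
  by move=> x s us sP; apply: leq_trans (h6 _ _ us sP) _; lia.
have [L [p [Kc [p0 pL KcP pij Kcd]]]] :=
  geodesic_chain adj_symm cl_refl cl_symm adj_cl Hv (conn_self Hy).
have vy : v <> y by move=> vy; have [ o] := p_v P; rewrite vy yN.
have L0 : (0 < L)%N.
  by rewrite lt0n; apply/eqP => L0; apply: vy; rewrite -p0 -pL L0.
have KcH i : (i < L)%N -> Kc i `<=` H by move=> /KcP[].
have conK i x z : (i < L)%N -> Kc i x -> Kc i z -> conn (Kc i) x z.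
  by move=> /KcP[_ [+ _] _ _]; apply.
(* the last link of the chain that meets what is already there *)
have Jex : exists i, (i < L)%N && `[< exists z, Kc i z /\ eta asg1 n z >].
  exists 0; rewrite L0; apply/asboolP; exists v; split; last exact: p_v P.
  by rewrite -p0; have [] := KcP _ L0.
have Jub i : (i < L)%N && `[< exists z, Kc i z /\ eta asg1 n z >] -> (i <= L)%N.
  by move=> /andP[/ltnW].
case: (ex_maxnP Jex Jub) => j0 /andP[j0L /asboolP[zj [Kzj ezj]]] jmax.
have Kfree i x : (j0 < i < L)%N -> Kc i x -> asg1 x = None.
  move=> /andP[j0i iL] Kx; apply: contrapT => xa.
  have := jmax i; rewrite iL leqNgt j0i => /(_ _)/negP; apply=> //.
  by apply/asboolP; exists x; split=> //; apply: H_assigned P (KcH _ iL _ Kx) xa.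
pose start b := (j0.+1 + b * W)%N.
have startS b : start b.+1 = (start b + W)%N by rewrite /start mulSn; lia.
have W3 : (3 < W)%N by lia.
(* The last two links of a block are left out, except in the final block, which runs to the end of
   the chain. Since a link can meet only itself and its two neighbours, the cores are disjoint. *)
pose cidx b i := (start b <= i < L)%N /\ ((i < start b + W - 2)%N \/ (L <= start b + W)%N).
pose core b : set V := [set x | exists i, cidx b i /\ Kc i x].
have cidxL b i : cidx b i -> [/\ (j0 < i < L)%N, (start b <= i)%N & (i < start b + W)%N].
  by rewrite /cidx /start => h; split; lia.
have coreU b b' x : core b x -> core b' x -> b = b'.
  wlog bb' : b b' / (b < b')%N => [Hw|[i [ci Ki]] [i' [ci' Ki']]].
    case: (ltngtP b b') => // lt h h'; [exact: Hw|symmetry; exact: Hw].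
  have [iL _ _] := cidxL _ _ ci; have [iL' _ _] := cidxL _ _ ci'.
  have sb : (start b + W <= start b')%N by rewrite -startS /start; nia.
  have i1 : (i < L)%N by lia.
  have i1' : (i' < L)%N by lia.
  have [dx _] := Kcd _ _ i1 Ki; have [_ ndx] := Kcd _ _ i1' Ki'.
  case: (ndx i.+1) => //; move: ci ci'; rewrite /cidx; lia.
pose asgC x := if asg1 x is Some q then Some q else
  if `[< exists b, core b x >] then Some (n, p (start (xget 0 [set b | core b x])))
  else None.
have coreE b x : core b x -> asgC x = Some (n, p (start b)).
  move=> bx; rewrite /asgC; have [i [ci Ki]] := bx.
  have [iL _ _] := cidxL _ _ ci; rewrite (Kfree i) //.
  have ex : exists b, core b x by exists b.
  rewrite asboolT //; congr (Some (_, p (start _))).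
  by apply: coreU bx; apply: (xgetPex 0 ex).
have asgCP x q : asgC x = Some q -> asg1 x = Some q \/
    asg1 x = None /\ exists b, core b x /\ q = (n, p (start b)).
  case E: (asg1 x) => [q'|]; first by rewrite /asgC E; left.
  move=> xq; right; split=> //; move: (xq); rewrite /asgC E.
  case: asboolP => // -[b bx] _; exists b; split=> //.
  by move: xq; rewrite (coreE _ _ bx) => -[].
have extC : extends asg1 asgC by move=> x q; rewrite /asgC => ->.
have startcore b : (start b < L)%N -> core b (p (start b)).
  move=> sL; exists (start b); split; last by have [] := KcP _ sL.
  by rewrite /cidx; lia.
have coreL b x : core b x -> (start b < L)%N.
  by move=> [i [ci _]]; move: ci; rewrite /cidx; lia.
have coreconn b x : core b x -> conn (core b) (p (start b)) x.
  move=> bx; have sL := coreL _ _ bx; case: bx => i [ci Ki].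
  have [iL si iW] := cidxL _ _ ci; have iL' : (i < L)%N by lia.
  apply: conn_trans (_ : conn (core b) (p i) x); last first.
    apply: conn_sub (conK _ _ _ iL' _ Ki); last by have [] := KcP _ iL'.
    by move=> t Kt; exists i.
  move: (ci); have -> : i = (start b + (i - start b))%N by lia.
  elim: (i - start b)%N => [|k IHk] ck.
    by rewrite addn0; apply: conn_refl; apply: startcore.
  have ck' : cidx b (start b + k) by move: ck; rewrite /cidx; lia.
  apply: conn_trans (IHk ck') _.
  have kL : (start b + k < L)%N by move: ck'; rewrite /cidx; lia.
  have [_ _ K1 K2] := KcP _ kL; rewrite addnS.
  apply: conn_sub (conK _ _ _ kL K1 K2).
  by move=> t Kt; exists (start b + k)%N.
have coredle b x : core b x -> dle H W (p (start b)) x.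
  move=> bx; have sL := coreL _ _ bx; case: bx => i [ci Ki].
  have [iL si iW] := cidxL _ _ ci; have iL' : (i < L)%N by lia.
  have Hp : H (p (start b)) by apply: (KcH _ sL); have [] := KcP _ sL.
  apply: (@dle_leq _ _ _ cl_refl H (i - start b).+1) => //; first lia.
  exists (p i); first by apply: pij; lia.
  by have [h1 h2 h3 h4] := KcP _ iL'; exists (Kc i).
have HC x : H x -> asgC x <> None -> exists o, asgC x = Some (n, o).
  move=> Hx; case E: (asgC x) => [[c o]|//] _; exists o.
  case: (asgCP _ _ E) => [E1|[_ [b [_ [-> _]]]]//].
  by have [-> _ _ _ _] := p_new P (H_un Hx) E1.
have newC x o : asgC x = Some (n, o) -> [/\ H x, asgC o = Some (n, o),
    conn (clu asgC n o) o x & dle H (W + 4 * K * j) o x].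
  move=> /asgCP[E|[xN [b [bx [oE]]]]].
    have Hx : H x by apply: eta_new P _; exists o.
    have [_ h2 h3 h4 h5] := p_new P (H_un Hx) E; split=> //; first exact: extC.
    by apply: conn_sub h4; apply: clu_extends.
  have sL := coreL _ _ bx; have [i [ci Ki]] := bx.
  have Ho : H o by rewrite oE; apply: (KcH _ sL); have [] := KcP _ sL.
  split.
  - by have [iL _ _] := cidxL _ _ ci; apply: (KcH i) => //; lia.
  - by rewrite oE; apply: coreE; apply: startcore.
  - by rewrite oE; apply: conn_sub (coreconn _ _ bx) => t /coreE.
  - by apply: (@dle_leq _ _ _ cl_refl H W); rewrite ?leq_addr // oE; apply: coredle.
have multC x (s : seq V) : uniq s ->
    (forall o, o \in s -> asgC o = Some (n, o) /\ dle H (Rad 4) o x) ->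
    (size s <= 1 + 7 * j.+1)%N.
  move=> us sP; rewrite -(count_predC (fun o => asg1 o == Some (n, o))).
  rewrite mulnS addnCA addnC leq_add //.
    rewrite -size_filter.
    pose bo o := xget 0 [set b | core b o].
    have boP o : o \in [seq o <- s | ~~ (asg1 o == Some (n, o))] ->
        [/\ core (bo o) o, o = p (start (bo o)) & dle H (Rad 4) o x].
      rewrite mem_filter => /andP[/negP no /sP[/asgCP[/eqP//|[_ [b [bo_ oE]]]] d]].
      have h : [set b | core b o] (bo o) by apply: xgetPex; exists b.
       split=> //; case: oE => {1}->.
      by rewrite (coreU _ _ _ bo_ h).
    (* Two new centers near [x] are at distance at most [2 * Rad 4 = 6 * W], whereas centers lie [W]
       apart along a geodesic. Their block numbers differ by at most 6, hence at most seven
       centers. *)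
    rewrite -(size_map bo); apply: size_window.
      rewrite map_inj_in_uniq ?filter_uniq // => o o' /boP[_ oE _] /boP[_ oE' _] bE.
      by rewrite oE oE' bE.
    move=> _ _ /mapP[ o os ->] /mapP[ o' os' ->].
    have [c1 oE d1] := boP _ os; have [c2 oE' d2] := boP _ os'.
    have s1 := coreL _ _ c1; have s2 := coreL _ _ c2.
    have dd : dle H (start (bo o) + (Rad 4 + Rad 4)) v o'.
      apply: (dle_trans (y := o)).
        by rewrite {2}oE -p0 -{1}(subn0 (start (bo o))); apply: pij; lia.
      by apply: (dle_trans d1); apply: dle_sym.
    have := (Kcd (start (bo o')) o' s2); case.
      by rewrite {2}oE'; have [] := KcP _ s2.
    move=> _ nd; rewrite leqNgt; apply/negP => lt.
    apply: (nd _ _ dd); rewrite /start /Rad; move: lt.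
    move=> lt; have : ((bo o + 7) * W <= bo o' * W)%N by rewrite leq_mul2r; lia.
    by rewrite mulnDl; lia.
  rewrite -size_filter; apply: (p_mult P (x := x)); first exact: filter_uniq.
  by move=> o; rewrite mem_filter => /andP[/eqP h /sP[_ d]].
pose el x c := c = n /\ asgC x = None /\ exists i, (j0 <= i < L)%N /\ Kc i x.
pose rb (x : V) (c : nat) := (W + 4 * K * j)%N.
have Dn : Dm1 n = H by rewrite /Dm1 eqxx.
have conn0 w c o : asgC w = Some (c, o) -> conn (clu asgC c o) o w.
  move=> wo; case: (c =P n) => [cn|cn]; first by rewrite cn in wo *; have [] := newC _ _ wo.
  case: (asgCP _ _ wo) => [E|[_ [b [_ [/cn]]]]//].
  case E0: (asg w) => [q|]; last by have [/cn] := p_new P E0 E.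
  have := p_ext P E0; rewrite E => -[qE]; rewrite -qE in E0.
  have [_ _ _ h _] := b_idx B E0; apply: conn_sub h => t /(p_ext P); exact: extC.
have dom0 c o : asgC o = Some (c, o) -> Dm1 c o.
  move=> oo; rewrite /Dm1; case: eqP => [cn|cn].
    by rewrite cn in oo; have [] := newC _ _ oo.
  case: (asgCP _ _ oo) => [E|[_ [b [_ [/cn]]]]//].
  case E0: (asg o) => [q|]; last by have [/cn] := p_new P E0 E.
  have := p_ext P E0; rewrite E => -[qE]; rewrite -qE in E0.
  by have [] := b_idx B E0.
have KcF : finite_set [set x | exists i, (i < L)%N /\ Kc i x].
  apply: sub_finite_set (dle_finite adj cl_finite H L v) => x [i [iL Ki]].
  have [d _] := Kcd _ _ iL Ki; apply: dle_leq d => //; exact: Hv.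
have candF : finite_set [set x | exists c o,
    [/\ el x c, asgC o = Some (c, o) & dle (Dm1 c) (rb x c + 4 * K) o x]].
  apply: sub_finite_set KcF => x [c [ o [[_ [_ [i [iL Ki]]]] _ _]]].
  by exists i; split=> //; lia.
have [asg2 [[ext2 gr] abs]] := absorption adj_symm cl_refl cl_symm adj_cl conn0 dom0 candF.
have all_in i x : (j0 <= i < L)%N -> Kc i x -> asg2 x <> None.
  move=> iL Ki; have iL' : (i < L)%N by lia.
  case E: (asgC x) => [q|]; first by rewrite (ext2 _ _ E).
  (* Every link outside the cores contains an assigned vertex: [zj] for link [j0]; the point shared
     with the previous link, which is in the core, for the first link of a gap; the center of the
     next core for the second one. *)
  have [w [Kw wa]] : exists w, Kc i w /\ asgC w <> None.
    case: (leqP i j0) => ij0.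
      have -> : i = j0 by lia.
      by exists zj; split=> //; have [ o /extC->] := ezj.
    pose b := ((i - j0.+1) %/ W)%N; pose r := ((i - j0.+1) %% W)%N.
    have iE : i = (start b + r)%N.
      by have := divn_eq (i - j0.+1) W; rewrite /start /b /r; lia.
    have rW : (r < W)%N by rewrite ltn_mod; lia.
    have nc : ~ cidx b i.
      by move=> ci; have := coreE b x (ex_intro _ i (conj ci Ki)); rewrite E.
    have [rW2 sL] : (W - 2 <= r)%N /\ (start b + W < L)%N by move: nc; rewrite /cidx; lia.
    case: (ltnP r (W - 1)) => rW1.
      exists (p i); split; first by have [] := KcP _ iL'.
      rewrite (coreE b) //; exists i.-1; split; first by rewrite /cidx; lia.
      have i1L : (i.-1 < L)%N by lia.
      have [_ _ _] := KcP _ i1L; have -> // : i.-1.+1 = i by lia.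
    exists (p i.+1); split; first by have [] := KcP _ iL'.
    have -> : i.+1 = start b.+1 by rewrite startS; lia.
    by rewrite (coreE b.+1) //; apply: startcore; rewrite startS.
  have nTx : ~ [set z | asgC z <> None] x by rewrite /= E.
  have [x' [t [xx' x't Kt ta]]] := conn_exit adj_symm (conK _ _ _ iL' Ki Kw) nTx wa.
  have [ o0 tE] := HC _ (KcH _ iL' _ Kt) ta.
  have [Ht oE cE dE] := newC _ _ tE.
  pose Q := conn (Kc i `\` [set z | asgC z <> None]) x.
  have QP z : Q z -> Kc i z /\ asgC z = None.
    by move=> /conn_r[Kz /= /contrapT].
  have elz z c : Q z -> el z c <-> c = n.
    move=> Qz; have [Kz zN] := QP _ Qz; split=> [[]//|->].
    by split=> //; split=> //; exists i.
  have Qx : Q x by apply: conn_refl; split.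
  have [_ sK _ _] := KcP _ iL'.
  apply: (abs x Q) => //.
  - by apply: small_sub sK _ _; [move=> z /QP[]|apply: connected_comp].
  - by move=> z /QP[].
  - by move=> z c Qz /(elz _ _ Qz); move/(elz _ _ Qx).
  - move=> z c Qz /(elz _ _ Qx) cE'; split=> //; first exact/(elz _ _ Qz).
    by rewrite cE' Dn; apply: (KcH _ iL'); have [] := QP _ Qz.
  - exists x', t, n, o0; split; first by split=> //; apply/(elz _ _ Qx).
    by rewrite Dn.
  - move=> s us sP; apply: leq_trans (multC x s us _) _; last lia.
    move=> o /sP[c [oo /(elz _ _ Qx) cE' d]]; rewrite cE' Dn in oo d.
    have [Ho _ _ _] := newC _ _ oo.
    split=> //; apply: dle_leq d => //; rewrite /rb /Rad; nia.
have new2 x c o : asg1 x = None -> asg2 x = Some (c, o) ->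
    c = n /\ exists i, (j0 <= i < L)%N /\ Kc i x.
  move=> xN xo; case E: (asgC x) => [q|]; last first.
    by have [[-> [_ h]] _ _ _] := gr _ _ _ E xo.
  have := ext2 _ _ E; rewrite xo => -[qE]; rewrite -qE in E.
  case: (asgCP _ _ E) => [|[_ [b [[i [ci Ki]] [-> _]]]]]; first by rewrite xN.
  by split=> //; exists i; split=> //; have [iL _ _] := cidxL _ _ ci; lia.
have ext12 : extends asg1 asg2 by apply: extends_trans ext2.
have eta2 x : eta asg1 n x -> eta asg2 n x by move=> [ o /ext12]; exists o.
have etaK i x : (j0 <= i < L)%N -> Kc i x -> eta asg2 n x.
  move=> iL Ki; have := all_in _ _ iL Ki; case E: (asg2 x) => [[c o]|//] _.
  case E1: (asg1 x) => [q|]; last by have [cE _] := new2 _ _ _ E1 E; exists o; rewrite E cE.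
  apply: eta2; apply: H_assigned P _ _; last by rewrite E1.
  by apply: (KcH i) => //; lia.
exists asg2; split=> //; last first.
  have L1 : (j0 <= L.-1 < L)%N by lia.
  apply: (etaK _ _ L1); have L1' : (L.-1 < L)%N by lia.
  by have [_ _ _] := KcP _ L1'; rewrite prednK // pL.
constructor.
- exact: extends_trans (p_ext P) ext12.
- move=> x c o xN xo; case E: (asgC x) => [q|].
    have := ext2 _ _ E; rewrite xo => -[qE]; rewrite -qE in E.
    have cn : c = n.
      case: (asgCP _ _ E) => [E1|[_ [b [_ [-> _]]]]//].
      by have [] := p_new P xN E1.
    rewrite cn in E *; have [h1 h2 h3 h4] := newC _ _ E.
    split=> //; first exact: ext2.
      by apply: conn_sub h3; apply: clu_extends.
    have [Ho _ _ _] := newC _ _ h2.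
    by apply: dle_leq h4 => //; rewrite leq_add2l leq_mul2l leqnSn orbT.
  have [[cn [_ [i [iL Ki]]]] oo d cc] := gr _ _ _ E xo.
  rewrite cn in cc oo d; split=> //.
  + by apply: (KcH i) => //; lia.
  + exact: ext2.
  + by move: d; rewrite Dn /rb mulnSr -addnA.
- apply: (@sub_finite_set _ _ ([set x | asg1 x <> None] `|`
      [set x | exists i, (i < L)%N /\ Kc i x])).
    move=> x /=; case E: (asg1 x) => [q|] xN; [by left|right].
    case E': (asg2 x) xN => [[c o]|//] _.
    have [_ [i [iL Ki]]] := new2 _ _ _ E E'; exists i; split=> //; lia.
  by rewrite finite_setU; split=> //; apply: (p_fin P).
- apply: (conn_center adj_symm (o := zj)).
  have toz i x : (j0 <= i < L)%N -> Kc i x -> conn (eta asg2 n) zj x.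
    move=> iL; have iL' : (i < L)%N by lia.
    move=> Ki; apply: conn_trans (_ : conn (eta asg2 n) (p i) x); last first.
      apply: conn_sub (conK _ _ _ iL' _ Ki); last by have [] := KcP _ iL'.
      by move=> t; apply: etaK.
    move: iL'; have -> : i = (j0 + (i - j0))%N by lia.
    elim: (i - j0)%N => [|k IHk] kL.
      rewrite addn0; apply: conn_sub (conK _ _ _ j0L Kzj _); last by have [] := KcP _ j0L.
      by move=> t; apply: etaK; lia.
    have kL' : (j0 + k < L)%N by lia.
    apply: conn_trans (IHk kL') _; have [_ _ K1 K2] := KcP _ kL'; rewrite addnS.
    by apply: conn_sub (conK _ _ _ kL' K1 K2) => t; apply: etaK; lia.
  move=> x [ o xo]; case E: (asg1 x) => [q|].
    have ex : eta asg1 n x.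
      by have := ext12 _ _ E; rewrite xo => -[qE]; exists o; rewrite E -qE.
    by apply: conn_sub (p_eta P ezj ex) => t; apply: eta2.
  by have [_ [i [iL Ki]]] := new2 _ _ _ E xo; apply: toz iL Ki.
- by apply: eta2; apply: p_v P.
- move=> x s us sP; apply: (multC x s us) => o /sP[oo d]; split=> //.
  case E: (asgC o) => [q|]; first by rewrite -(ext2 _ _ E) in oo *.
  by have [_ h _ _] := gr _ _ _ E oo; rewrite E in h.
Qed.

Hypothesis Gd : forall i u, (i < n)%N -> un asg u -> live asg Dm i u -> sees asg i u.

(** One chain is drawn from [v] to the border of each supernode seen by [v], of which there are at
    most three. This contact is what preserves [b_adj]. *)
Lemma skeleton : exists j asg1, [/\ (j <= 3)%N, partial j asg1 &
  forall i, sees asg i v -> exists x y, [/\ eta asg i x, eta asg1 n y & adj x y]].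
Proof.
pose s := [seq i <- iota 0 n | `[< sees asg i v >]].
have s3 : (size s <= 3)%N.
  apply: (bag_le3 B vN) => [|i]; first by rewrite filter_uniq ?iota_uniq.
  by rewrite mem_filter => /andP[/asboolP].
suff H0 (t : seq nat) : (size t <= 3)%N -> {subset t <= s} ->
    exists asg1, partial (size t) asg1 /\ forall i, i \in t ->
    exists x y, [/\ eta asg i x, eta asg1 n y & adj x y].
  have [//|asg1 [P1 h1]] := H0 s s3.
  exists (size s), asg1; split=> // i iv; apply: h1.
  by rewrite mem_filter mem_iota asboolT // (sees_lt B iv).
elim: t => [_ _|i t IHt /= t3 ts]; first by have [asg1 P1] := partial0; exists asg1.
have [||asg1 [P1 h1]] := IHt; first exact: ltnW.
  by move=> k kt; apply: ts; rewrite inE kt orbT.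
have : i \in s by apply: ts; rewrite mem_head.
rewrite mem_filter => /andP[/asboolP[x [y [ix xy vy]]] _].
have [asg2 [P2 e2 ey]] := add_path t3 P1 vy.
exists asg2; split=> // k; rewrite inE => /orP[/eqP->|/h1[x' [y' [g1 [ o g2] g3]]]].
  by exists x, y.
by exists x', y'; split=> //; exists o; apply: e2.
Qed.

(** Since the old assignment is good, the older supernodes live on a free component are seen by it,
    so they are at most three; the new supernode may be a fourth. *)
Lemma creation : exists asg1, [/\ extends asg asg1,
  forall i x, (i < n)%N -> eta asg1 i x -> eta asg i x, asg1 v <> None,
  basic n.+1 asg1 Dm1 & forall u, un asg1 u -> (kap asg1 Dm1 n.+1 u <= 4)%N].
Proof.
have [j [asg1 [j3 P1 sk]]] := skeleton; have ext := p_ext P1.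
have etaE i x : i <> n -> eta asg1 i x -> eta asg i x.
  move=> ni [ o xo]; case E: (asg x) => [q|]; last by have [/ni] := p_new P1 E xo.
  by exists o; rewrite E -(ext _ _ E).
have e2 i x : (i < n)%N -> eta asg1 i x -> terr asg i x.
  by move=> ni ix; left; apply: etaE ix; lia.
have DmE i : (i < n)%N -> Dm1 i = Dm i.
  by move=> ni; rewrite /Dm1; case: eqP => // ?; lia.
have Dn : Dm1 n = H by rewrite /Dm1 eqxx.
have kap3 u c : un asg1 u -> (c <= n)%N -> (kap asg1 Dm1 c u <= 3)%N.
  move=> uN cn; have uN' := un_mono ext uN.
  apply: leq_trans (kap_mono ext e2 DmE u cn) _; rewrite /kap -size_filter.
  apply: (bag_le3 B uN') => [|i]; first by rewrite filter_uniq ?iota_uniq.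
  rewrite mem_filter mem_iota => /andP[/asboolP li /andP[_ ic]].
  by apply: Gd => //; lia.
have nidx x i o : asg1 x = Some (i, o) -> asg x = Some (i, o) /\ (i < n)%N \/
    asg x = None /\ i = n.
  move=> xo; case E: (asg x) => [[i' o']|].
    left; have := ext _ _ E; rewrite xo => -[-> ->]; split=> //.
    by have [] := b_idx B E.
  by right; split=> //; have [] := p_new P1 E xo.
exists asg1; split=> //.
- by move=> i x ni; apply: etaE; lia.
- by have [ o ->] := p_v P1.
- constructor.
  + move=> x i o xo; case: (nidx _ _ _ xo) => [[E ni]|[E ni]].
      have [h1 h2 h3 h4 h5] := b_idx B E; rewrite DmE //; split=> //.
      * exact: ltnW.
      * exact: ext.
      * by apply: conn_sub h4; apply: clu_extends.
    have [_ h2 h3 h4 h5] := p_new P1 E xo; rewrite ni Dn in xo *; split=> //.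
    apply: dle_leq h5 => //; first by apply: (eta_new P1); exists o.
    by rewrite /Rad; nia.
  + exact: p_fin P1.
  + move=> i; case: (i =P n) => [->|ni]; first exact: p_eta P1.
    move=> x y /(etaE _ _ ni) ix /(etaE _ _ ni) iy.
    by apply: conn_sub (b_eta B ix iy) => t [ o /ext to]; exists o.
  + move=> i x y; rewrite ltnS leq_eqVlt => /orP[/eqP->|ni].
      rewrite Dn => Hx xy Wy; apply: (conn_step Hx xy).
      case E: (asg y) => [[i' o']|//]; exfalso.
      by have := Wy _ _ (ext _ _ E); have [] := b_idx B E; lia.
    by rewrite DmE // => Dx xy /(Wge_mono ext) Wy; apply: (b_cls B ni Dx xy Wy).
  + move=> i x s us sP; case: (i =P n) => [ni|ni].
      apply: leq_trans (p_mult P1 (x := x) us _) _; last lia.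
      by move=> o /sP; rewrite ni Dn.
    apply: (b_mult B (i := i) (x := x) us) => o /sP[oo d].
    case: (nidx _ _ _ oo) => [[E ni']|[_ /ni//]].
    by split=> //; rewrite -DmE.
  + move=> i k u ik si sk'.
    have lts i' u' : sees asg1 i' u' -> (i' <= n)%N.
      by move=> [x [y [[ o /nidx[[_ /ltnW]|[_ ->]]]]]].
    have kn := lts _ _ sk'; have ni : (i < n)%N by lia.
    have si' := sees_mono ext e2 ni si.
    move: kn; rewrite leq_eqVlt => /orP[/eqP kn|kn]; last first.
      have [x [y [h1 h2 h3]]] := b_adj B ik si' (sees_mono ext e2 kn sk').
      by exists x, y; split=> //; apply: (eta_mono ext).
    rewrite kn in sk' *; move: sk' => [x [y [nx xy uy]]].
    have uy' := conn_sub (un_mono ext) uy.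
    have vu : conn (un asg) v u.
      apply: conn_trans (conn_sym adj_symm uy').
      by apply: (conn_step (eta_new P1 nx) xy); apply: conn_r uy'.
    have [x1 [y1 [h1 h2 h3]]] := sk i (sees_conn (conn_sym adj_symm vu) si').
    by exists x1, y1; split=> //; apply: (eta_mono ext).
  + move=> u c y o y' yo yy' uy'.
    case: (nidx _ _ _ yo) => [[E cn]|[E cn]].
      rewrite DmE //; have := b_rad B E yy' (conn_sub (un_mono ext) uy').
      apply: dle_leq => //; first by have [_ _ /(center_dom B)] := b_idx B E.
      by apply: Rad_mono; have := kap_mono ext e2 DmE u (ltnW cn); lia.
    (* A fresh cluster has radius at most [W + 12 * K], within [Rad 0], so its whole growth
       allowance is intact. *)
    have [_ h2 h3 _ h5] := p_new P1 E yo; rewrite cn Dn.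
    apply: dle_leq h5 => //; first by apply: (eta_new P1); exists o.
    by rewrite /Rad; nia.
  + by move=> u c uN; rewrite ltnS; apply: kap3.
- move=> u uN; rewrite /kap -addn1 iotaD count_cat /= addn0.
  by have := kap3 u n uN (leqnn n); rewrite /kap; case: asboolP; lia.
Qed.

End Skeleton.

Lemma step n asg Dm v : good n asg Dm -> un asg v ->
  exists asg' Dm', [/\ extends asg asg',
    forall i x, (i < n)%N -> eta asg' i x -> terr asg i x,
    forall i, (i < n)%N -> Dm' i = Dm i, good n.+1 asg' Dm' & asg' v <> None].
Proof.
move=> [B Gd] vN; have [asg1 [e1 t1 v1 B1 k1]] := creation B vN Gd.
have [asg2 [e2 t2 B2]] := growth B1 k1.
eexists asg2, _; split; last 2 first.
- exact: B2.
- by case E: (asg1 v) v1 => [p|//] _; rewrite (e2 _ _ E).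
- exact: extends_trans e2.
- move=> i x ni /t2; apply: (terr_mono e1 _ ni).
  by move=> i' x' ni' /(t1 _ _ ni'); left.
- by move=> i ni /=; case: (i =P n) => // ?; lia.
Qed.

End Supernodes.

(** * Counting passages between adjacent clusters *)

Section ClusterGraph.
Variables (V : choiceType) (adj : V -> V -> Prop) (cen : V -> V).
Hypothesis adj_symm : forall x y, adj x y -> adj y x.

Definition touch x y := cen x = cen y \/
  exists x' y', [/\ cen x' = cen x, cen y' = cen y & adj x' y'].

Fixpoint hop n x y :=
  if n is n'.+1 then exists2 z, hop n' x z & touch z y else cen x = cen y.

Lemma touch_sym x y : touch x y -> touch y x.
Proof.
move=> [xy|[x' [y' [h1 h2 h3]]]]; first by left.
by right; exists y', x'; split=> //; apply: adj_symm.
Qed.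

Lemma touch_adj x y : adj x y -> touch x y.
Proof. by right; exists x, y. Qed.

Lemma hop_trans m n x y z : hop m x y -> hop n y z -> hop (m + n) x z.
Proof.
move=> xy; elim: n z => [z yz|n IHn z [t /IHn yt tz]]; last by rewrite addnS; exists t.
rewrite addn0; case: m xy => [/= ->//|m [t xt ty]]; exists t => //.
by case: ty => [ty|[x' [y' [h1 h2 h3]]]]; [left; rewrite ty|right; exists x', y'; rewrite -yz].
Qed.

Lemma hop1 x y : touch x y -> hop 1 x y.
Proof. by exists x. Qed.

Lemma hop_sym n x y : hop n x y -> hop n y x.
Proof.
elim: n y => [y //|n IHn y [z /IHn xz /touch_sym/hop1 zy]].
exact: hop_trans zy xz.
Qed.

Lemma hop_leq m n x y : (m <= n)%N -> hop m x y -> hop n x y.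
Proof.
move=> /subnKC <- xy; apply: hop_trans xy _.
by elim: (n - m)%N => // k IHk; exists y => //; left.
Qed.

End ClusterGraph.

(** * The limit partition and its hop count *)

Section Decomposition.
Variables (V : countType) (adj cl : V -> V -> Prop).
Hypothesis adj_symm : forall x y, adj x y -> adj y x.
Hypothesis cl_refl : forall x, cl x x.
Hypothesis cl_symm : forall x y, cl x y -> cl y x.
Hypothesis adj_cl : forall x y, adj x y -> cl x y.
Hypothesis cl_finite : forall x, finite_set [set y | cl x y].
Hypothesis V_infinite : ~ finite_set [set: V].
Local Notation conn := (conn adj).
Local Notation connected_set := (connected_set adj).
Local Notation small := (small adj cl).
Local Notation st := (st adj cl).
Local Notation dle := (dle adj cl).
Hypothesis noK5 : forall A : nat -> set V,
  (forall i, (i < 5)%N -> connected_set (A i)) ->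
  (forall i j x, (i < j < 5)%N -> A i x -> A j x -> False) ->
  (forall i j, (i < j < 5)%N -> exists x y, [/\ A i x, A j y & adj x y]) -> False.

Variables (m K G W : nat).
Hypothesis mE : m = 22.
Hypothesis KE : K = (3 * m)%N.
Hypothesis GE : G = (4 * K + 4)%N.
Hypothesis WE : W = (4 * G)%N.
Local Notation assignment := (assignment V).
Local Notation good := (good adj cl m G W).
Local Notation basic := (basic adj cl m G W).
Local Notation terr := (terr adj).
Local Notation sees := (sees adj).
Local Notation live := (live adj cl).

(** Each new supernode starts at the free vertex of least rank, so every vertex is eventually
    assigned. A free vertex always exists because [V] is infinite and only finitely many vertices
    are assigned at a given stage. *)
Lemma stages : exists (asg : nat -> assignment) (Dm : nat -> nat -> set V),
  [/\ forall n, good n (asg n) (Dm n), forall n, extends (asg n) (asg n.+1),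
      forall n i x, (i < n)%N -> eta (asg n.+1) i x -> terr (asg n) i x,
      forall n i, (i < n)%N -> Dm n.+1 i = Dm n i &
      forall n x, (pickle x < n)%N -> asg n x <> None].
Proof.
pose state : Type := nat * assignment * (nat -> set V).
pose good1 (s : state) := good s.1.1 s.1.2 s.2.
have next (s : state) : exists s' : state, good1 s -> [/\ good1 s',
    s'.1.1 = s.1.1.+1, extends s.1.2 s'.1.2,
    (forall i x, (i < s.1.1)%N -> eta s'.1.2 i x -> terr s.1.2 i x) &
    (forall i, (i < s.1.1)%N -> s'.2 i = s.2 i) /\
    exists v, [/\ s.1.2 v = None, s'.1.2 v <> None &
      forall x, s.1.2 x = None -> (pickle v <= pickle x)%N]].
  case: s => -[n asg] Dm; case: (pselect (good n asg Dm)) => [gd|ng]; last first.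
    by exists (n, asg, Dm).
  have [v0 v0N] : exists v, asg v = None.
    apply: contrapT => nv; apply: V_infinite.
    have [/b_fin fin _] := gd; apply: sub_finite_set fin => x _ xN.
    by apply: nv; exists x.
  have ex : exists k, `[< exists v, asg v = None /\ pickle v = k >].
    by exists (pickle v0); apply/asboolP; exists v0.
  case: (ex_minnP ex) => k /asboolP[v [vN vk]] kmin.
  have [asg' [Dm' [h1 h2 h3 h4 h5]]] :=
    step adj_symm cl_refl cl_symm adj_cl cl_finite noK5 mE KE GE WE gd vN.
  exists (n.+1, asg', Dm') => _; split=> //=; split=> //.
  exists v; split=> // x xN; rewrite vk; apply: kmin; apply/asboolP.
  by exists x.
have [f fP] := choice next.
pose s0 : state := (0, fun=> None, fun=> set0).
have g0 : good1 s0.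
  split=> //; constructor=> //=.
  - by apply: sub_finite_set (finite_set0 V) => x.
  - by move=> i x y [].
  - by move=> i x [|o s] // us /(_ o); rewrite mem_head => /(_ isT)[].
  - by move=> i j u _ [x [y [[]]]].
pose s n := iter n f s0.
have gs n : good1 (s n) /\ (s n).1.1 = n.
  elim: n => // n [IH1 IH2]; have [h1 h2 _ _ _] := fP _ IH1.
  by split=> //; rewrite /s iterS h2 -/(s n) IH2.
exists (fun n => (s n).1.2), (fun n => (s n).2); split.
- by move=> n; have [h1 h2] := gs n; move: h1; rewrite /good1 h2.
- by move=> n; have [/fP[]] := gs n.
- move=> n i x ni; have [h1 h2] := gs n.
  by have [_ _ _ h _] := fP _ h1; apply: h; rewrite h2.
- move=> n i ni; have [h1 h2] := gs n.
  by have [_ _ _ _ [h _]] := fP _ h1; apply: h; rewrite h2.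
- move=> n x; suff : (s n).1.2 x = None -> (n <= pickle x)%N by move=> h + /h; lia.
  elim: n x => // n IHn x xN.
  have [h1 h2] := gs n; have [_ _ ext _ [_ [v [vN va vmin]]]] := fP _ h1.
  have xN' := extends_None ext xN; have := IHn _ xN'.
  rewrite leq_eqVlt => /orP[/eqP nx|//]; have := vmin _ xN'.
  have := IHn _ vN; move=> p1 p2; exfalso; apply: va.
  have -> // : v = x by apply: (pcan_inj pickleK); lia.
Qed.

(** Hops across a small set are counted by recursion on the oldest supernode [i] that it meets. It
    meets at most [m] clusters of [i], each of which is skipped from first to last visit. Off [i]
    the pieces are again small, and [i] joins the list [s] of supernodes met on the way; the K5
    count stops the recursion, for such a list has at most three elements. *)
Theorem cluster_decomposition_aux : exists (cen : V -> V) (R L : nat),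
  [/\ forall x, cen (cen x) = cen x,
      forall x, conn [set y | cen y = cen x] (cen x) x,
      forall x, dle setT R (cen x) x &
      forall P x y, small P -> P x -> P y -> hop adj cen L x y].
Proof.
have [asg [Dm [gd ext terrS DmS total]]] := stages.
have extk k n : extends (asg n) (asg (n + k)).
  by elim: k => [|k IHk]; rewrite ?addn0 // addnS; apply: extends_trans IHk _; apply: ext.
have extl n n' : (n <= n')%N -> extends (asg n) (asg n') by move=> /subnKC <-.
have Dml n n' i : (i < n <= n')%N -> Dm n' i = Dm n i.
  move=> /andP[ni /subnKC <-]; elim: (n' - n)%N => [|k IHk]; first by rewrite addn0.
  by rewrite addnS DmS ?IHk //; lia.
have Bn n := (gd n).1.
have terrl n n' i : (i < n <= n')%N -> eta (asg n') i `<=` terr (asg n) i.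
  move=> /andP[ni /subnKC <-]; move: (n' - n)%N => k.
  suff h : terr (asg (n + k)) i `<=` terr (asg n) i by move=> x ex; apply: h; left.
  elim: k => [|k IHk]; first by rewrite addn0.
  rewrite addnS => x tx; apply: IHk; move: x tx.
  apply: (terr_mono adj_symm (n := n + k)%N); [exact: ext|exact: terrS|lia].
pose fin x := odflt (0, x) (asg (pickle x).+1 x).
pose ix x := (fin x).1; pose cen x := (fin x).2.
have finE n x : (pickle x < n)%N -> asg n x = Some (ix x, cen x).
  move=> xn; have := total (pickle x).+1 x (ltnSn _).
  rewrite /ix /cen /fin; case E: (asg (pickle x).+1 x) => [[i o]|//] _ /=.
  exact: (extl _ _ xn _ _ E).
have finP n x i o : asg n x = Some (i, o) -> ix x = i /\ cen x = o.
  move=> xo; have h := finE (n + (pickle x).+1)%N x.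
  have := extk (pickle x).+1 _ _ _ xo; rewrite h; last lia.
  by move=> [-> ->].
have ixlt n x : (ix x < n)%N \/ asg n x = None.
  case E: (asg n x) => [[i o]|]; [left|by right].
  by have [-> _] := finP _ _ _ _ E; have [] := b_idx (Bn n) E.
have Wgel n i x : (i <= ix x)%N -> Wge (asg n) i x.
  by move=> ixx j o /finP[<- _].
have cenA x : asg (pickle x).+1 (cen x) = Some (ix x, cen x).
  have E := finE _ _ (ltnSn (pickle x)).
  by have [] := b_idx (Bn _) E.
have domP (P : set V) n i z : connected_set P -> (i < n)%N ->
    (forall t, P t -> (i <= ix t)%N) -> P z -> ix z = i -> P `<=` Dm n i.
  move=> cP ni Pi Pz zi; have Dz : Dm n i z.
    have E := finE (n + (pickle z).+1)%N z; have {}E := E ltac:(lia).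
    have [h1 h2 _ _ _] := b_idx (Bn _) E; rewrite zi in h2.
    by rewrite -(Dml n (n + (pickle z).+1)%N); last lia.
  move=> t Pt; have := cP _ _ Pz Pt; elim=> // a b _ Da ab Pb.
  by apply: (b_cls (Bn n) ni Da ab); apply: Wgel; apply: Pi.
(* [i] was met by a small set enclosing [P] all of whose vertices are at least as young *)
pose hist (s : seq nat) (P : set V) := forall i, i \in s ->
  (forall z, P z -> (i < ix z)%N) /\
  exists P', [/\ small P', P `<=` P', forall z, P' z -> (i <= ix z)%N &
                 exists2 z, P' z & ix z = i].
have minix (P : set V) x : P x -> exists2 z, P z & forall t, P t -> (ix z <= ix t)%N.
  move=> Px; have ex : exists k, `[< exists z, P z /\ ix z = k >].
    by exists (ix x); apply/asboolP; exists x.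
  case: (ex_minnP ex) => k /asboolP[z [Pz zk]] kmin; exists z => // t Pt.
  by rewrite zk; apply: kmin; apply/asboolP; exists t.
(* Look at the stage whose number is the index of the oldest vertex [u] of [P]: there [u] is still
   free, and the enclosing set [P'] makes each [i] of [s] live at [u], hence seen, as the stage is
   good. *)
have hist3 s P x : uniq s -> hist s P -> P x -> (size s <= 3)%N.
  move=> us hs /minix[u Pu umin]; pose n := ix u.
  have uN : asg n u = None by case: (ixlt n u); rewrite /n ?ltnn.
  apply: (bag_le3 adj_symm noK5 mE KE GE WE (Bn n) uN us) => i si.
  have [Pi [P' [sP' PP' P'i [z P'z zi]]]] := hs _ si.
  have ni : (i < n)%N := Pi _ Pu.
  apply: (gd n).2 => //; have cP' := sP'.1.
  have DP' := domP P' n i z cP' ni P'i P'z zi.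
  split; first exact/DP'/PP'.
  exists z, u; split; last first.
  - exists P'; split=> // [t P't|]; last exact: PP'.
    by split; [exact: DP'|apply: Wgel; exact: P'i].
  - exact: conn_refl.
  - apply: (terrl n (n + (pickle z).+1)%N); first lia.
    by exists (cen z); rewrite (finE _ z) ?zi //; lia.
(* The centers of clusters of [i] meeting [P] lie within [Rad 3 + 1] of [x] in the domain of [i], so
   [b_mult] applies at a stage where all of the finite set [P] is assigned. *)
have near (P : set V) i x : small P -> P x -> (exists2 z, P z & ix z = i) ->
    (forall t, P t -> (i <= ix t)%N) ->
    exists cs : seq V, (size cs <= m)%N /\ forall z, P z -> ix z = i -> cen z \in cs.
  move=> sP Px [z0 Pz0 z0i] Pi.
  have /finite_seqP[l lE] : finite_set P.
    by apply: sub_finite_set (cl_finite x) => t Pt; apply: sP.2.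
  have Pl t : P t <-> t \in l by rewrite lE.
  pose N := (\max_(t <- l) pickle t + i).+1.
  have lN t : t \in l -> (pickle t < N)%N.
    by move=> tl; rewrite ltnS; apply: leq_trans (leq_addr _ _); apply: leq_bigmax_seq.
  have DP := domP P N i z0 sP.1 ltac:(lia) Pi Pz0 z0i.
  exists (undup [seq cen t | t <- l & ix t == i]); split; last first.
    move=> z Pz zi; rewrite mem_undup; apply/mapP; exists z => //.
    by rewrite mem_filter zi eqxx; apply/Pl.
  apply: (b_mult (Bn N) (i := i) (x := x)); first exact: undup_uniq.
  move=> o; rewrite mem_undup => /mapP[t]; rewrite mem_filter => /andP[/eqP ti tl ->].
  have E := finE _ _ (lN _ tl); have [_ _ h3 _ h5] := b_idx (Bn N) E.
  rewrite ti in h3 h5; split=> //.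
  have Do := center_dom (Bn N) h3.
  apply: (@dle_leq _ _ _ cl_refl _ (Rad G W 3).+1) => //; first by rewrite /Rad; lia.
  by exists t => //; exists P; split=> //; apply/Pl.
have rec t : exists L, forall s P x y, uniq s -> (size s + t = 4)%N -> hist s P ->
    small P -> P x -> P y -> hop adj cen L x y.
  elim: t => [|t [L0 IHt]].
    exists 0 => s P x y us; rewrite addn0 => s4 hs _ Px _.
    by have := hist3 _ _ _ us hs Px; rewrite s4.
  (* Here [k] counts the clusters of [i] still allowed. One of them is reached at its first visit
     and left at its last; before and after, only the other [k'] are met. *)
  pose f := fix f k := if k is k'.+1 then (f k' + 1 + (1 + f k'))%N else L0.
  have fS k : (f k <= f k.+1)%N by rewrite /=; lia.
  exists (f m) => s P x y us s4 hs sP Px Py.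
  have [u Pu umin] := minix _ _ Px; pose i := ix u.
  have [cs [csm csP]] : exists cs : seq V, (size cs <= m)%N /\
      forall z, P z -> ix z = i -> cen z \in cs by apply: near Px _ umin => //; exists u.
  have main (c : seq V) a b : conn (P `&` [set z | ix z = i -> cen z \in c]) a b ->
      hop adj cen (f (size c)) a b.
    elim: c a b => [|o c IHc] a b ab.
      have abP : conn (P `\` [set z | ix z = i]) a b.
        by apply: conn_sub ab => z [Pz /= zi]; split=> // /zi.
      pose Q := conn (P `\` [set z | ix z = i]) a.
      have QP : Q `<=` P by move=> z /conn_r[].
      apply: (IHt (i :: s) Q); last exact: abP.
      - rewrite /= us andbT; apply/negP => si.
        by have [/(_ _ Pu)] := hs _ si; rewrite ltnn.
      - by rewrite /= addSnnS.
      - move=> k; rewrite inE => /orP[/eqP->|ks].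
          split; last by exists P; split=> //; exists u.
          move=> z /conn_r[Pz /= zi]; rewrite ltn_neqAle umin // andbT.
          by apply/eqP => /esym.
        have [h1 [P' [h2 h3 h4 h5]]] := hs _ ks; split; first by move=> z /QP/h1.
        by exists P'; split=> // z /QP/h3.
      - apply: small_sub sP QP _; exact: connected_comp.
      - by apply: conn_refl; exact: conn_l abP.
    case: (conn_split adj_symm [set z | cen z = o] ab).
      move=> ab'; apply: hop_leq (fS _) _; apply: IHc; apply: conn_sub ab'.
      move=> z [[Pz /= zc] zo]; split=> // /zc; rewrite inE => /orP[/eqP//|].
      exact.
    have att z t1 : cen t1 = o -> attached adj
        (P `&` [set z | ix z = i -> cen z \in o :: c]) [set z | cen z = o] z t1 ->
        hop adj cen (f (size c) + 1) z t1.
      move=> t1o [->|[z1 zz1 z1t]].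
        by apply: (@hop_leq _ _ _ 0).
      apply: hop_trans (hop1 (touch_adj cen z1t)); apply: IHc; apply: conn_sub zz1.
      move=> z2 [[Pz /= zc] zo]; split=> // /zc; rewrite inE => /orP[/eqP//|].
      exact.
    move=> [t1 [t2 [[_ t1o] [_ t2o] /(att _ _ t1o) a1 /(att _ _ t2o) a2]]].
    rewrite /= [X in (_ + X)%N]addnC; apply: hop_trans a1 _.
    have t12 : hop adj cen 0 t1 t2 by rewrite /= t1o t2o.
    exact: (hop_trans t12 (hop_sym adj_symm a2)).
  have fm k : (k <= m)%N -> (f k <= f m)%N.
    move=> /subnKC <-; elim: (m - k)%N => [|d IHd]; first by rewrite addn0.
    by rewrite addnS; apply: leq_trans IHd (fS _).
  apply: hop_leq (fm _ csm) _; apply: main; apply: conn_sub (sP.1 _ _ Px Py).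
  by move=> z Pz; split=> // /csP; apply.
have [L Lp] := rec 4.
exists cen, (Rad G W 3), L; split.
- by move=> x; have [] := finP _ _ _ _ (cenA x).
- move=> x; have E := finE _ _ (ltnSn (pickle x)).
  have [_ _ _ h _] := b_idx (Bn _) E; apply: conn_sub h => y /= yE.
  by have [] := finP _ _ _ _ yE.
- move=> x; have E := finE _ _ (ltnSn (pickle x)).
  have [_ _ _ _ h] := b_idx (Bn _) E.
  have sub D k a b : dle D k a b -> dle setT k a b.
    elim: k b => //= k IHk b [c /IHk ac cb]; exists c => //.
    by apply: st_sub cb.
  exact: sub h.
- by move=> P x y sP Px Py; apply: (Lp [::] P).
Qed.

End Decomposition.

Theorem cluster_decomposition (V : countType) (adj cl : V -> V -> Prop) :
  (forall x y, adj x y -> adj y x) ->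
  (forall x, cl x x) -> (forall x y, cl x y -> cl y x) ->
  (forall x y, adj x y -> cl x y) ->
  (forall x, finite_set [set y | cl x y]) -> ~ finite_set [set: V] ->
  (forall A : nat -> set V,
    (forall i, (i < 5)%N -> connected_set adj (A i)) ->
    (forall i j x, (i < j < 5)%N -> A i x -> A j x -> False) ->
    (forall i j, (i < j < 5)%N -> exists x y, [/\ A i x, A j y & adj x y]) ->
    False) ->
  exists (cen : V -> V) (R L : nat),
  [/\ forall x, cen (cen x) = cen x,
      forall x, conn adj [set y | cen y = cen x] (cen x) x,
      forall x, dle adj cl setT R (cen x) x &
      forall P x y, small adj cl P -> P x -> P y -> hop adj cen L x y].
Proof.
move=> h1 h2 h3 h4 h5 h6 h7.
exact: (cluster_decomposition_aux h1 h2 h3 h4 h5 h6 h7 erefl erefl erefl erefl).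
Qed.

(** * The square grid has no K5 minor *)

Section NoK5.
Local Open Scope ring_scope.
Local Notation Z2 := (int * int)%type.

Definition gadj (p q : Z2) : Prop :=
  (p.1 = q.1 /\ (q.2 = p.2 + 1 \/ p.2 = q.2 + 1)) \/
  (p.2 = q.2 /\ (q.1 = p.1 + 1 \/ p.1 = q.1 + 1)).

Lemma gadj_sym p q : gadj p q -> gadj q p.
Proof. rewrite /gadj; lia. Qed.

(* The step from [a] to [b] crosses the upward ray issued from the center of the
   unit square whose lower left corner is [q]. *)
Definition crosses (a b q : Z2) : bool :=
  [&& a.2 == b.2, (a.1 == q.1) && (b.1 == q.1 + 1) || (b.1 == q.1) && (a.1 == q.1 + 1)
    & q.2 < a.2].

(* The order at infinity of the upward rays. *)
Definition before (a b : Z2) : bool := (a.1 < b.1) || (a.1 == b.1) && (b.2 < a.2).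

Lemma beforeN a b : a <> b -> before a b = ~~ before b a.
Proof.
case: a b => [a1 a2] [b1 b2] ab; rewrite /before /=.
have {}ab : ~ (a1 = b1 /\ a2 = b2) by move=> [e1 e2]; apply: ab; rewrite e1 e2.
lia.
Qed.

Lemma crosses_sym a b q : crosses a b q = crosses b a q.
Proof.
rewrite /crosses eq_sym orbC; case: eqP => //= e.
by rewrite e.
Qed.

Lemma crosses_vert (x y : int) q : crosses (x, y) (x, y + 1) q = false.
Proof. by rewrite /crosses /=; apply/negbTE/negP => /andP[/eqP]; lia. Qed.

Lemma before_vert (x y : int) c :
  (x, y + 1) <> c -> before c (x, y) = before c (x, y + 1).
Proof.
case: c => c1 c2 n; have {}n : ~ (x = c1 /\ y + 1 = c2) by move=> [e1 e2]; apply: n; congr pair.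
by rewrite /before /=; case: (ltgtP c1 x) n => //= ->; lia.
Qed.

Lemma before_vertr (x y : int) c :
  (x, y) <> c -> before (x, y) c = before (x, y + 1) c.
Proof.
case: c => c1 c2 n; have {}n : ~ (x = c1 /\ y = c2) by move=> [e1 e2]; apply: n; congr pair.
by rewrite /before /=; case: (ltgtP x c1) n => //= ->; lia.
Qed.

Lemma crosses_vertr a a' (x y : int) : a <> (x, y + 1) -> a' <> (x, y + 1) ->
  crosses a a' (x, y) = crosses a a' (x, y + 1).
Proof.
case: a a' => [a1 a2] [b1 b2] n n'.
have {}n : ~ (a1 = x /\ a2 = y + 1) by move=> [e1 e2]; apply: n; congr pair.
have {}n' : ~ (b1 = x /\ b2 = y + 1) by move=> [e1 e2]; apply: n'; congr pair.
rewrite /crosses /=; case: eqP => //= ab.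
have [/andP[/eqP e1 /eqP e2]|] := boolP ((a1 == x) && _) => /=; first lia.
by have [/andP[/eqP e1 /eqP e2] _|//] := boolP ((b1 == x) && _) => /=; lia.
Qed.

Local Ltac decide_int := repeat match goal with
  | |- context [@eq_op ?T ?a ?b] =>
      first [have -> : @eq_op T a b = true by apply/eqP; lia
            |have -> : @eq_op T a b = false by apply/eqP; lia]
  | |- context [@Order.lt ?d ?T ?a ?b] =>
      first [have -> : @Order.lt d T a b = true by lia
            |have -> : @Order.lt d T a b = false by lia]
  end.

Lemma cross_edge_hor (x y u w : int) :
  (x, y) <> (u, w) -> (x, y) <> (u + 1, w) -> (x + 1, y) <> (u, w) ->
  crosses (x, y) (x + 1, y) (u, w) (+) crosses (x, y) (x + 1, y) (u + 1, w) (+)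
  (crosses (u, w) (u + 1, w) (x, y) (+) crosses (u, w) (u + 1, w) (x + 1, y)) =
  before (x, y) (u, w) (+) before (x, y) (u + 1, w) (+)
  (before (x + 1, y) (u, w) (+) before (x + 1, y) (u + 1, w)).
Proof.
move=> n1 n2 n3; rewrite /crosses /before /=.
have {}n1 : ~ (x = u /\ y = w) by move=> [e1 e2]; apply: n1; congr pair.
have {}n2 : ~ (x = u + 1 /\ y = w) by move=> [e1 e2]; apply: n2; congr pair.
have {}n3 : ~ (x + 1 = u /\ y = w) by move=> [e1 e2]; apply: n3; congr pair.
have [h|[h|h]] : y < w \/ w < y \/ y = w by lia.
- have h' : x = u \/ x = u + 1 \/ u = x + 1 \/ (x < u - 1) \/ (u + 1 < x) by lia.
  by case: h' => [e|[e|[e|[e|e]]]]; decide_int; rewrite /= ?andbF.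
- have h' : x = u \/ x = u + 1 \/ u = x + 1 \/ (x < u - 1) \/ (u + 1 < x) by lia.
  by case: h' => [e|[e|[e|[e|e]]]]; decide_int; rewrite /= ?andbF.
- have h' : (x < u - 1) \/ (u + 1 < x) by lia.
  by case: h' => e; decide_int; rewrite /= ?andbF.
Qed.

(** Prolong both edges at each end by its upward ray, moved to just right of the vertex, the lower
    vertices of a column further right. Two such curves cross an odd number of times exactly when
    their ends interleave at infinity, which is the right-hand side. The edges being disjoint, and
    the rays too, only crossings of an edge with a ray remain on the left. *)
Lemma cross_edge a a' c c' : gadj a a' -> gadj c c' ->
  a <> c -> a <> c' -> a' <> c -> a' <> c' ->
  crosses a a' c (+) crosses a a' c' (+) (crosses c c' a (+) crosses c c' a') =
  before a c (+) before a c' (+) (before a' c (+) before a' c').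
Proof.
have horP p q : gadj p q ->
    [\/ exists x y : int, (p, q) = ((x, y), (x, y + 1)),
        exists x y : int, (q, p) = ((x, y), (x, y + 1)),
        exists x y : int, (p, q) = ((x, y), (x + 1, y)) |
        exists x y : int, (q, p) = ((x, y), (x + 1, y))].
  case: p q => [p1 p2] [q1 q2]; rewrite /gadj /= => -[[-> [->|->]]|[-> [->|->]]].
  - by apply: Or41; exists q1, p2.
  - by apply: Or42; exists q1, q2.
  - by apply: Or43; exists p1, q2.
  - by apply: Or44; exists q1, q2.
have vert (x y : int) b b' : (x, y) <> b -> (x, y + 1) <> b -> (x, y) <> b' -> (x, y + 1) <> b' ->
  [/\ crosses (x, y) (x, y + 1) b = false, crosses (x, y) (x, y + 1) b' = false,
      crosses b b' (x, y) = crosses b b' (x, y + 1),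
      before (x, y) b = before (x, y + 1) b &
      [/\ before (x, y) b' = before (x, y + 1) b', before b (x, y) = before b (x, y + 1) &
          before b' (x, y) = before b' (x, y + 1)]].
  move=> n1 n2 n3 n4; split; rewrite ?crosses_vert //.
  - by apply: crosses_vertr; apply: nesym.
  - exact: before_vertr.
  - by split; [exact: before_vertr|exact: before_vert|exact: before_vert].
move=> /horP[] [x [y [-> ->]]] hc n1 n2 n3 n4.
- have [-> -> -> -> [-> _ _]] := vert x y c c' n1 n3 n2 n4.
  by rewrite !addbb.
- have [h1 h2 -> -> [-> _ _]] := vert x y c c' n3 n1 n4 n2.
  by rewrite crosses_sym h1 crosses_sym h2 !addbb.
- case: (horP _ _ hc) n1 n2 n3 n4 => -[u [w [-> ->]]] n1 n2 n3 n4.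
  + have [-> -> -> _ [_ -> ->]] := vert u w (x, y) (x + 1, y) (nesym n1) (nesym n2) (nesym n3) (nesym n4).
    by rewrite !addbb.
  + have [h1 h2 -> _ [_ -> ->]] := vert u w (x, y) (x + 1, y) (nesym n2) (nesym n1) (nesym n4) (nesym n3).
    by rewrite ![crosses (u, w + 1) _ _]crosses_sym h1 h2 !addbb.
  + exact: cross_edge_hor.
  + rewrite [LHS]addbC [crosses (u + 1, w) _ _]crosses_sym (crosses_sym (u + 1, w)).
    rewrite [LHS]addbC (addbC (crosses _ _ (u + 1, w))) cross_edge_hor //.
    by rewrite (addbC (before (x, y) _)) (addbC (before (x + 1, y) _)).
- case: (horP _ _ hc) n1 n2 n3 n4 => -[u [w [-> ->]]] n1 n2 n3 n4.
  + have [-> -> -> _ [_ -> ->]] := vert u w (x + 1, y) (x, y) (nesym n1) (nesym n2) (nesym n3) (nesym n4).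
    by rewrite !addbb.
  + have [h1 h2 -> _ [_ -> ->]] := vert u w (x + 1, y) (x, y) (nesym n2) (nesym n1) (nesym n4) (nesym n3).
    by rewrite ![crosses (u, w + 1) _ _]crosses_sym h1 h2 !addbb.
  + rewrite !(crosses_sym (x + 1, y)) (addbC (crosses (u, w) _ _)) cross_edge_hor //.
    by rewrite addbC.
  + rewrite !(crosses_sym (x + 1, y)) !(crosses_sym (u + 1, w)).
    rewrite (addbC (crosses (u, w) _ _)) (addbC (crosses (x, y) _ _)) cross_edge_hor //.
    rewrite addbC (addbC (before (x, y) _)) (addbC (before (x + 1, y) _)) //.
Qed.

Fixpoint gpath (a : Z2) (l : seq Z2) : Prop :=
  if l is b :: l' then gadj a b /\ gpath b l' else True.

Fixpoint upcross (a : Z2) (l : seq Z2) (q : Z2) : bool :=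
  if l is b :: l' then crosses a b q (+) upcross b l' q else false.

Lemma cross_step a l c c' : gpath a l -> gadj c c' ->
  c \notin a :: l -> c' \notin a :: l ->
  upcross a l c (+) upcross a l c' (+) (crosses c c' a (+) crosses c c' (last a l)) =
  before a c (+) before a c' (+) (before (last a l) c (+) before (last a l) c').
Proof.
move=> pl cc; elim: l a pl => [a _ _ _|b l IHl a [ab pl]] /=; first by rewrite !addbb.
rewrite !inE !negb_or => /and3P[/eqP ca /eqP cb cl] /and3P[/eqP ca' /eqP cb' cl'].
have := @cross_edge a b c c' ab cc (nesym ca) (nesym ca') (nesym cb) (nesym cb').
have := IHl b pl; rewrite !inE !negb_or.
move/eqP: cb => cb; move/eqP: cb' => cb'; rewrite cb cl cb' cl' => /(_ isT isT).
rewrite (addbACA (crosses a b c) (upcross b l c)).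
move: (crosses a b c (+) crosses a b c') (upcross b l c (+) upcross b l c')
  (crosses c c' a) (crosses c c' b) (crosses c c' (last b l)) (before a c (+) _) (before b c (+) _) (before (last b l) c (+) _).
by do 8!case.
Qed.

Lemma cross_paths a l c k : gpath a l -> gpath c k ->
  (forall x, x \in a :: l -> x \in c :: k -> False) ->
  upcross a l c (+) upcross a l (last c k) (+) (upcross c k a (+) upcross c k (last a l)) =
  before a c (+) before a (last c k) (+)
  (before (last a l) c (+) before (last a l) (last c k)).
Proof.
move=> pl; elim: k c => [c _ _|c' k IHk c [cc pk] dj] /=; first by rewrite !addbb.
have nc : c \notin a :: l by apply/negP => /dj; apply; rewrite mem_head.
have nc' : c' \notin a :: l by apply/negP => /dj; apply; rewrite !inE eqxx orbT.
have h1 := cross_step pl cc nc nc'.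
have /IHk h2 : gpath c' k := pk.
have {}h2 := h2 (fun x xl xk => dj x xl ltac:(rewrite inE xk orbT //)).
move: h1 h2; rewrite (addbACA (before a c) (before a c')).
rewrite (addbACA (before a c') (before a (last c' k))).
rewrite (addbACA (before a c) (before a (last c' k))).
rewrite (addbACA (crosses _ _ _) (upcross _ _ _)).
move: (upcross a l c) (upcross a l c') (upcross a l (last c' k))
  (crosses c c' a (+) crosses c c' (last a l))
  (upcross c' k a (+) upcross c' k (last a l)) (before a c (+) _) (before a c' (+) _)
  (before a (last c' k) (+) _).
by do 8!case.
Qed.

Lemma conn_gpath (D : set Z2) a b : conn gadj D a b ->
  exists l, [/\ gpath a l, last a l = b & forall x, x \in a :: l -> D x].
Proof.
elim=> [Da|y z _ [l [pl <- lD]] yz Dz].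
  by exists [::]; split=> // x; rewrite inE => /eqP->.
exists (rcons l z); split; last 2 first.
- by rewrite last_rcons.
- by move=> x; rewrite -rcons_cons mem_rcons inE => /orP[/eqP->|/lD].
- elim: l a pl yz {lD} => [|t l IHl] a /=; first by split.
  by move=> [ay pl] yz; split=> //; apply: IHl.
Qed.

(** A parity argument in the style of van Kampen: sum [cross_paths] over the fifteen pairs of
    disjoint edges of K5. Each crossing parity [u i j l] occurs twice. Each comparison of two
    vertices occurs six times, some of them reversed, where [s] becomes [1 - s]; every set of four
    vertices contributes three reversals, so there are fifteen, an odd number. *)
Lemma no_K5 (A : nat -> set Z2) :
  (forall i, (i < 5)%N -> connected_set gadj (A i)) ->
  (forall i j x, (i < j < 5)%N -> A i x -> A j x -> False) ->
  (forall i j, (i < j < 5)%N -> exists x y, [/\ A i x, A j y & gadj x y]) -> False.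
Proof.
move=> cA dA tA.
have dis i j x : (i < 5)%N -> (j < 5)%N -> i <> j -> A i x -> A j x -> False.
  move=> i5 j5 ij Ai Aj; case: (ltngtP i j) => // lt.
    by apply: (dA i j x) => //; rewrite lt.
  by apply: (dA j i x) => //; rewrite lt.
have /choice[r rA] : forall i, exists x : Z2, (i < 5)%N -> A i x.
  move=> i; case: (ltnP i 5) => [i5|_]; last by exists (0, 0).
  have [i4|i4] := ltnP i 4.
    by have [x [y [Ax _ _]]] := tA i 4 ltac:(lia); exists x.
  have -> : i = 4 by lia.
  by have [x [y [_ Ay _]]] := tA 0 4 isT; exists y.
have /choice[P PP] : forall ij : nat * nat, exists l, (ij.1 < ij.2 < 5)%N ->
    [/\ gpath (r ij.1) l, last (r ij.1) l = r ij.2 &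
        forall x, x \in r ij.1 :: l -> A ij.1 x \/ A ij.2 x].
  move=> [i j] /=.
  case: (boolP (i < j < 5)%N) => [ij|_]; last by exists [::].
  have [x [y [Ax Ay xy]]] := tA _ _ ij.
  have i5 : (i < 5)%N by lia.
  have j5 : (j < 5)%N by lia.
  suff /conn_gpath[l [h1 h2 h3]] : conn gadj [set x | A i x \/ A j x] (r i) (r j).
    by exists l.
  apply: (conn_trans (y := x)).
    by apply: conn_sub (cA _ i5 _ _ (rA _ i5) Ax) => z; left.
  apply: (conn_trans (y := y)); last first.
    by apply: conn_sub (cA _ j5 _ _ Ay (rA _ j5)) => z; right.
  by apply: conn_adj xy; [left|right].
(* Parities are read as natural numbers so that the fifteen identities become a linear system
   without integral solution. *)
pose u i j l : nat := upcross (r i) (P (i, j)) (r l).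
pose s i k : nat := before (r i) (r k).
have sN i k : (i < k < 5)%N -> (s i k + s k i = 1)%N.
  move=> ik; rewrite /s beforeN; first by case: before.
  move=> e; apply: (dA i k (r i)) => //; last rewrite e; apply: rA; lia.
have E i j k l : (i < j < 5)%N -> (k < l < 5)%N -> i <> k -> i <> l -> j <> k -> j <> l ->
    exists h, (u i j k + u i j l + (u k l i + u k l j) +
    (s i k + s i l + (s j k + s j l)) = 2 * h)%N.
  move=> ij kl ik il jk jl.
  have [p1 e1 d1] := PP (i, j) ij; have [p2 e2 d2] := PP (k, l) kl.
  rewrite /= in p1 e1 d1 p2 e2 d2.
  have := cross_paths p1 p2; rewrite e1 e2 => H.
  have {}H := H ltac:(move=> x /d1[] h /d2[] h'; apply: dis h h'; lia).
  exists ((u i j k + u i j l + (u k l i + u k l j) +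
    (s i k + s i l + (s j k + s j l))) %/ 2)%N.
  move: H; rewrite /u /s.
  case: (upcross (r i) _ (r k)); case: (upcross (r i) _ (r l));
  case: (upcross (r k) _ (r i)); case: (upcross (r k) _ (r j));
  case: (before (r i) (r k)); case: (before (r i) (r l));
  by case: (before (r j) (r k)); case: (before (r j) (r l)).
have [h1 e1] := E 0 1 2 3 isT isT ltac:(lia) ltac:(lia) ltac:(lia) ltac:(lia).
have [h2 e2] := E 0 1 2 4 isT isT ltac:(lia) ltac:(lia) ltac:(lia) ltac:(lia).
have [h3 e3] := E 0 1 3 4 isT isT ltac:(lia) ltac:(lia) ltac:(lia) ltac:(lia).
have [h4 e4] := E 0 2 1 3 isT isT ltac:(lia) ltac:(lia) ltac:(lia) ltac:(lia).
have [h5 e5] := E 0 2 1 4 isT isT ltac:(lia) ltac:(lia) ltac:(lia) ltac:(lia).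
have [h6 e6] := E 0 2 3 4 isT isT ltac:(lia) ltac:(lia) ltac:(lia) ltac:(lia).
have [h7 e7] := E 0 3 1 2 isT isT ltac:(lia) ltac:(lia) ltac:(lia) ltac:(lia).
have [h8 e8] := E 0 3 1 4 isT isT ltac:(lia) ltac:(lia) ltac:(lia) ltac:(lia).
have [h9 e9] := E 0 3 2 4 isT isT ltac:(lia) ltac:(lia) ltac:(lia) ltac:(lia).
have [h10 e10] := E 0 4 1 2 isT isT ltac:(lia) ltac:(lia) ltac:(lia) ltac:(lia).
have [h11 e11] := E 0 4 1 3 isT isT ltac:(lia) ltac:(lia) ltac:(lia) ltac:(lia).
have [h12 e12] := E 0 4 2 3 isT isT ltac:(lia) ltac:(lia) ltac:(lia) ltac:(lia).
have [h13 e13] := E 1 2 3 4 isT isT ltac:(lia) ltac:(lia) ltac:(lia) ltac:(lia).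
have [h14 e14] := E 1 3 2 4 isT isT ltac:(lia) ltac:(lia) ltac:(lia) ltac:(lia).
have [h15 e15] := E 1 4 2 3 isT isT ltac:(lia) ltac:(lia) ltac:(lia) ltac:(lia).
have s01 := sN 0 1 isT; have s02 := sN 0 2 isT; have s03 := sN 0 3 isT.
have s04 := sN 0 4 isT; have s12 := sN 1 2 isT; have s13 := sN 1 3 isT.
have s14 := sN 1 4 isT; have s23 := sN 2 3 isT; have s24 := sN 2 4 isT.
have s34 := sN 3 4 isT.
clear E sN PP tA dA cA dis rA; clearbody u s.
lia.
Qed.

End NoK5.

(** * Arcs *)

Lemma falseR (R : realType) : ((1 : R) <= 0)%R -> False.
Proof. by rewrite ler10. Qed.

Section Arcs.
Local Open Scope ring_scope.
Variables (R : realType) (E : normedModType R).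
Implicit Types (a b c : E) (S T : set E).

Local Notation unit_itv := [set t : R | 0 <= t <= 1].

(** The parametrization is total and constant outside the unit interval, so that a concatenation is
    the single formula [f (2 * t) + g (2 * t - 1) - b], visibly continuous. *)
Definition is_arc a b S := exists f : R -> E,
  [/\ continuous f, forall t, t <= 0 -> f t = a, forall t, 1 <= t -> f t = b,
      forall s t, unit_itv s -> unit_itv t -> f s = f t -> s = t &
      S = f @` unit_itv].

(** The projection of the line onto the unit interval, in a form whose continuity is immediate. *)
Definition clamp (t : R) : R := (1 + `|t| - `|t - 1|) / 2.

Lemma clamp_continuous : continuous clamp.
Proof.
move=> t; apply: cvgM; last exact: cvg_cst.
apply: cvgB; first by apply: cvgD; [exact: cvg_cst|exact: norm_continuous].
by apply: cvg_norm; apply: cvgB; [exact: cvg_id|exact: cvg_cst].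
Qed.

Lemma clamp_le0 t : t <= 0 -> clamp t = 0.
Proof. by move=> t0; rewrite /clamp ler0_norm // ler0_norm; lra. Qed.

Lemma clamp_ge1 t : 1 <= t -> clamp t = 1.
Proof. by move=> t1; rewrite /clamp ger0_norm ?ger0_norm; lra. Qed.

Lemma clamp_id t : unit_itv t -> clamp t = t.
Proof. by move=> /= /andP[t0 t1]; rewrite /clamp ger0_norm // ler0_norm; lra. Qed.

Definition segment_set a b : set E := [set a + t *: (b - a) | t in unit_itv].

Lemma arc_segment a b : a <> b -> is_arc a b (segment_set a b).
Proof.
move=> ab; exists (fun t => a + clamp t *: (b - a)); split.
- move=> t; apply: cvgD; first exact: cvg_cst.
  by apply: cvgZ; [exact: clamp_continuous|exact: cvg_cst].
- by move=> t /clamp_le0->; rewrite scale0r addr0.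
- by move=> t /clamp_ge1->; rewrite scale1r addrC subrK.
- move=> s t /clamp_id-> /clamp_id-> /addrI/eqP.
  rewrite -subr_eq0 -scalerBl scaler_eq0 !subr_eq0 => /orP[/eqP//|/eqP ba].
  by case: ab.
- by apply/seteqP; split=> x [t tI <-]; exists t; rewrite // clamp_id.
Qed.

Lemma arc_r a b S : is_arc a b S -> S b.
Proof.
move=> [f [_ _ f1 _ ->]]; exists 1; last exact: f1.
by rewrite /= lexx ler01.
Qed.

Lemma arc_rev a b S : is_arc a b S -> is_arc b a S.
Proof.
move=> [f [fc f0 f1 fi ->]]; exists (fun t => f (1 - t)).
have I1 t : unit_itv t -> unit_itv (1 - t) by rewrite /=; lra.
split.
- have c1 : continuous (fun t : R => 1 - t).
    by move=> t; apply: cvgB; [exact: cvg_cst|exact: cvg_id].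
  by move=> t; exact: (continuous_comp (c1 t) (fc _)).
- by move=> t t0; apply: f1; lra.
- by move=> t t0; apply: f0; lra.
- by move=> s t /I1 s1 /I1 t1 /(fi _ _ s1 t1); lra.
- apply/seteqP; split=> x [t tI <-]; exists (1 - t); try exact: I1.
    by congr f; lra.
  by [].
Qed.

Lemma arc_cat a b c S T : is_arc a b S -> is_arc b c T ->
  (forall x, S x -> T x -> x = b) -> is_arc a c (S `|` T).
Proof.
move=> [f [fc f0 f1 fi SE]] [g [gc g0 g1 gi TE]] ST.
pose h t := f (2 * t) + g (2 * t - 1) - b.
have hl t : t <= 1 / 2 -> h t = f (2 * t).
  by move=> t2; rewrite /h g0 ?addrK //; lra.
have hr t : 1 / 2 <= t -> h t = g (2 * t - 1).
  by move=> t2; rewrite /h f1 1?[b + _]addrC ?addrK //; lra.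
have Sf t : unit_itv t -> S (f t) by move=> tI; rewrite SE; exists t.
have Tg t : unit_itv t -> T (g t) by move=> tI; rewrite TE; exists t.
have bf t : unit_itv t -> f t = b -> t = 1.
  move=> tI ftb; apply: fi => //; first by rewrite /=; lra.
  by rewrite ftb f1.
have bg t : unit_itv t -> g t = b -> t = 0.
  move=> tI ftb; apply: gi => //; first by rewrite /=; lra.
  by rewrite ftb g0.
exists h; split.
- have c2 : continuous (fun t : R => 2 * t).
    by move=> t; apply: cvgM; [exact: cvg_cst|exact: cvg_id].
  move=> t; apply: cvgB; last exact: cvg_cst.
  have c3 : continuous (fun t : R => 2 * t - 1).
    by move=> u; apply: cvgB; [exact: c2|exact: cvg_cst].
  apply: cvgD; first exact: (continuous_comp (c2 t) (fc _)).
  exact: (continuous_comp (c3 t) (gc _)).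
- by move=> t t0; rewrite hl ?f0 //; lra.
- by move=> t t1; rewrite hr ?g1 //; lra.
- have mix s t : unit_itv s -> unit_itv t -> s <= 1 / 2 -> 1 / 2 <= t -> h s = h t -> s = t.
    move=> /= sI tI s2 t2; rewrite hl // hr // => e.
    have s' : unit_itv (2 * s) by rewrite /=; lra.
    have t' : unit_itv (2 * t - 1) by rewrite /=; lra.
    have fb : f (2 * s) = b by apply: ST; [exact: Sf|rewrite e; exact: Tg].
    have e1 := bf _ s' fb; have e2 : 2 * t - 1 = 0 by apply: bg; rewrite // -e.
    lra.
  move=> s t sI tI; case: (lerP s (1 / 2)) => s2; case: (lerP t (1 / 2)) => t2.
  + rewrite !hl // => /fi e; suff : 2 * s = 2 * t by lra.
    by move: sI tI => /= sI tI; apply: e; rewrite /=; lra.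
  + by apply: mix => //; lra.
  + by move=> e; symmetry; apply: mix => //; lra.
  + rewrite !hr; [|lra|lra] => /gi e; suff : 2 * s - 1 = 2 * t - 1 by lra.
    by move: sI tI => /= sI tI; apply: e; rewrite /=; lra.
- rewrite SE TE; apply/seteqP; split=> x.
    case=> -[t /= tI <-].
      exists (t / 2); first by rewrite /=; lra.
      by rewrite hl; [congr f; lra|lra].
    exists ((t + 1) / 2); first by rewrite /=; lra.
    by rewrite hr; [congr g; lra|lra].
  move=> [t /= tI <-]; case: (lerP t (1 / 2)) => t2.
    by left; exists (2 * t); [rewrite /=; lra|rewrite hl].
  by right; exists (2 * t - 1); [rewrite /=; lra|rewrite hr //; lra].
Qed.

End Arcs.

(** * Routing the edges through the cells of the clusters *)

Section Strands.
Local Open Scope ring_scope.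
Variable R : realType.
Local Notation Z2 := (int * int)%type.
Local Notation E := 'rV[R]_2.

Definition mv (z d : Z2) : Z2 := (z.1 + d.1, z.2 + d.2).
Definition opp (d : Z2) : Z2 := (- d.1, - d.2).
Definition rot (d : Z2) : Z2 := (- d.2, d.1).
Definition isdir (d : Z2) : Prop :=
  [\/ d = (1, 0), d = (0, 1), d = (-1, 0) | d = (0, -1)].

Lemma oppK d : opp (opp d) = d.
Proof. by case: d => a b; rewrite /opp /= !opprK. Qed.

Lemma rot2 d : rot (rot d) = opp d.
Proof. by case: d => a b. Qed.

Lemma rot_opp d : rot (opp d) = opp (rot d).
Proof. by case: d. Qed.

Lemma mvK z d : mv (mv z d) (opp d) = z.
Proof. by case: z d => [a b] [c e]; rewrite /mv /= !addrK. Qed.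

Lemma isdir_opp d : isdir d -> isdir (opp d).
Proof.
case=> ->; rewrite /opp /= ?oppr0 ?opprK;
  [apply: Or43|apply: Or44|apply: Or41|apply: Or42] => //.
Qed.

Lemma dir4 u d : isdir u -> isdir d ->
  [\/ d = u, d = opp u, d = rot u | d = opp (rot u)].
Proof.
by case=> -> [] ->; rewrite /opp /rot /= ?oppr0 ?opprK;
  first [apply: Or41; by []|apply: Or42; by []|apply: Or43; by []|apply: Or44; by []].
Qed.

Lemma gadj_dir z z' : gadj z z' -> exists2 d, isdir d & z' = mv z d.
Proof.
case: z z' => [a b] [a' b']; rewrite /gadj /= => -[[-> [->|->]]|[-> [->|->]]].
- by exists (0, 1); [apply: Or42|rewrite /mv /= addr0].
- by exists (0, -1); [apply: Or44|rewrite /mv /= addr0 addrK].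
- by exists (1, 0); [apply: Or41|rewrite /mv /= addr0].
- by exists (-1, 0); [apply: Or43|rewrite /mv /= addr0 addrK].
Qed.

Lemma dir_neq u : isdir u -> [/\ u <> opp u, u <> rot u, u <> opp (rot u),
  rot u <> opp u & opp (rot u) <> opp u /\ rot u <> opp (rot u)].
Proof. by case=> ->; rewrite /opp /rot /= ?oppr0 ?opprK. Qed.

Definition dot (w : E) (q u : Z2) : R :=
  (w 0 0 - q.1%:~R) * u.1%:~R + (w 0 1 - q.2%:~R) * u.2%:~R.

Definition mk (a b : R) : E := \row_j (if j == 0 then a else b).

(** The point of parameter [t] on the side [d] of the unit square centered at [q], run
    counterclockwise. The neighbouring square runs the same side backwards, whence the [1 - t] of
    [pt_flip]. *)
Definition pt (q d : Z2) (t : R) : E :=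
  mk (q.1%:~R + d.1%:~R / 2 - d.2%:~R * (t - 1 / 2))
     (q.2%:~R + d.2%:~R / 2 + d.1%:~R * (t - 1 / 2)).

Definition ctr (q : Z2) : E := mk q.1%:~R q.2%:~R.

Lemma mk0 a b : mk a b 0 0 = a.
Proof. by rewrite mxE. Qed.

Lemma mk1 a b : mk a b 0 1 = b.
Proof. by rewrite mxE. Qed.

Lemma row2_ext (w w' : E) : w 0 0 = w' 0 0 -> w 0 1 = w' 0 1 -> w = w'.
Proof.
move=> h0 h1; apply/rowP => j; case: (unliftP 0 j) => [k|] ->; rewrite ?ord1 //.
by have -> : lift 0 (0 : 'I_1) = 1 by apply/val_inj.
Qed.

Lemma dot_opp w q u : dot w q (opp u) = - dot w q u.
Proof. by rewrite /dot /opp /= !mulrNz; ring. Qed.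

Lemma dot_ext w w' q u : isdir u -> dot w q u = dot w' q u ->
  dot w q (rot u) = dot w' q (rot u) -> w = w'.
Proof.
rewrite /dot /rot => -[] -> /=; rewrite ?mulrNz ?mulr0z ?mulr1z => h1 h2;
  by apply: row2_ext; lra.
Qed.

Lemma dot_pt q d t : isdir d -> dot (pt q d t) q d = 1 / 2 /\
  dot (pt q d t) q (rot d) = t - 1 / 2.
Proof.
by case=> ->; rewrite /dot /pt /rot !mk0 !mk1 /= ?mulrNz ?mulr0z ?mulr1z; split; lra.
Qed.

Lemma dot_ctr q d : dot (ctr q) q d = 0.
Proof. by rewrite /dot /ctr mk0 mk1; ring. Qed.

Lemma dot_mv w q d e : dot w (mv q d) e =
  dot w q e - (d.1%:~R * e.1%:~R + d.2%:~R * e.2%:~R).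
Proof. by rewrite /dot /mv /= !intrD; ring. Qed.

Lemma pt_flip q d t : isdir d -> pt (mv q d) (opp d) (1 - t) = pt q d t.
Proof.
move=> hd; have hd' := isdir_opp hd.
have [h1 h2] := dot_pt q t hd; have [h3 h4] := dot_pt (mv q d) (1 - t) hd'.
apply: (dot_ext hd (q := q)).
  rewrite h1; move: h3; rewrite dot_opp dot_mv; case: hd => ->;
  by rewrite /= ?mulrNz ?mulr0z ?mulr1z; lra.
rewrite h2; move: h4; rewrite rot_opp dot_opp dot_mv; case: hd => ->;
by rewrite /rot /= ?mulrNz ?mulr0z ?mulr1z; lra.
Qed.

Variables (cen pd : Z2 -> Z2) (dep : Z2 -> nat).
Hypothesis pdP : forall z, z <> cen z ->
  [/\ isdir (pd z), cen (mv z (pd z)) = cen z & (dep (mv z (pd z)) < dep z)%N].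

(* The chord that crosses the cell of [q] from position [px] of the side of its
   parent to position [t] of the side [d] is the line [X = px + Y * sl] for
   [0 <= Y <= ym], in the frame whose [X]-axis is the side of the parent. *)
Definition px (q d : Z2) (t : R) : R :=
  if d == opp (rot (pd q)) then (1 - t) / 3
  else if d == opp (pd q) then (2 - t) / 3 else 1 - t / 3.
Definition sl (q d : Z2) (t : R) : R :=
  if d == opp (rot (pd q)) then - 1 / 3
  else if d == opp (pd q) then (1 - 2 * t) / 3 else 1 / 3.
Definition ym (q d : Z2) (t : R) : R :=
  if d == opp (rot (pd q)) then 1 - t
  else if d == opp (pd q) then 1 else t.

Definition valid (q d : Z2) (t : R) :=
  [/\ isdir d, 0 < t < 1 & q <> cen q -> d <> pd q].

(** A radius in the cell of a root, a chord to the side of the parent elsewhere. The chord omits its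
    end on that side ([0 < Y]), which is left to the cell of the parent. *)
Definition on (q d : Z2) (t : R) (w : E) : Prop :=
  if q == cen q then
    exists2 l : R, 0 <= l <= 1 & dot w q d = l / 2 /\ dot w q (rot d) = l * (t - 1 / 2)
  else let X := 1 / 2 + dot w q (rot (pd q)) in let Y := 1 / 2 - dot w q (pd q) in
    [/\ 0 < Y, Y <= ym q d t & X = px q d t + Y * sl q d t].

Lemma valid3 q d t : q <> cen q -> valid q d t ->
  [\/ [/\ d = opp (rot (pd q)), px q d t = (1 - t) / 3, sl q d t = - 1 / 3 & ym q d t = 1 - t],
      [/\ d = opp (pd q), px q d t = (2 - t) / 3, sl q d t = (1 - 2 * t) / 3 & ym q d t = 1] |
      [/\ d = rot (pd q), px q d t = 1 - t / 3, sl q d t = 1 / 3 & ym q d t = t]].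
Proof.
move=> qr [hd _ /(_ qr) dp]; have [hu _ _] := pdP qr.
have [_ _ _ n1 [n2 n3]] := dir_neq hu.
rewrite /px /sl /ym; case: (dir4 hu hd) => [/dp//|dE|dE|dE].
- apply: Or32; rewrite dE; have -> : (opp (pd q) == opp (rot (pd q))) = false.
    by apply/eqP => /esym.
  by rewrite eqxx.
- apply: Or33; rewrite dE; have -> : (rot (pd q) == opp (rot (pd q))) = false by apply/eqP.
  by have -> : (rot (pd q) == opp (pd q)) = false by apply/eqP.
- by apply: Or31; rewrite dE eqxx.
Qed.

Lemma on_cell q d t w e : valid q d t -> on q d t w -> isdir e ->
  dot w q e <= 1 / 2 /\ (dot w q e = 1 / 2 -> e = d /\ w = pt q d t).
Proof.
move=> vq; rewrite /on; case: (q =P cen q) => [qr|qr].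
  move: vq => [hd /andP[t0 t1] _] [l /andP[l0 l1] [h1 h2]] he.
  have [p1 p2] := dot_pt q t hd.
  case: (dir4 hd he) => ->; rewrite ?dot_opp ?h1 ?h2.
  - split; first lra.
    move=> h; split=> //; apply: (dot_ext hd (q := q)); rewrite ?h1 ?h2 ?p1 ?p2; first lra.
    by have -> : l = 1; [lra|rewrite mul1r].
  - by split; [lra|move=> h; exfalso; apply: (@falseR R); lra].
  - have a1 : l * (t - 1 / 2) < 1 / 2 by nra.
    by split; [lra|move=> h; exfalso; apply: (@falseR R); lra].
  - have a1 : - (l * (t - 1 / 2)) < 1 / 2 by nra.
    by split; [lra|move=> h; exfalso; apply: (@falseR R); lra].
have [hu _ _] := pdP qr; have [hd /andP[t0 t1] dp] := vq.
set X := 1 / 2 + dot w q (rot (pd q)); set Y := 1 / 2 - dot w q (pd q).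
have eX : dot w q (rot (pd q)) = X - 1 / 2 by rewrite /X; lra.
have eY : dot w q (pd q) = 1 / 2 - Y by rewrite /Y; lra.
move=> [Y0 Y1 XY] he; have [p1 p2] := dot_pt q t hd.
have wpt : dot w q d = 1 / 2 -> dot w q (rot d) = t - 1 / 2 -> w = pt q d t.
  by move=> g1 g2; apply: (dot_ext hd (q := q)); rewrite ?g1 ?g2.
case: (valid3 qr vq) => -[dE pE sE yE]; rewrite pE sE in XY; rewrite yE in Y1;
case: (dir4 hu he) => ->; rewrite ?dot_opp ?eX ?eY.
- by split; [lra|move=> h; exfalso; apply: (@falseR R); lra].
- by split; [lra|move=> h; exfalso; apply: (@falseR R); lra].
- by split; [lra|move=> h; exfalso; apply: (@falseR R); lra].
- split; first lra; move=> h; split=> //; apply: wpt; rewrite dE ?rot_opp ?rot2 ?dot_opp ?oppK ?eX ?eY; lra.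
- by split; [lra|move=> h; exfalso; apply: (@falseR R); lra].
- split; first lra; move=> h; split=> //; apply: wpt; rewrite dE ?rot_opp ?rot2 ?dot_opp ?oppK ?eX ?eY; first lra.
  by have YE : Y = 1; [lra|rewrite YE in XY; lra].
- by split; [nra|move=> h; exfalso; apply: (@falseR R); nra].
- by split; [nra|move=> h; exfalso; apply: (@falseR R); nra].
- by split; [lra|move=> h; exfalso; apply: (@falseR R); lra].
- by split; [lra|move=> h; exfalso; apply: (@falseR R); lra].
- split; first lra; move=> h; split=> //; apply: wpt; rewrite dE ?rot_opp ?rot2 ?dot_opp ?oppK ?eX ?eY; lra.
- by split; [lra|move=> h; exfalso; apply: (@falseR R); lra].
Qed.

(** The three sides other than that of the parent are sent, in cyclic order, to the three thirds of
    the side of the parent, so distinct chords do not cross. In a root cell distinct radii share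
    only the center. *)
Lemma on_same q d t d' t' w : valid q d t -> valid q d' t' ->
  on q d t w -> on q d' t' w -> (d = d' /\ t = t') \/ q = cen q /\ w = ctr q.
Proof.
move=> v v'; rewrite /on; case: (q =P cen q) => [qr|qr].
  move: v v' => [hd /andP[t0 t1] _] [hd' /andP[s0 s1] _].
  move=> [l /andP[l0 l1] [h1 h2]] [k /andP[k0 k1] [h3 h4]].
  have [l00|lp] : l = 0 \/ 0 < l by lra.
    right; split=> //; apply: (dot_ext hd (q := q)).
      by rewrite h1 l00 dot_ctr; lra.
    by rewrite h2 l00 dot_ctr; lra.
  left; case: (dir4 hd hd') => dE; rewrite dE ?rot_opp ?rot2 ?dot_opp ?oppK in h3 h4.
  - split=> //; have lk : l = k by lra.
    rewrite lk in h2 lp; have : k * (t - t') = 0 by lra.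
    by move/eqP; rewrite mulf_eq0 => /orP[/eqP|/eqP]; lra.
  - by exfalso; apply: (@falseR R); lra.
  - exfalso; rewrite h2 in h3; rewrite h1 in h4; apply: (@falseR R); nra.
  - exfalso; rewrite h2 in h3; rewrite h1 in h4; apply: (@falseR R); nra.
move=> [Y0 Y1 XY] [_ Y1' XY']; left.
move: Y0 Y1 XY Y1' XY'; set Y := _ - dot w q _; set X := _ + _ => Y0 Y1 XY Y1' XY'.
have [_ /andP[t0 t1] _] := v; have [_ /andP[s0 s1] _] := v'.
case: (valid3 qr v) => -[dE pE sE yE]; case: (valid3 qr v') => -[dE' pE' sE' yE'];
rewrite pE sE in XY; rewrite pE' sE' in XY'; rewrite yE in Y1; rewrite yE' in Y1';
rewrite dE dE'.
- by split=> //; lra.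
- by exfalso; apply: (@falseR R); nra.
- by exfalso; apply: (@falseR R); nra.
- by exfalso; apply: (@falseR R); nra.
- split=> //; have : (t - t') * (1 + 2 * Y) = 0 by lra.
  by move/eqP; rewrite mulf_eq0 => /orP[/eqP|/eqP]; lra.
- by exfalso; apply: (@falseR R); nra.
- by exfalso; apply: (@falseR R); nra.
- by exfalso; apply: (@falseR R); nra.
- by split=> //; lra.
Qed.

(** By [on_cell], a piece lies in its closed square and reaches the boundary only at its own end on
    the side [d]. A common point thus lies on a side common to both squares and is that end for
    both; a corner would lie on two sides at once. *)
Lemma on_diff q d t q' d' t' w : valid q d t -> valid q' d' t' ->
  on q d t w -> on q' d' t' w -> q <> q' ->
  [/\ q' = mv q d, d' = opp d, w = pt q d t & w = pt q' d' t'].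
Proof.
move=> v v' o o' qq'.
have dirs := And4 (Or41 _ _ _ erefl : isdir (1, 0)) (Or42 _ _ _ erefl : isdir (0, 1))
  (Or43 _ _ _ erefl : isdir (-1, 0)) (Or44 _ _ _ erefl : isdir (0, -1)).
have [d1 d2 d3 d4] := dirs.
have [a1 b1] := on_cell v o d1; have [a2 b2] := on_cell v o d2.
have [a3 b3] := on_cell v o d3; have [a4 b4] := on_cell v o d4.
have [a1' b1'] := on_cell v' o' d1; have [a2' b2'] := on_cell v' o' d2.
have [a3' b3'] := on_cell v' o' d3; have [a4' b4'] := on_cell v' o' d4.
move: a1 b1 a2 b2 a3 b3 a4 b4 a1' b1' a2' b2' a3' b3' a4' b4'.
rewrite /dot /= ?mulrNz ?mulr0z ?mulr1z.
case: q q' qq' {v v' o o'} => [x y] [x' y'] qq' /=.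
move: (w 0 0) (w 0 1) => p r a1 b1 a2 b2 a3 b3 a4 b4 a1' b1' a2' b2' a3' b3' a4' b4'.
have bnd (z z' : int) : (z'%:~R - z%:~R <= 1 :> R) -> (z%:~R - z'%:~R <= 1 :> R) ->
    [\/ z' = z, z' = z + 1 | z = z' + 1].
  rewrite -!intrB !(ler_int R _ 1) => h1 h2.
  have [->|[->|->]] : z' = z \/ z' = z + 1 \/ z = z' + 1 by lia.
  - exact: Or31.
  - exact: Or32.
  - exact: Or33.
have bx := bnd x x' ltac:(lra) ltac:(lra); have by' := bnd y y' ltac:(lra) ltac:(lra).
case: bx => xE; case: by' => yE; subst;
  rewrite ?intrD ?mulr1z in a1 b1 a2 b2 a3 b3 a4 b4 a1' b1' a2' b2' a3' b3' a4' b4'.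
- by [].
- have [h1 h2] := b2 ltac:(lra); have [h3 h4] := b4' ltac:(lra).
  by rewrite -h1 -h3 /mv /opp /= ?addr0 ?oppr0; split; rewrite ?h1 ?h3.
- have [h1 h2] := b4 ltac:(lra); have [h3 h4] := b2' ltac:(lra).
  by rewrite -h1 -h3 /mv /opp /= ?addr0 ?oppr0 ?opprK ?addrK; split; rewrite ?h1 ?h3.
- have [h1 h2] := b1 ltac:(lra); have [h3 h4] := b3' ltac:(lra).
  by rewrite -h1 -h3 /mv /opp /= ?addr0 ?oppr0; split; rewrite ?h1 ?h3.
- by have [h1 _] := b1 ltac:(lra); have [h2 _] := b2 ltac:(lra); rewrite -h1 in h2.
- by have [h1 _] := b1 ltac:(lra); have [h2 _] := b4 ltac:(lra); rewrite -h1 in h2.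
- have [h1 h2] := b3 ltac:(lra); have [h3 h4] := b1' ltac:(lra).
  by rewrite -h1 -h3 /mv /opp /= ?addr0 ?oppr0 ?opprK ?addrK; split; rewrite ?h1 ?h3.
- by have [h1 _] := b3 ltac:(lra); have [h2 _] := b2 ltac:(lra); rewrite -h1 in h2.
- by have [h1 _] := b3 ltac:(lra); have [h2 _] := b4 ltac:(lra); rewrite -h1 in h2.
Qed.

Lemma px_bound q d t : q <> cen q -> valid q d t -> 0 < px q d t < 1.
Proof.
move=> qr v; have [_ /andP[t0 t1] _] := v.
by case: (valid3 qr v) => -[_ -> _ _]; apply/andP; split; lra.
Qed.

Lemma px_inj q d t d' t' : q <> cen q -> valid q d t -> valid q d' t' ->
  px q d t = px q d' t' -> d = d' /\ t = t'.
Proof.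
move=> qr v v'; have [_ /andP[t0 t1] _] := v; have [_ /andP[s0 s1] _] := v'.
case: (valid3 qr v) => -[dE -> _ _]; case: (valid3 qr v') => -[dE' -> _ _] h;
  rewrite dE dE'.
- by split=> //; lra.
- by exfalso; apply: (@falseR R); lra.
- by exfalso; apply: (@falseR R); lra.
- by exfalso; apply: (@falseR R); lra.
- by split=> //; lra.
- by exfalso; apply: (@falseR R); lra.
- by exfalso; apply: (@falseR R); lra.
- by exfalso; apply: (@falseR R); lra.
- by split=> //; lra.
Qed.

Lemma valid_prev q d t : q <> cen q -> valid q d t ->
  valid (mv q (pd q)) (opp (pd q)) (1 - px q d t).
Proof.
move=> qr v; have [hu cu du] := pdP qr; have /andP[p0 p1] := px_bound qr v.
split; [exact: isdir_opp|by apply/andP; split; lra|move=> qr' e].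
by have [_ _] := pdP qr'; rewrite -e mvK => /(ltn_trans du); rewrite ltnn.
Qed.

(** The successive cells, entrance sides and positions of a strand on its way to the root; [1 - px]
    because the parent reads the common side backwards. *)
Inductive orb (q d : Z2) (t : R) : Z2 -> Z2 -> R -> Prop :=
| orb_refl : orb q d t q d t
| orb_next q' d' t' : orb q d t q' d' t' -> q' <> cen q' ->
    orb q d t (mv q' (pd q')) (opp (pd q')) (1 - px q' d' t').

Lemma orb_valid q d t q' d' t' : valid q d t -> orb q d t q' d' t' -> valid q' d' t'.
Proof. by move=> v; elim=> // *; apply: valid_prev. Qed.

Lemma orb_cen q d t q' d' t' : orb q d t q' d' t' -> cen q' = cen q.
Proof. by elim=> // q1 d1 t1 _ e /pdP[_ -> _]. Qed.

Lemma orb_dep q d t q' d' t' : orb q d t q' d' t' -> (dep q' <= dep q)%N.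
Proof. by elim=> // q1 d1 t1 _ e /pdP[_ _ /ltnW h]; apply: leq_trans h e. Qed.

Lemma orb_inv q d t q' d' t' : orb q d t q' d' t' ->
  [/\ q' = q, d' = d & t' = t] \/ exists q1 d1 t1, [/\ orb q d t q1 d1 t1, q1 <> cen q1,
    q' = mv q1 (pd q1), d' = opp (pd q1) & t' = 1 - px q1 d1 t1].
Proof. by case=> [|q1 d1 t1 ob n]; [left|right; exists q1, d1, t1]. Qed.

Lemma orb_first q d t q' d' t' : q <> cen q ->
  orb (mv q (pd q)) (opp (pd q)) (1 - px q d t) q' d' t' -> orb q d t q' d' t'.
Proof.
move=> qr; elim=> [|q1 d1 t1 _ ob n]; last exact: orb_next.
by apply: orb_next => //; apply: orb_refl.
Qed.

Lemma orb_split q d t q' d' t' : orb q d t q' d' t' ->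
  [/\ q' = q, d' = d & t' = t] \/
  q <> cen q /\ orb (mv q (pd q)) (opp (pd q)) (1 - px q d t) q' d' t'.
Proof.
elim=> [|q1 d1 t1 _ [[-> -> ->]|[qr ob]] n]; first by left.
  by right; split=> //; apply: orb_refl.
by right; split=> //; apply: orb_next.
Qed.

Definition strand q d t : set E :=
  [set w | exists q' d' t', orb q d t q' d' t' /\ on q' d' t' w].

Lemma strand_root q d t : q = cen q -> strand q d t = on q d t.
Proof.
move=> qr; apply/seteqP; split=> w.
  by move=> [q' [d' [t' [/orb_split[[-> -> ->]|[]]]]]].
by move=> ob; exists q, d, t; split=> //; apply: orb_refl.
Qed.

Lemma strand_next q d t : q <> cen q ->
  strand q d t = on q d t `|` strand (mv q (pd q)) (opp (pd q)) (1 - px q d t).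
Proof.
move=> qr; apply/seteqP; split=> w.
  move=> [q' [d' [t' [/orb_split[[-> -> ->]|[_ ob]] ow]]]]; first by left.
  by right; exists q', d', t'.
move=> [ow|[q' [d' [t' [ob ow]]]]]; first by exists q, d, t; split=> //; apply: orb_refl.
by exists q', d', t'; split=> //; apply: orb_first.
Qed.

Lemma dot_seg a b l q e : dot (a + l *: (b - a)) q e = dot a q e + l * (dot b q e - dot a q e).
Proof. by rewrite /dot !mxE; ring. Qed.

Lemma on_root_segment q d t : q = cen q -> valid q d t ->
  on q d t = segment_set (ctr q) (pt q d t).
Proof.
move=> qr [hd _ _]; have [p1 p2] := dot_pt q t hd.
apply/seteqP; split=> w; rewrite /on -qr eqxx.
  move=> [l l01 [h1 h2]]; exists l => //; apply: (dot_ext hd (q := q));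
  by rewrite dot_seg dot_ctr ?p1 ?p2 ?h1 ?h2; lra.
by move=> [l l01 <-]; exists l => //; rewrite !dot_seg !dot_ctr p1 p2; split; lra.
Qed.

Lemma pt_chord q d t : q <> cen q -> valid q d t ->
  1 / 2 + dot (pt q d t) q (rot (pd q)) = px q d t + ym q d t * sl q d t /\
  1 / 2 - dot (pt q d t) q (pd q) = ym q d t.
Proof.
move=> qr v; have [hd _ _] := v; have [p1 p2] := dot_pt q t hd.
case: (valid3 qr v) => -[dE -> -> ->]; move: p1 p2; set P := pt _ _ _; rewrite dE;
  rewrite ?rot_opp ?rot2 ?dot_opp ?oppK => p1 p2; by split; lra.
Qed.

Lemma on_segment q d t : q <> cen q -> valid q d t ->
  let b := pt (mv q (pd q)) (opp (pd q)) (1 - px q d t) in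
  on q d t `|` [set b] = segment_set b (pt q d t) /\ ~ on q d t b.
Proof.
move=> qr v b; have [hu _ _] := pdP qr.
have bE : b = pt q (pd q) (px q d t) by rewrite /b pt_flip.
have [b1 b2] := dot_pt q (px q d t) hu; rewrite -bE in b1 b2.
have [c1 c2] := pt_chord qr v; have y0 : 0 < ym q d t.
  by have [_ /andP[t0 t1] _] := v; case: (valid3 qr v) => -[_ _ _ ->]; lra.
rewrite /on; case: (q =P cen q) => // _; split; last by rewrite b1 => -[]; lra.
apply/seteqP; split=> w.
  move=> [[h1 h2 h3]|->]; last by exists 0; rewrite /= ?lexx ?ler01 // scale0r addr0.
  exists ((1 / 2 - dot w q (pd q)) / ym q d t).
    have l0 : 0 <= (1 / 2 - dot w q (pd q)) / ym q d t by apply: divr_ge0; [exact: ltW h1|exact: ltW y0].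
    have l1 : (1 / 2 - dot w q (pd q)) / ym q d t <= 1 by rewrite ler_pdivrMr // [leRHS]mul1r.
    by rewrite /= l0 l1.
  apply: (dot_ext hu (q := q)); rewrite dot_seg ?b1 ?b2.
    have -> : dot (pt q d t) q (pd q) - 1 / 2 = - ym q d t by lra.
    by rewrite mulrN divfK; [lra|rewrite gt_eqF].
  have -> : dot (pt q d t) q (rot (pd q)) - (px q d t - 1 / 2) = ym q d t * sl q d t by lra.
  by rewrite mulrA divfK; [lra|rewrite gt_eqF].
move=> [l /= /andP[l0 l1] wE].
have [l00|lp] : l = 0 \/ 0 < l by lra.
  by right; rewrite -wE l00 scale0r addr0.
left; rewrite -wE !dot_seg b1 b2.
have -> : dot (pt q d t) q (pd q) - 1 / 2 = - ym q d t by lra.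
have -> : dot (pt q d t) q (rot (pd q)) - (px q d t - 1 / 2) = ym q d t * sl q d t by lra.
have m0 : 0 < l * ym q d t by apply: mulr_gt0.
have m1 : l * ym q d t <= ym q d t by rewrite -[leRHS]mul1r ler_wpM2r // ltW.
by split; [lra|lra|ring].
Qed.

(** By induction on the depth: the chord in [q] is appended to the strand of the parent, which runs
    through cells of smaller depth and so never comes back to [q]. *)
Lemma strand_arc q d t : valid q d t -> is_arc (ctr (cen q)) (pt q d t) (strand q d t).
Proof.
have [n] := ubnP (dep q); elim: n q d t => // n IHn q d t dn v.
have [qr|qr] := pselect (q = cen q).
  rewrite strand_root // on_root_segment // -qr; apply: arc_segment => cE.
  have [hd _ _] := v; have [p1 _] := dot_pt q t hd.
  by move: p1; rewrite -cE dot_ctr; lra.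
have [hu cu du] := pdP qr; rewrite strand_next //.
have vp := valid_prev qr v; set b := pt (mv q (pd q)) (opp (pd q)) (1 - px q d t).
have := IHn _ _ _ (leq_trans du dn) vp; rewrite cu -/b => arcp.
have [segE nb] := on_segment qr v; rewrite -/b in segE nb.
have -> : on q d t `|` strand (mv q (pd q)) (opp (pd q)) (1 - px q d t) =
   strand (mv q (pd q)) (opp (pd q)) (1 - px q d t) `|` segment_set b (pt q d t).
  rewrite -segE; apply/seteqP; split=> w.
    by case=> h; [right; left|left].
  by case=> [h|[h|->]]; [right|left|right; apply: (arc_r arcp)].
apply: arc_cat arcp _ _.
  apply: arc_segment => bE; apply: nb; rewrite bE.
  rewrite /on; case: (q =P cen q) => // _; have [c1 c2] := pt_chord qr v.
  rewrite c1 c2; split=> //.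
  by have [_ /andP[t0 t1] _] := v; case: (valid3 qr v) => -[_ _ _ ->]; lra.
move=> x [q' [d' [t' [ob ox]]]]; rewrite -segE => -[xq|//]; exfalso.
have dq : (dep q' < dep q)%N by apply: leq_ltn_trans (orb_dep ob) du.
have qq' : q <> q' by move=> e; rewrite e ltnn in dq.
have vo := orb_valid vp ob.
have [q'E d'E _ _] := on_diff v vo xq ox qq'.
case: (orb_inv ob) => [[e1 e2 _]|[q1 [d1 [t1 [ob1 n1 e1 e2 _]]]]].
  have [_ _ /(_ qr)] := v; apply; move: e2; rewrite d'E => /(congr1 opp).
  by rewrite !oppK.
have e3 : q1 = q by rewrite -(mvK q d) -q'E -d'E e1 e2 mvK.
by move: (leq_ltn_trans (orb_dep ob1) du); rewrite e3 ltnn.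
Qed.

Definition port q d := isdir d /\ cen (mv q d) <> cen q.

Lemma port_valid q d : port q d -> valid q d (1 / 2).
Proof.
move=> [hd cq]; split=> //; first by apply/andP; split; lra.
by move=> /pdP[_ cE _] dE; apply: cq; rewrite dE.
Qed.

Lemma port_flip q d : port q d -> port (mv q d) (opp d).
Proof. by move=> [hd cq]; split; [exact: isdir_opp|rewrite mvK => /esym]. Qed.

Lemma port_not_next q d q1 : port q d -> q1 <> cen q1 -> q = mv q1 (pd q1) -> d <> opp (pd q1).
Proof. by move=> [_ cq] /pdP[_ cE _] qE dE; apply: cq; rewrite dE qE mvK cE. Qed.

(** Strands never merge: from a common position, injectivity of [px] recovers the previous one.
    Going back, both stop together, since the side of a port leads to another cluster and is never
    crossed by a step of the tree. *)
Lemma orb_inj q d q' d' q1 d1 t1 : port q d -> port q' d' ->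
  orb q d (1 / 2) q1 d1 t1 -> orb q' d' (1 / 2) q1 d1 t1 -> q = q' /\ d = d'.
Proof.
move=> p p'; have v := port_valid p; have v' := port_valid p'.
elim=> [/orb_inv[[-> -> _]//|[q2 [d2 [t2 [_ n e1 e2 _]]]]]|].
  by case: (port_not_next p n e1 e2).
move=> q2 d2 t2 ob IH n /orb_inv[[e1 e2 _]|[q3 [d3 [t3 [ob3 n3 e1 e2 e3]]]]].
  by case: (port_not_next p' n (esym e1) (esym e2)).
have pE : pd q2 = pd q3 by rewrite -(oppK (pd q2)) e2 oppK.
have qE : q2 = q3 by rewrite -(mvK q2 (pd q2)) e1 e2 mvK.
subst q3; have [] := px_inj n (orb_valid v ob) (orb_valid v' ob3) _; first lra.
by move=> dE tE; apply: IH; rewrite dE tE.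
Qed.

Lemma strands_meet q d q' d' w : port q d -> port q' d' ->
  strand q d (1 / 2) w -> strand q' d' (1 / 2) w ->
  [\/ q = q' /\ d = d', cen q = cen q' /\ w = ctr (cen q) |
    [/\ q' = mv q d, d' = opp d & w = pt q d (1 / 2)]].
Proof.
move=> p p' [q1 [d1 [t1 [ob ow]]]] [q2 [d2 [t2 [ob' ow']]]].
have v := orb_valid (port_valid p) ob; have v' := orb_valid (port_valid p') ob'.
have [e|ne] := pselect (q1 = q2).
  subst q2; case: (on_same v v' ow ow') => [[e1 e2]|[e1 e2]].
    by apply: Or31; rewrite -e1 -e2 in ob'; apply: (orb_inj p p' ob ob').
  apply: Or32; rewrite -(orb_cen ob) -(orb_cen ob'); split=> //.
  by rewrite -e1.
have [e1 e2 wE _] := on_diff v v' ow ow' ne.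
have flip q3 d3 q4 d4 : q4 = mv q3 d3 -> d4 = opp d3 -> q3 = mv q4 d4 /\ d3 = opp d4.
  by move=> -> ->; rewrite mvK oppK.
case: (orb_inv ob) => [[a1 a2 a3]|[q3 [d3 [t3 [_ n3 a1 a2 _]]]]].
  case: (orb_inv ob') => [[b1 b2 _]|[q4 [d4 [t4 [_ n4 b1 b2 _]]]]].
    by apply: Or33; subst.
  exfalso; have q4E : q4 = q by rewrite -a1 (flip _ _ _ _ e1 e2).1 b1 b2 mvK.
  have [_ cE _] := pdP n4; have [_] := p; apply; rewrite -{1}a1 -a2 -e1 b1 cE q4E //.
exfalso; have q3E : q2 = q3 by rewrite e1 a1 a2 mvK.
have [_ _] := v'; rewrite q3E => /(_ n3); apply.
by rewrite e2 a2 oppK.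
Qed.

Lemma ctr_inj : injective ctr.
Proof.
move=> [a b] [a' b'] /rowP h; have := h 0; have := h 1; rewrite !mxE /=.
by move=> /intr_inj -> /intr_inj ->.
Qed.

Lemma strand_ctr q d r : port q d -> r = cen r -> strand q d (1 / 2) (ctr r) -> r = cen q.
Proof.
move=> p rr [q1 [d1 [t1 [ob ow]]]]; have v := orb_valid (port_valid p) ob.
suff e : r = q1 by rewrite rr e (orb_cen ob).
have d1' : isdir (1, 0) by apply: Or41. 
have d2' : isdir (0, 1) by apply: Or42.
have d3' : isdir (-1, 0) by apply: Or43.
have d4' : isdir (0, -1) by apply: Or44.
have [h1 _] := on_cell v ow d1'; have [h2 _] := on_cell v ow d2'.
have [h3 _] := on_cell v ow d3'; have [h4 _] := on_cell v ow d4'.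
move: h1 h2 h3 h4; rewrite /dot /ctr !mk0 !mk1 /= ?mulrNz ?mulr0z ?mulr1z.
have bnd (z z' : int) : (z%:~R - z'%:~R <= 1 / 2 :> R) -> (z'%:~R - z%:~R <= 1 / 2 :> R) -> z = z'.
  move=> a1 a2; have b1 : (z - z' < 1)%R by rewrite -(ltr_int R) intrB; lra.
  have b2 : (z' - z < 1)%R by rewrite -(ltr_int R) intrB; lra.
  lia.
move=> h1 h2 h3 h4; rewrite (surjective_pairing r) (surjective_pairing q1).
by congr pair; apply: bnd; lra.
Qed.

Definition edge_set q d := strand q d (1 / 2) `|` strand (mv q d) (opp d) (1 / 2).

Lemma edge_arc q d : port q d -> is_arc (ctr (cen q)) (ctr (cen (mv q d))) (edge_set q d).
Proof.
move=> p; have p' := port_flip p.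
have a1 := strand_arc (port_valid p); have a2 := strand_arc (port_valid p').
have half : (1 / 2 : R) = 1 - 1 / 2 by lra.
have [hd cq] := p; have e := pt_flip q (1 / 2) hd; rewrite -half in e.
rewrite e in a2; apply: arc_cat a1 (arc_rev a2) _ => x s1 s2.
case: (strands_meet p p' s1 s2) => [[qE _]|[cE _]|[_ _ ->//]].
  by case: cq; rewrite -qE.
by case: cq.
Qed.

Lemma edge_meet q d q' d' w : port q d -> port q' d' ->
  strand q d (1 / 2) w -> strand q' d' (1 / 2) w -> w <> ctr (cen q) ->
  (cen q = cen q' /\ cen (mv q d) = cen (mv q' d')) \/
  (cen q = cen (mv q' d') /\ cen (mv q d) = cen q').
Proof.
move=> p p' s s' wc; case: (strands_meet p p' s s') => [[-> ->]|[_ /wc//]|[-> -> _]].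
  by left.
by right; rewrite mvK.
Qed.

End Strands.

(** * Spanning trees of the clusters and drawing of the cluster graph *)

Section Drawing.
Local Open Scope ring_scope.
Local Notation Z2 := (int * int)%type.
Variable cen : Z2 -> Z2.
Hypothesis cen_idem : forall z, cen (cen z) = cen z.
Hypothesis cen_conn : forall x, conn gadj [set y | cen y = cen x] (cen x) x.

Fixpoint near_root n z :=
  if n is n'.+1 then exists2 d, isdir d & cen (mv z d) = cen z /\ near_root n' (mv z d)
  else z = cen z.

Lemma near_root_ex z : exists n, near_root n z.
Proof.
have H r y : conn gadj [set y | cen y = r] r y -> exists n, near_root n y.
  elim=> [/= rr|y1 z1 cy [n hn] yz /= zr]; first by exists 0%N.
  have [d hd dE] := gadj_dir (gadj_sym yz); exists n.+1, d => //; rewrite -dE.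
  by split=> //; rewrite zr; exact: conn_r cy.
exact: H (cen_conn z).
Qed.

Lemma parent_exists : exists (pd : Z2 -> Z2) (dep : Z2 -> nat), forall z, z <> cen z ->
  [/\ isdir (pd z), cen (mv z (pd z)) = cen z & (dep (mv z (pd z)) < dep z)%N].
Proof.
have /choice[dep depP] : forall z, exists n, near_root n z /\ forall m, near_root m z -> (n <= m)%N.
  move=> z; have ex : exists n, `[< near_root n z >].
    by have [n hn] := near_root_ex z; exists n; apply/asboolP.
  case: (ex_minnP ex) => n /asboolP hn hm; exists n; split=> // m hm'.
  by apply: hm; apply/asboolP.
have /choice[pd pdP] : forall z, exists d, z <> cen z ->
    [/\ isdir d, cen (mv z d) = cen z & (dep (mv z d) < dep z)%N].
  move=> z; have [] := depP z; case: (dep z) => [zr _|n [d hd [cE hn]] _].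
    by exists z => /(_ zr).
  by exists d => _; split=> //; rewrite ltnS; have [_] := depP (mv z d); apply.
by exists pd, dep.
Qed.

Definition cluster_adj (u v : {z : Z2 | cen z == z}) : Prop :=
  val u <> val v /\ exists x y, [/\ cen x = val u, cen y = val v & gadj x y].

Lemma cluster_adj_sym u v : cluster_adj u v -> cluster_adj v u.
Proof.
move=> [uv [x [y [h1 h2 h3]]]]; split; first by move/esym.
by exists y, x; split=> //; apply: gadj_sym.
Qed.

Lemma cluster_adj_irrefl u : ~ cluster_adj u u.
Proof. by case. Qed.

Definition cluster_graph := Graph cluster_adj_sym cluster_adj_irrefl.

Lemma planar_cluster_graph (R : realType) : planar_graph R cluster_graph.
Proof.
have [pd [dep pdP]] := parent_exists.
pose V := {z : Z2 | cen z == z}.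
have /choice[P PP] : forall uv : V * V, exists qd : Z2 * Z2, cluster_adj uv.1 uv.2 ->
    [/\ port cen qd.1 qd.2, cen qd.1 = val uv.1 & cen (mv qd.1 qd.2) = val uv.2].
  move=> [u v]; have [[uv [x [y [h1 h2 /gadj_dir[d hd yE]]]]]|na] := pselect (cluster_adj u v).
    exists (x, d) => _ /=; rewrite -yE; split=> //; split=> //.
    by rewrite -yE h1 h2 => /esym.
  by exists ((0, 0), (0, 0)) => /na.
pose es (uv : V * V) := @edge_set R cen pd (P uv).1 (P uv).2.
have /choice[F FP] : forall uv : V * V, exists f : R -> 'rV[R]_2, cluster_adj uv.1 uv.2 ->
    [/\ continuous f, f 0 = ctr R (val uv.1), f 1 = ctr R (val uv.2),
        forall s t, 0 <= s <= 1 -> 0 <= t <= 1 -> f s = f t -> s = t &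
        forall t, 0 <= t <= 1 -> es uv (f t)].
  move=> uv; have [a|na] := pselect (cluster_adj uv.1 uv.2); last by exists (fun=> 0) => /na.
  have [p c1 c2] := PP uv a.
  have [f [f1 f2 f3 f4 f5]] := edge_arc R pdP p.
  exists f => _; rewrite c1 in f2; rewrite c2 in f3; split=> //.
  - by apply: f2.
  - by apply: f3.
  - by move=> t tI; rewrite /es f5; exists t.
have core3 uv w s : cluster_adj uv.1 uv.2 -> 0 < s < 1 -> F uv s <> ctr R (val (w : V)).
  move=> a /andP[s0 s1] Fw; have [_ F0 F1 Fi Fs] := FP uv a; have [p c1 c2] := PP uv a.
  have sI : 0 <= s <= 1 by rewrite !ltW.
  have wr : val w = cen (val w) by apply/esym/eqP; exact: (valP w).
  have := Fs s sI; rewrite Fw => -[h|h].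
    have wE := strand_ctr pdP p wr h; rewrite c1 in wE.
    have : s = 0 by apply: Fi; rewrite ?lexx ?ler01 // Fw F0 wE.
    by move=> e; rewrite e ltxx in s0.
  have wE := strand_ctr pdP (port_flip p) wr h; rewrite c2 in wE.
  have : s = 1 by apply: Fi; rewrite ?lexx ?ler01 // Fw F1 wE.
  by move=> e; rewrite e ltxx in s1.
have core4 uv uv' s t : cluster_adj uv.1 uv.2 -> cluster_adj uv'.1 uv'.2 -> 0 < s < 1 -> 0 < t < 1 ->
    F uv s = F uv' t -> (uv.1 = uv'.1 /\ uv.2 = uv'.2) \/ (uv.1 = uv'.2 /\ uv.2 = uv'.1).
  move=> a a' sI tI FF; have [_ _ _ _ Fs] := FP uv a; have [p c1 c2] := PP uv a.
  have [_ _ _ _ Fs'] := FP uv' a'; have [p' c1' c2'] := PP uv' a'.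
  have sI' : 0 <= s <= 1 by case/andP: sI => *; rewrite !ltW.
  have tI' : 0 <= t <= 1 by case/andP: tI => *; rewrite !ltW.
  have n1 : F uv s <> ctr R (cen (P uv).1) by rewrite c1; exact: core3.
  have n2 : F uv s <> ctr R (cen (mv (P uv).1 (P uv).2)) by rewrite c2; exact: core3.
  have := Fs' t tI'; rewrite -FF => S'; have S := Fs s sI'.
  suff : (val uv.1 = val uv'.1 /\ val uv.2 = val uv'.2) \/
         (val uv.1 = val uv'.2 /\ val uv.2 = val uv'.1).
    by case=> -[/val_inj e1 /val_inj e2]; [left|right].
  rewrite -c1 -c2 -c1' -c2'; case: S => h; case: S' => h'.
  - exact: (edge_meet pdP p p' h h' n1).
  - have := edge_meet pdP p (port_flip p') h h' n1; rewrite mvK.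
    by case=> -[e1 e2]; [right|left].
  - have := edge_meet pdP (port_flip p) p' h h' n2; rewrite mvK.
    by case=> -[e1 e2]; [right|left].
  - have := edge_meet pdP (port_flip p) (port_flip p') h h' n2; rewrite !mvK.
    by case=> -[e1 e2]; [left|right].
(* The ports chosen for [(u, v)] and [(v, u)] may differ. Ranks select one of the two, and the other
   direction is drawn as its reverse. *)
have [ltv ltvN] : exists ltv : V -> V -> bool, forall u v, cluster_adj u v -> ltv v u = ~~ ltv u v.
  exists (fun u v => (pickle (val u) < pickle (val v))%N) => u v [uv _].
  by case: ltngtP => // /(pcan_inj pickleK) e; case: uv.
pose arc (u v : V) := if ltv u v then F (u, v) else fun t => F (v, u) (1 - t).
have arc1 u v : ltv u v -> arc u v = F (u, v) by rewrite /arc => ->.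
have arc2 u v : ~~ ltv u v -> arc u v = fun t => F (v, u) (1 - t) by rewrite /arc => /negbTE->.
have arcP u v t : cluster_adj u v -> 0 < t < 1 -> exists uv s, [/\ cluster_adj uv.1 uv.2,
    uv = (u, v) \/ uv = (v, u), 0 < s < 1 & arc u v t = F uv s].
  move=> a /andP[t0 t1]; rewrite /arc; case: ifP => _.
    by exists (u, v), t; split=> //; [left|rewrite t0].
  exists (v, u), (1 - t); split=> //; [exact: cluster_adj_sym|by right|].
  by apply/andP; split; lra.
exists (fun u : V => ctr R (val u)), arc; split.
- by move=> u v /ctr_inj /val_inj.
- move=> u v a; have rev := cluster_adj_sym a.
  have [C F0 F1 Fi _] := FP (u, v) a; have [C' F0' F1' Fi' _] := FP (v, u) rev.
  have E1 := ltvN u v a; have [h|h] := boolP (ltv u v).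
    rewrite (arc1 _ _ h) (arc2 v u) ?E1 ?h //; split.
    + by apply: continuous_subspaceT.
    + by move=> s t; rewrite !in_itv /= => sI tI; apply: Fi.
    + exact: F0.
    + exact: F1.
    + by [].
  rewrite (arc2 _ _ h) (arc1 v u) ?E1 //; split.
  + apply: continuous_subspaceT => t; apply: continuous_comp; last exact: C'.
    by apply: cvgB; [exact: cvg_cst|exact: cvg_id].
  + move=> s t; rewrite !in_itv /= => /andP[s0 s1] /andP[t0 t1] e.
    have : 1 - s = 1 - t by apply: Fi' => //; apply/andP; split; lra.
    by lra.
  + by rewrite subr0 F1'.
  + by rewrite subrr F0'.
  + by move=> t _; congr (F _ _); lra.
- move=> u v w t a tI; have [uv [s [a1 _ sI ->]]] := arcP u v t a tI.
  exact: core3.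
move=> u v u' v' s t a a' sI tI.
have [uv [s1 [a1 e1 sI1 ->]]] := arcP u v s a sI.
have [uv' [t1 [a1' e1' tI1 ->]]] := arcP u' v' t a' tI.
move=> FF; have := core4 _ _ _ _ a1 a1' sI1 tI1 FF.
by case: e1 => ->; case: e1' => -> /= [] [-> ->]; (try by left); by right.
Qed.
End Drawing.

(** * Piecewise C^1 curves *)

Section RealFunctions.
Local Open Scope ring_scope.
Variable R : realType.
Implicit Types (a b t x e k m : R).

Definition cont_on (T : topologicalType) (f : R -> T) a b :=
  forall t, a <= t <= b -> forall U, nbhs (f t) U ->
  exists2 e, 0 < e & forall x, a <= x <= b -> `|x - t| < e -> U (f x).

Lemma cont_onP (T : topologicalType) (f : R -> T) a b :
  {within `[a, b], continuous f} <-> cont_on f a b.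
Proof.
rewrite subspace_continuousP; split=> h t tab.
  move=> U fU; have tI : `[a, b]%classic t by rewrite /= in_itv.
  have := h t tI U fU; rewrite /= => /nbhs_ballP[e e0 sub].
  exists e => // x xab xt; apply: (sub x); last by rewrite /= in_itv.
  by rewrite /ball /= distrC.
move=> U fU; rewrite /= in_itv /= in tab.
have [e e0 he] := h t tab U fU; apply/nbhs_ballP; exists e => // x xt.
rewrite /= in_itv /= => xab; apply: he => //; by rewrite distrC.
Qed.

Lemma cont_on_sub (T : topologicalType) (f : R -> T) a b a' b' :
  a <= a' -> b' <= b -> cont_on f a b -> cont_on f a' b'.
Proof.
move=> aa bb h t /andP[t1 t2] U fU.
have [|e e0 he] := h t _ U fU; first by apply/andP; split; lra.
by exists e => // x /andP[x1 x2]; apply: he; apply/andP; split; lra.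
Qed.

(** The mean value theorem between consecutive exceptional points. Length estimates below are
    obtained by comparing primitives through this lemma. *)
Lemma monotone_off_finite (f df : R -> R) (s : seq R) a b : a <= b -> cont_on f a b ->
  (forall t, a < t < b -> t \notin s -> is_derive t (1 : R) f (df t)) ->
  (forall t, a < t < b -> t \notin s -> 0 <= df t) -> f a <= f b.
Proof.
elim: s a b => [|y s IHs] a b ab fc fd f0.
  move: ab; rewrite le_eqVlt => /orP[/eqP->//|ab].
  have [||c] := @MVT R f df a b ab; last 1 first.
  - rewrite in_itv /= => cI e; rewrite -subr_ge0 e mulr_ge0 ?f0 // subr_ge0 ltW //.
  - by move=> x; rewrite in_itv /= => xI; apply: fd.
  - exact/cont_onP.
have [yab|yab] := boolP (a < y < b); last first.
  apply: IHs => // t tab ts; [apply: fd|apply: f0] => //; rewrite in_cons negb_or ts andbT;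
  by apply: contraNN yab => /eqP<-.
have /andP[ay yb] := yab; apply: (@le_trans _ _ (f y)).
  apply: IHs (ltW ay) _ _ _; first exact: cont_on_sub (lexx _) (ltW yb) fc.
    move=> t /andP[t1 t2] ts; apply: fd; first by apply/andP; split; lra.
    by rewrite in_cons negb_or ts andbT lt_eqF.
  move=> t /andP[t1 t2] ts; apply: f0; first by apply/andP; split; lra.
  by rewrite in_cons negb_or ts andbT lt_eqF.
apply: IHs (ltW yb) _ _ _; first exact: cont_on_sub (ltW ay) (lexx _) fc.
  move=> t /andP[t1 t2] ts; apply: fd; first by apply/andP; split; lra.
  by rewrite in_cons negb_or ts andbT gt_eqF.
move=> t /andP[t1 t2] ts; apply: f0; first by apply/andP; split; lra.
by rewrite in_cons negb_or ts andbT gt_eqF.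
Qed.

Lemma cont_onD (f h : R -> R) a b : cont_on f a b -> cont_on h a b ->
  cont_on (fun t => f t + h t) a b.
Proof.
move=> /cont_onP fc /cont_onP hc; apply/cont_onP => t.
by apply: cvgD; [exact: fc|exact: hc].
Qed.

Lemma cont_onZ (f : R -> R) k a b : cont_on f a b -> cont_on (fun t => k * f t) a b.
Proof. by move=> /cont_onP fc; apply/cont_onP => t; apply: cvgM; [exact: cvg_cst|exact: fc]. Qed.

Lemma seq_avoid (s : seq R) t : exists2 e, 0 < e & forall x, `|x - t| < e -> x != t -> x \notin s.
Proof.
elim: s => [|y s [e e0 he]]; first by exists 1.
have [->|yt] := eqVneq y t.
  by exists e => // x xe xt; rewrite in_cons negb_or xt he.
exists (Num.min e `|y - t|); first by rewrite lt_min e0 normr_gt0 subr_eq0.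
move=> x; rewrite lt_min => /andP[xe xy] xt; rewrite in_cons negb_or he // andbT.
by apply/eqP => xE; rewrite xE ltxx in xy.
Qed.

Lemma near_eq_derivable1 (V : normedModType R) (f h : R -> V) x e : 0 < e ->
  (forall y, `|y - x| < e -> f y = h y) ->
  derive1 f x = derive1 h x /\ (derivable f x 1 -> derivable h x 1).
Proof.
move=> e0 fh; have nr : \near x, f x = h x.
  by apply/nbhs_ballP; exists e => // y xy; apply: fh; rewrite distrC.
split; first by rewrite !derive1E; apply: near_eq_derive.
by apply: near_eq_derivable.
Qed.

Lemma derive1_affine (V : normedModType R) (f : R -> V) k m x : derivable f (k * x + m) 1 ->
  is_derive x (1 : R) (fun t => f (k * t + m)) (k *: derive1 f (k * x + m)).
Proof.
move=> /derivable1_diffP df.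
have dh : is_derive x (1 : R) (fun t => k * t + m) k.
  have -> : (fun t => k * t + m) = (k \*: id) \+ cst m by [].
  by apply: is_derive_eq; rewrite addr0 /GRing.scale /= mulr1.
have hd : differentiable (fun t => k * t + m) x by apply/derivable1_diffP.
have dc : differentiable (f \o (fun t => k * t + m)) x by apply: differentiable_comp.
apply: DeriveDef; first exact/derivable1_diffP.
rewrite (deriveE _ dc) (diff_comp hd df) /= -(deriveE _ hd) derive_val derive1E (deriveE _ df).
by rewrite -linearZ /= /GRing.scale /= mulr1.
Qed.

Definition side z t x := z = 0 \/ 0 < z * (x - t).

(* One-sided ([z = 1] or [z = -1]) or two-sided ([z = 0]) limit of the derivative. *)
Definition dlim (V : normedModType R) z (u : R -> V) t l :=
  forall e, 0 < e -> exists2 dl, 0 < dl &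
    forall x, `|x - t| < dl -> side z t x -> `|l - derive1 u x| < e.

Lemma dlim_eq (V : normedModType R) z (u u' : R -> V) t l e : 0 < e ->
  (forall x, `|x - t| < e -> side z t x -> derive1 u x = derive1 u' x) ->
  dlim z u t l -> dlim z u' t l.
Proof.
move=> e0 uu' h r r0; have [dl dl0 hd] := h r r0.
exists (Num.min e dl); first by rewrite lt_min e0.
by move=> x; rewrite lt_min => /andP[x1 x2] sx; rewrite -uu' //; apply: hd.
Qed.

Lemma dlim_affine (V : normedModType R) z (u u' : R -> V) k m t l e : 0 < e -> k != 0 ->
  (forall x, `|x - t| < e -> side z t x -> derive1 u' x = k *: derive1 u (k * x + m)) ->
  dlim (Num.sg k * z) u (k * t + m) l -> dlim z u' t (k *: l).
Proof.
move=> e0 k0 uu' h r r0; have nk : 0 < `|k| by rewrite normr_gt0.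
have [|dl dl0 hd] := h (r / `|k|); first exact: divr_gt0.
exists (Num.min e (dl / `|k|)); first by rewrite lt_min e0 divr_gt0.
move=> x; rewrite lt_min => /andP[x1 x2] sx; rewrite uu' // -scalerBr normrZ mulrC.
rewrite -ltr_pdivlMr //; apply: hd.
  have -> : k * x + m - (k * t + m) = k * (x - t) by ring.
  by rewrite normrM mulrC -ltr_pdivlMr.
case: sx => [->|sx]; [by left; rewrite mulr0|right].
have -> : Num.sg k * z * (k * x + m - (k * t + m)) = (Num.sg k * k) * (z * (x - t)) by ring.
by rewrite -normrEsg mulr_gt0.
Qed.

End RealFunctions.

(** * Primitives of the speed: restriction, reparametrization, gluing *)

Section Curves.
Local Open Scope ring_scope.
Variables (R : realType) (M : topologicalType) (A : smooth_atlas R M) (g : riemannian_metric A).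
Implicit Types (a b t x e k m z : R) (c : R -> M) (L : R -> R) (s : seq R).

(** Where a velocity limit on the side [z] is required: the exceptional points and the ends of the
    interval are only asked for one-sided limits. *)
Definition sidable z a b s t :=
  [\/ [/\ z = 0, a < t < b & t \notin s], z = 1 /\ a <= t < b | z = -1 /\ a < t <= b].

(* [L] is a primitive of the speed of the piecewise C^1 curve [c] on [a, b]. *)
Definition tame c L a b := [/\ cont_on c a b, cont_on L a b & exists s,
  [/\ forall t (i : chart A), a < t < b -> t \notin s -> dom i (c t) -> derivable (coord i \o c) t 1,
      forall t, a < t < b -> t \notin s -> is_derive t (1 : R) L (speed g c t) &
      forall z t (i : chart A), sidable z a b s t -> dom i (c t) -> exists l, dlim z (coord i \o c) t l]].

Lemma bilinZ (G : 'M[R]_2) k v : bilin G (k *: v) (k *: v) = k ^+ 2 * bilin G v v.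
Proof. by rewrite /bilin linearZ /= -!scalemxAl -scalemxAr !mxE expr2 mulrA. Qed.

Lemma chart_atP p : dom (chart_at A p) p.
Proof. by rewrite /chart_at; case: cid. Qed.

Lemma speed_ge0 c t : 0 <= speed g c t.
Proof. exact: sqrtr_ge0. Qed.

Lemma dom_near c a b t (i : chart A) : cont_on c a b -> a <= t <= b -> dom i (c t) ->
  exists2 e, 0 < e & forall x, a <= x <= b -> `|x - t| < e -> dom i (c x).
Proof.
move=> cc tab ct; apply: cc => //; apply: open_nbhs_nbhs; split=> //.
exact: dom_open.
Qed.

Lemma sidable_itv z a b s t : sidable z a b s t -> a <= t <= b.
Proof.
by move=> [[_ /andP[h1 h2] _]|[_ /andP[h1 h2]]|[_ /andP[h1 h2]]]; apply/andP; split; lra.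
Qed.

Lemma sidable_near c a b s z t (i : chart A) : cont_on c a b -> sidable z a b s t -> dom i (c t) ->
  exists2 e, 0 < e & forall x, `|x - t| < e -> side z t x ->
    [/\ a < x < b, x \notin s & dom i (c x)].
Proof.
move=> cc sd ct; have [e1 e10 h1] := dom_near cc (sidable_itv sd) ct.
have [e2 e20 h2] := seq_avoid s t.
have ab : exists2 e3, 0 < e3 & forall x, `|x - t| < e3 -> side z t x ->
    a < x < b /\ (x = t -> t \notin s).
  case: sd => [[_ /andP[q1 q2] ts]|[-> /andP[q1 q2]]|[-> /andP[q1 q2]]].
  - exists (Num.min (t - a) (b - t)); first by rewrite lt_min !subr_gt0 q1.
    move=> x; rewrite lt_min !ltr_norml => /andP[/andP[x1 x2] /andP[x3 x4]] _.
    by split=> //; apply/andP; split; lra.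
  - exists (b - t); first by rewrite subr_gt0.
    move=> x; rewrite ltr_norml => /andP[x1 x2] [|sx]; first by move/eqP; rewrite oner_eq0.
    by split; [apply/andP; split; lra|move=> xE; exfalso; rewrite xE subrr mulr0 ltxx in sx].
  - exists (t - a); first by rewrite subr_gt0.
    move=> x; rewrite ltr_norml => /andP[x1 x2] [|sx].
      by move/eqP; rewrite oppr_eq0 oner_eq0.
    by split; [apply/andP; split; lra|move=> xE; exfalso; rewrite xE subrr mulr0 ltxx in sx].
have [e3 e30 h3] := ab; exists (Num.min e1 (Num.min e2 e3)).
  by rewrite !lt_min e10 e20.
move=> x; rewrite !lt_min => /and3P[x1 x2 x3] sx; have [xab xt] := h3 x x3 sx.
split=> //; first by have [xE|/h2->//] := eqVneq x t; rewrite xE; apply: xt.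
by apply: h1 => //; case/andP: xab => *; apply/andP; split; apply: ltW.
Qed.

Lemma tame_sub c L a b a' b' : a <= a' -> b' <= b -> tame c L a b -> tame c L a' b'.
Proof.
move=> aa bb [cc Lc [s [h1 h2 h3]]]; split; [exact: cont_on_sub cc|exact: cont_on_sub Lc|].
exists s; split=> [t i /andP[t1 t2]|t /andP[t1 t2]|z t i sd].
- by apply: h1; apply/andP; split; lra.
- by apply: h2; apply/andP; split; lra.
- apply: h3; case: sd => [[-> /andP[q1 q2] ts]|[-> /andP[q1 q2]]|[-> /andP[q1 q2]]].
  + by apply: Or31; split=> //; apply/andP; split; lra.
  + by apply: Or32; split=> //; apply/andP; split; lra.
  + by apply: Or33; split=> //; apply/andP; split; lra.
Qed.

Lemma tame_le c L a b : a <= b -> tame c L a b -> L a <= L b.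
Proof.
move=> ab [cc Lc [s [h1 h2 h3]]]; apply: (monotone_off_finite ab Lc h2).
by move=> *; apply: speed_ge0.
Qed.

Lemma tame_unique c L L' a b : a <= b -> tame c L a b -> tame c L' a b ->
  L b - L a = L' b - L' a.
Proof.
suff H c1 L1 L2 : a <= b -> tame c1 L1 a b -> tame c1 L2 a b -> L1 b - L1 a <= L2 b - L2 a.
  by move=> ab h h'; apply/eqP; rewrite eq_le (H c L L' ab h h') (H c L' L ab h' h).
move=> ab [_ k1 [s1 [_ d1 _]]] [_ k2 [s2 [_ d2 _]]].
have : L2 a + (-1) * L1 a <= L2 b + (-1) * L1 b; last lra.
have := @monotone_off_finite R (fun t => L2 t + (-1) * L1 t) (fun=> 0) (s1 ++ s2) a b ab.
apply=> //; first by apply: cont_onD => //; apply: cont_onZ.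
move=> t tab; rewrite mem_cat negb_or => /andP[t1 t2].
have D1 := d1 t tab t1; have D2 := d2 t tab t2.
have -> : (fun t => L2 t + -1 * L1 t) = (L2 \+ (-1) \*: L1) by [].
by apply: is_derive_eq; rewrite /GRing.scale /= mulN1r subrr.
Qed.

Lemma speed_affine c k m x :
  derivable (coord (chart_at A (c (k * x + m))) \o c) (k * x + m) 1 ->
  speed g (fun t => c (k * t + m)) x = `|k| * speed g c (k * x + m).
Proof.
move=> du; rewrite /speed; set j := chart_at A _; set u := coord j \o c.
have -> : coord j \o (fun t => c (k * t + m)) = fun t => u (k * t + m) by [].
have D : is_derive x (1 : R) (fun t => u (k * t + m)) (k *: derive1 u (k * x + m)).
  exact: derive1_affine.
rewrite derive1E derive_val bilinZ.
by rewrite sqrtrM ?sqr_ge0 // sqrtr_sqr.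
Qed.

(** For negative [k] the curve is run backwards, and the sign in front of [L] makes the primitive
    nondecreasing again. *)
Lemma tame_affine c L a b a' b' k m : k != 0 ->
  (0 < k /\ k * a' + m = a /\ k * b' + m = b) \/ (k < 0 /\ k * a' + m = b /\ k * b' + m = a) ->
  tame c L a b -> tame (fun t => c (k * t + m)) (fun t => Num.sg k * L (k * t + m)) a' b'.
Proof.
move=> k0 hk [cc Lc [s [h1 h2 h3]]]; have nk : 0 < `|k| by rewrite normr_gt0.
have rng x : a' <= x <= b' -> a <= k * x + m <= b.
  by move=> /andP[x1 x2]; case: hk => -[k1 [<- <-]]; apply/andP; split; nra.
have rng' x : a' < x < b' -> a < k * x + m < b.
  by move=> /andP[x1 x2]; case: hk => -[k1 [<- <-]]; apply/andP; split; nra.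
have ca (T : topologicalType) (f : R -> T) : cont_on f a b -> cont_on (fun t => f (k * t + m)) a' b'.
  move=> fc t tab U fU; have [e e0 he] := fc _ (rng t tab) U fU.
  exists (e / `|k|); first exact: divr_gt0.
  move=> x xab xt; apply: he; first exact: rng.
  have -> : k * x + m - (k * t + m) = k * (x - t) by ring.
  by rewrite normrM mulrC -ltr_pdivlMr.
split; [exact: ca|by apply: cont_onZ; exact: ca|].
pose s' := [seq (y - m) / k | y <- s].
have ss t : t \notin s' -> k * t + m \notin s.
  apply: contraNN => ts; have -> : t = (k * t + m - m) / k by field.
  exact: map_f.
have der x (i : chart A) : a' < x < b' -> x \notin s' -> dom i (c (k * x + m)) ->
    is_derive x (1 : R) (coord i \o (fun t => c (k * t + m)))
      (k *: derive1 (coord i \o c) (k * x + m)).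
  move=> xab xs dx; have := h1 _ _ (rng' x xab) (ss x xs) dx.
  exact: derive1_affine.
exists s'; split.
- by move=> t i tab ts dt; have D := der t i tab ts dt; apply: ex_derive.
- move=> t tab ts; have D := h2 _ (rng' t tab) (ss t ts).
  rewrite speed_affine; last by apply: h1; [exact: rng'|exact: ss|exact: chart_atP].
  have D1 : is_derive t (1 : R) (fun t => L (k * t + m)) (k *: derive1 L (k * t + m)).
    by apply: derive1_affine.
  have -> : (fun t => Num.sg k * L (k * t + m)) = (Num.sg k \*: (fun t => L (k * t + m))) by [].
  apply: is_derive_eq; rewrite derive1E derive_val /GRing.scale /=.
  by rewrite mulrA -normrEsg.
- move=> z t i sd dt.
  have cc' := ca _ _ cc.
  have [e e0 he] := sidable_near cc' sd dt.
  have sd' : sidable (Num.sg k * z) a b s (k * t + m).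
    case: hk => -[k1 [ka kb]].
      rewrite gtr0_sg // mul1r; case: sd => [[-> q ts]|[-> /andP[q1 q2]]|[-> /andP[q1 q2]]].
      + by apply: Or31; split; [|exact: rng'|exact: ss].
      + by apply: Or32; split=> //; rewrite -ka -kb; apply/andP; split; nra.
      + by apply: Or33; split=> //; rewrite -ka -kb; apply/andP; split; nra.
    rewrite ltr0_sg //; case: sd => [[-> q ts]|[-> /andP[q1 q2]]|[-> /andP[q1 q2]]].
    + by apply: Or31; split; [rewrite mulr0|exact: rng'|exact: ss].
    + by apply: Or33; split; [rewrite mulr1|rewrite -ka -kb; apply/andP; split; nra].
    + by apply: Or32; split; [rewrite mulrNN mulr1|rewrite -ka -kb; apply/andP; split; nra].
  have [l hl] := h3 _ _ _ sd' dt; exists (k *: l).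
  apply: (dlim_affine e0 k0 _ hl) => x xt sx; have [x1 x2 x3] := he x xt sx.
  by have D := der x i x1 x2 x3; rewrite derive1E derive_val.
Qed.

Definition glue (T : Type) b (f f' : R -> T) t := if t <= b then f t else f' t.

Lemma glue_l (T : Type) b (f f' : R -> T) t : t <= b -> glue b f f' t = f t.
Proof. by rewrite /glue => ->. Qed.

Lemma glue_r (T : Type) b (f f' : R -> T) t : f b = f' b -> b <= t -> glue b f f' t = f' t.
Proof.
rewrite /glue => fb bt; case: (leP t b) => // tb.
by have -> : t = b by apply/eqP; rewrite eq_le tb.
Qed.

Lemma cont_on_glue (T : topologicalType) (f f' : R -> T) a b e : f b = f' b ->
  cont_on f a b -> cont_on f' b e -> cont_on (glue b f f') a e.
Proof.
move=> fb fc fc' t tae U fU.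
have H1 : exists2 r, 0 < r & forall x, a <= x <= b -> `|x - t| < r -> U (f x).
  have [tb|bt] := leP t b.
    apply: fc; first by case/andP: tae => ->.
    by rewrite glue_l in fU.
  exists (t - b); first by rewrite subr_gt0.
  by move=> x /andP[_ xb]; rewrite ltr_norml => /andP[h _]; exfalso; apply: (@falseR R); lra.
have H2 : exists2 r, 0 < r & forall x, b <= x <= e -> `|x - t| < r -> U (f' x).
  have [bt|tb] := leP b t.
    apply: fc'; first by case/andP: tae => _ ->; rewrite bt.
    by rewrite glue_r in fU.
  exists (b - t); first by rewrite subr_gt0.
  by move=> x /andP[xb _]; rewrite ltr_norml => /andP[_ h]; exfalso; apply: (@falseR R); lra.
have [r1 r10 h1] := H1; have [r2 r20 h2] := H2.
exists (Num.min r1 r2); first by rewrite lt_min r10.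
move=> x /andP[x1 x2]; rewrite lt_min => /andP[y1 y2]; have [xb|bx] := leP x b.
  by rewrite glue_l //; apply: h1 => //; rewrite x1.
by rewrite glue_r ?(ltW bx) //; apply: h2 => //; rewrite (ltW bx).
Qed.

Lemma glue_derive (V : normedModType R) (f f' h : R -> V) b x : f b = f' b ->
  (x < b /\ h = f) \/ (b < x /\ h = f') ->
  derive1 (glue b f f') x = derive1 h x /\ (derivable h x 1 -> derivable (glue b f f') x 1).
Proof.
move=> fb [] [xb ->].
  have [||h1 _] := @near_eq_derivable1 R V (glue b f f') f x (b - x).
  - by rewrite subr_gt0.
  - by move=> y; rewrite ltr_norml => /andP[_ y2]; rewrite glue_l //; lra.
  split=> //; apply: (@near_eq_derivable1 R V f (glue b f f') x (b - x) _ _).2.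
    by rewrite subr_gt0.
  by move=> y; rewrite ltr_norml => /andP[_ y2]; rewrite glue_l //; lra.
have [||h1 _] := @near_eq_derivable1 R V (glue b f f') f' x (x - b).
- by rewrite subr_gt0.
- by move=> y; rewrite ltr_norml => /andP[y2 _]; rewrite glue_r //; lra.
split=> //; apply: (@near_eq_derivable1 R V f' (glue b f f') x (x - b) _ _).2.
  by rewrite subr_gt0.
by move=> y; rewrite ltr_norml => /andP[y2 _]; rewrite glue_r //; lra.
Qed.

Lemma comp_glue (T U : Type) (h : T -> U) b (f f' : R -> T) :
  h \o glue b f f' = glue b (h \o f) (h \o f').
Proof. by apply/funext => t; rewrite /glue /=; case: ifP. Qed.

Lemma speed_glue c c' c1 b x : c b = c' b -> (x < b /\ c1 = c) \/ (b < x /\ c1 = c') ->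
  speed g (glue b c c') x = speed g c1 x.
Proof.
move=> cb h; have e : glue b c c' x = c1 x.
  by case: h => -[xb ->]; [rewrite glue_l ?ltW|rewrite glue_r ?ltW].
rewrite /speed /= e; set j := chart_at A _; rewrite comp_glue.
suff -> : derive1 (glue b (coord j \o c) (coord j \o c')) x = derive1 (coord j \o c1) x by [].
have ub : (coord j \o c) b = (coord j \o c') b by rewrite /= cb.
have h' : (x < b /\ coord j \o c1 = coord j \o c) \/ (b < x /\ coord j \o c1 = coord j \o c').
  by case: h => -[xb ->]; [left|right].
by have [-> _] := glue_derive ub h'.
Qed.

Lemma tame_glue c c' L L' a b e : a < b -> b < e -> c b = c' b -> L b = L' b ->
  tame c L a b -> tame c' L' b e -> tame (glue b c c') (glue b L L') a e.
Proof.
move=> ab be cb Lb [cc Lc [s [h1 h2 h3]]] [cc' Lc' [s' [h1' h2' h3']]].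
split; [exact: cont_on_glue|exact: cont_on_glue|].
have ub (i : chart A) : (coord i \o c) b = (coord i \o c') b by rewrite /= cb.
exists (b :: s ++ s'); split.
- move=> t i /andP[t1 t2]; rewrite in_cons mem_cat !negb_or => /and3P[tb ts ts'] dt.
  rewrite comp_glue; have [tb'|bt] := ltP t b.
    have [_ e2] := glue_derive (h := coord i \o c) (ub i) (or_introl (conj tb' erefl)); apply: e2.
    by rewrite glue_l ?ltW // in dt; apply: h1 => //; rewrite t1.
  have bt' : b < t by rewrite lt_neqAle eq_sym tb.
  have [_ e2] := glue_derive (h := coord i \o c') (ub i) (or_intror (conj bt' erefl)); apply: e2.
  by rewrite glue_r // in dt; apply: h1' => //; rewrite bt'.
- move=> t /andP[t1 t2]; rewrite in_cons mem_cat !negb_or => /and3P[tb ts ts'].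
  have [tb'|bt] := ltP t b.
    rewrite (speed_glue (c1 := c)) //; last by left.
    have D : is_derive t (1 : R) L (speed g c t) by apply: h2; rewrite // t1.
    have [e1 e2] := glue_derive (h := L) Lb (or_introl (conj tb' erefl)).
    apply: DeriveDef; first by apply: e2; apply: ex_derive.
    by rewrite -derive1E e1 derive1E derive_val.
  have bt' : b < t by rewrite lt_neqAle eq_sym tb.
  rewrite (speed_glue (c1 := c')) //; last by right.
  have D : is_derive t (1 : R) L' (speed g c' t) by apply: h2'; rewrite // bt'.
  have [e1 e2] := glue_derive (h := L') Lb (or_intror (conj bt' erefl)).
  apply: DeriveDef; first by apply: e2; apply: ex_derive.
  by rewrite -derive1E e1 derive1E derive_val.
move=> z t i sd dt; rewrite comp_glue.
have [[tb sl]|[bt sr]] : (t <= b /\ sidable z a b s t) \/ (b <= t /\ sidable z b e s' t).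
  case: sd => [[-> /andP[q1 q2]]|[-> /andP[q1 q2]]|[-> /andP[q1 q2]]].
  + rewrite in_cons mem_cat !negb_or => /and3P[tb ts ts'].
    have [tb'|bt] := ltP t b; first by left; split; [exact: ltW|apply: Or31; rewrite q1].
    right; split=> //; apply: Or31; split=> //.
    by rewrite q2 andbT lt_neqAle eq_sym tb.
  + have [tb'|bt] := ltP t b; first by left; split; [exact: ltW|apply: Or32; rewrite q1].
    by right; split=> //; apply: Or32; rewrite bt.
  + have [tb'|bt] := leP t b; first by left; split=> //; apply: Or33; rewrite q1.
    by right; split; [exact: ltW|apply: Or33; rewrite bt].
- rewrite glue_l // in dt; have [l hl] := h3 _ _ _ sl dt; exists l.
  have [r r0 hr] := sidable_near cc sl dt.
  apply: dlim_eq r0 _ hl => x xt sx; have [/andP[x1 x2] _ _] := hr x xt sx.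
  by have [-> _] := glue_derive (h := coord i \o c) (ub i) (or_introl (conj x2 erefl)).
- rewrite glue_r // in dt; have [l hl] := h3' _ _ _ sr dt; exists l.
  have [r r0 hr] := sidable_near cc' sr dt.
  apply: dlim_eq r0 _ hl => x xt sx; have [/andP[x1 x2] _ _] := hr x xt sx.
  by have [-> _] := glue_derive (h := coord i \o c') (ub i) (or_intror (conj x1 erefl)).
Qed.

End Curves.

(** * Length of curves *)

Lemma entry_cvg (R : realType) (T : Type) (F : set_system T) (m n : nat)
    (f : T -> 'M[R]_(m, n)) (f0 : 'M[R]_(m, n)) (j : 'I_m) (k : 'I_n) :
  f @ F --> f0 -> (fun x => f x j k) @ F --> f0 j k.
Proof.
move=> hf; exact: (@cvg_comp _ _ _ f (fun v : 'M[R]_(m, n) => v j k) F (nbhs f0) (nbhs (f0 j k))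
  hf (@matrix_normedtype.coord_continuous R m n j k f0)).
Qed.

Section Lengths.
Local Open Scope ring_scope.
Variables (R : realType) (M : topologicalType) (A : smooth_atlas R M) (g : riemannian_metric A).
Implicit Types (a b t x e k m z : R) (c : R -> M) (L : R -> R) (s : seq R).

(** Cousin's lemma in additive form: the supremum of the [y] with [P a y] is reached, and could be
    passed if it were less than [b]. It replaces subdivisions of a compact interval. *)
Lemma cousin (P : R -> R -> Prop) a b : a <= b ->
  (forall t, a <= t <= b -> exists2 e, 0 < e &
    forall x y, a <= x -> x <= t -> t <= y -> y <= b -> t - x < e -> y - t < e -> P x y) ->
  (forall x y w, a <= x -> x <= y -> y <= w -> w <= b -> P x y -> P y w -> P x w) -> P a b.
Proof.
move=> ab loc add; pose S := [set y | a <= y <= b /\ P a y].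
have Sa : S a.
  split; first by rewrite lexx ab.
  have [|e e0 he] := loc a; first by rewrite lexx ab.
  by apply: he; rewrite ?lexx ?subrr.
have Sub : has_ubound S by exists b => y [/andP[]].
have Ssup : has_sup S by split=> //; exists a.
have aT : a <= sup S by apply: ub_le_sup.
have Tb : sup S <= b by apply: ge_sup; [exists a|move=> y [/andP[]]].
have [|e e0 he] := loc (sup S); first by rewrite aT Tb.
have [y0 [/andP[ay0 y0b] Py0] y0T] := sup_adherent e0 Ssup.
have y0S : y0 <= sup S by apply: ub_le_sup => //; split=> //; rewrite ay0 y0b.
have PT : P a (sup S).
  apply: (add a y0) => //; apply: he => //; [lra|by rewrite subrr].
pose w := Num.min b (sup S + e / 2).
have Tw : sup S <= w by rewrite le_min Tb; lra.
have wb : w <= b by rewrite ge_min lexx.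
have we : w <= sup S + e / 2 by rewrite ge_min lexx orbT.
have Pw : P a w.
  apply: (add a (sup S)) => //; apply: he => //; [by rewrite subrr|lra].
have wS : w <= sup S by apply: ub_le_sup => //; split=> //; rewrite (le_trans aT Tw) wb.
suff -> : b = w by [].
apply/eqP; rewrite eq_le wb andbT; case: (leP b w) => // bw.
by exfalso; apply: (@falseR R); move: bw wS; rewrite /w minElt; case: ifP => _; lra.
Qed.

Lemma dlim_leftP (V : normedModType R) (u : R -> V) t :
  cvg (derive1 u x @[x --> t^'-]) <-> exists l, dlim (-1) u t l.
Proof.
split=> [/cvg_ex[l /cvgrPdist_lt hl]|[l hl]].
  exists l => e e0; have /nbhs_ballP[dl dl0 hd] := hl e e0; exists dl => // x xt [|sx].
    by move/eqP; rewrite oppr_eq0 oner_eq0.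
  by apply: hd; [rewrite /ball /= distrC|move: sx; rewrite mulN1r oppr_gt0 subr_lt0].
apply/cvg_ex; exists l; apply/cvgrPdist_lt => e e0; have [dl dl0 hd] := hl e e0.
apply/nbhs_ballP; exists dl => // x xt xlt; apply: hd; first by rewrite distrC.
by right; rewrite mulN1r oppr_gt0 subr_lt0.
Qed.

Lemma dlim_rightP (V : normedModType R) (u : R -> V) t :
  cvg (derive1 u x @[x --> t^'+]) <-> exists l, dlim 1 u t l.
Proof.
split=> [/cvg_ex[l /cvgrPdist_lt hl]|[l hl]].
  exists l => e e0; have /nbhs_ballP[dl dl0 hd] := hl e e0; exists dl => // x xt [|sx].
    by move/eqP; rewrite oner_eq0.
  by apply: hd; [rewrite /ball /= distrC|move: sx; rewrite mul1r subr_gt0].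
apply/cvg_ex; exists l; apply/cvgrPdist_lt => e e0; have [dl dl0 hd] := hl e e0.
apply/nbhs_ballP; exists dl => // x xt xlt; apply: hd; first by rewrite distrC.
by right; rewrite mul1r subr_gt0.
Qed.

Lemma norm_lt_eq (V : normedModType R) (x y : V) : (forall e, 0 < e -> `|x - y| < e) -> x = y.
Proof.
move=> h; apply/eqP; rewrite -subr_eq0 -normr_eq0; apply: contraT => n0.
by have := h `|x - y|; rewrite ltxx normr_gt0 -normr_eq0 => /(_ n0).
Qed.

Lemma dlim0P (V : normedModType R) (u : R -> V) t :
  {for t, continuous (derive1 u)} <-> exists l, dlim 0 u t l.
Proof.
split=> [/cvgrPdist_lt hl|[l hl]].
  exists (derive1 u t) => e e0; have /nbhs_ballP[dl dl0 hd] := hl e e0.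
  by exists dl => // x xt _; apply: hd; rewrite /ball /= distrC.
have lE : l = derive1 u t.
  apply: norm_lt_eq => e e0; have [dl dl0 hd] := hl e e0.
  by apply: hd; [rewrite subrr normr0|left].
apply/cvgrPdist_lt => e e0; have [dl dl0 hd] := hl e e0.
by apply/nbhs_ballP; exists dl => // x xt; rewrite -lE; apply: hd; [rewrite distrC|left].
Qed.

Definition admissible c a b s := [/\ cont_on c a b,
  forall t (i : chart A), a < t < b -> t \notin s -> dom i (c t) -> derivable (coord i \o c) t 1 &
  forall z t (i : chart A), sidable z a b s t -> dom i (c t) -> exists l, dlim z (coord i \o c) t l].

Lemma piecewise_C1P c : piecewise_C1 A c <-> exists s, admissible c 0 1 s.
Proof.
split=> [[/cont_onP cc [s hs]]|[s [cc h1 h2]]].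
  exists s; split=> // [t i /andP[t0 t1] ts dt|z t i sd dt].
    by have [|h _ _] := hs t i _ dt; [rewrite !ltW|have [] := h _ ts; rewrite ?t0].
  have [h1 h2 h3] := hs t i (sidable_itv sd) dt.
  case: sd => [[-> tI ts]|[-> /andP[t0 t1]]|[-> /andP[t0 t1]]].
  - by have [_ /dlim0P] := h1 tI ts.
  - exact/dlim_rightP/h3.
  - exact/dlim_leftP/h2.
split; first exact/cont_onP.
exists s => t i /andP[t0 t1] dt u; split.
- move=> tI ts; split; first exact: h1.
  by apply/dlim0P; apply: h2 => //; apply: Or31.
- by move=> tp; apply/dlim_leftP; apply: h2 => //; apply: Or33; rewrite tp.
- by move=> tp; apply/dlim_rightP; apply: h2 => //; apply: Or32; rewrite t0.
Qed.

Lemma bilin2 (G : 'M[R]_2) (v w : 'rV[R]_2) : bilin G v w =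
  (v 0 0 * G 0 0 + v 0 1 * G 1 0) * w 0 0 + (v 0 0 * G 0 1 + v 0 1 * G 1 1) * w 0 1.
Proof.
rewrite /bilin !mxE !big_ord_recl !big_ord0 !mxE !big_ord_recl !big_ord0.
have -> : lift ord0 (ord0 : 'I_1) = 1 :> 'I_2 by apply/val_inj.
by rewrite !addr0.
Qed.

(** The chart used by [speed] may jump with [t]. By the chain rule and [gram_compat] a fixed chart
    gives the same value, as continuity arguments require. *)
Lemma speed_chart c t e (i : chart A) : 0 < e -> (forall x, `|x - t| < e -> dom i (c x)) ->
  derivable (coord i \o c) t 1 ->
  speed g c t = Num.sqrt (bilin (gram g i (coord i (c t))) (derive1 (coord i \o c) t)
    (derive1 (coord i \o c) t)).
Proof.
move=> e0 di du; rewrite /speed; set j := chart_at A (c t).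
have dit : dom i (c t) by apply: di; rewrite subrr normr0.
have djt : dom j (c t) by apply: chart_atP.
pose tau := coord j \o param i : 'rV[R]_2 -> 'rV[R]_2.
have [dtau _] := transition_smooth i j 1.
have dt : differentiable tau ((coord i \o c) t).
  by apply: dtau; exists (c t).
have [-> _] := @near_eq_derivable1 R _ (coord j \o c) (tau \o (coord i \o c)) t e e0
  (fun x xt => congr1 (coord j) (esym (coordK (di x xt)))).
move/derivable1_diffP : (du) => du'.
rewrite derive1E (deriveE _ (differentiable_comp du' dt)) (diff_comp du' dt) /=.
rewrite -(deriveE _ du') -derive1E -(deriveE _ dt).
rewrite (gram_compat g dit djt) /=.
by rewrite coordK.
Qed.

Lemma speed_side c s z t : admissible c 0 1 s -> sidable z 0 1 s t ->
  exists l, forall e, 0 < e -> exists2 dl, 0 < dl &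
    forall x, `|x - t| < dl -> side z t x -> `|l - speed g c x| < e.
Proof.
move=> [cc h1 h2] sd; pose i := chart_at A (c t).
have dt : dom i (c t) by apply: chart_atP.
have [l hl] := h2 _ _ _ sd dt; have [r r0 hr] := sidable_near cc sd dt.
pose F := within [set x | side z t x] (nbhs t).
have FF : Filter F by apply: within_filter.
pose u := coord i \o c; pose u' := derive1 u.
have cu' : u' x @[x --> F] --> l.
  apply/cvgrPdist_lt => e e0; have [dl dl0 hd] := hl e e0.
  by apply/nbhs_ballP; exists dl => // x xt sx; apply: hd; rewrite // distrC.
have cu : u x @[x --> F] --> u t.
  have cci : nbhs (u t) `<=` u x @[x --> F].
    move=> U uU; have := coord_continuous dt uU.
    move=> cU; have [e e0 he] := cc t (sidable_itv sd) _ cU.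
    apply/nbhs_ballP; exists (Num.min e r); first by rewrite /= lt_min e0.
    move=> x; rewrite /ball /= distrC lt_min => /andP[x1 x2] sx.
    have [/andP[q1 q2] _ _] := hr x x2 sx.
    by apply: he => //; rewrite !ltW.
  exact: cci.
have cg : gram g i (u x) @[x --> F] --> gram g i (u t).
  apply: cvg_comp cu _; apply: (gram_smooth g i 0); by exists (c t).
have U j : (fun x => u' x 0 j) @ F --> l 0 j by exact: entry_cvg.
have G (j q : 'I_2) : (fun x => gram g i (u x) j q) @ F --> gram g i (u t) j q.
  by apply: (@entry_cvg R _ _ 2 2 (fun x => gram g i (u x))).
pose S x := Num.sqrt (bilin (gram g i (u x)) (u' x) (u' x)).
have cS : S x @[x --> F] --> Num.sqrt (bilin (gram g i (u t)) l l).
  have bS : (fun x => bilin (gram g i (u x)) (u' x) (u' x)) @ F --> bilin (gram g i (u t)) l l.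
    rewrite bilin2; under eq_fun do rewrite bilin2.
    exact: (cvgD (cvgM (cvgD (cvgM (U 0) (G 0 0)) (cvgM (U 1) (G 1 0))) (U 0))
      (cvgM (cvgD (cvgM (U 0) (G 0 1)) (cvgM (U 1) (G 1 1))) (U 1))).
  exact: (@cvg_comp _ _ _ (fun x => bilin (gram g i (u x)) (u' x) (u' x)) Num.sqrt F
    (nbhs (bilin (gram g i (u t)) l l)) _ bS (@sqrt_continuous R _)).
exists (Num.sqrt (bilin (gram g i (u t)) l l)) => e e0.
move/cvgrPdist_lt : cS => /(_ e e0) /nbhs_ballP[dl dl0 hd].
exists (Num.min dl r); first by rewrite lt_min dl0.
move=> x; rewrite lt_min => /andP[x1 x2] sx.
have [xI xs dx] := hr x x2 sx.
have xI' : 0 <= x <= 1 by case/andP: xI => *; rewrite !ltW.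
have [e1 e10 he1] := dom_near cc xI' dx.
have /andP[xp xq] := xI.
rewrite (@speed_chart c x (Num.min e1 (Num.min x (1 - x))) i).
- by apply: hd => //; rewrite /ball /= distrC.
- by rewrite !lt_min e10 xp subr_gt0.
- move=> y; rewrite !lt_min => /and3P[y1 y2 y3]; apply: he1 => //.
  by move: y2 y3; rewrite !ltr_norml => /andP[? ?] /andP[? ?]; apply/andP; split; lra.
- exact: h1.
Qed.

Lemma speed_continuous c s t : admissible c 0 1 s -> 0 < t < 1 -> t \notin s ->
  {for t, continuous (speed g c)}.
Proof.
move=> ad tI ts; have [|l hl] := speed_side (z := 0) (t := t) ad; first by apply: Or31.
have lE : l = speed g c t.
  apply: norm_lt_eq => e e0; have [dl dl0 hd] := hl e e0.
  by apply: hd; [rewrite subrr normr0|left].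
apply/cvgrPdist_lt => e e0; have [dl dl0 hd] := hl e e0.
by apply/nbhs_ballP; exists dl => // x xt; rewrite -lE; apply: hd; [rewrite distrC|left].
Qed.

Lemma speed_bounded c s : admissible c 0 1 s -> exists B, forall t, 0 <= t <= 1 -> speed g c t <= B.
Proof.
move=> ad; apply: (@cousin (fun x y => exists B, forall t, x <= t <= y -> speed g c t <= B)) => //.
  move=> t /andP[t0 t1].
  have half z : z = 1 \/ z = -1 -> exists2 e, 0 < e & exists B, forall x, 0 <= x <= 1 ->
      `|x - t| < e -> 0 < z * (x - t) -> speed g c x <= B.
    move=> hz; have [sd|nsd] := pselect (sidable z 0 1 s t).
      have [l hl] := speed_side ad sd; have [dl dl0 hd] := hl 1 ltr01.
      exists dl => //; exists (l + 1) => x _ xt sx; have := hd x xt (or_intror sx).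
      by rewrite distrC ltr_norml => /andP[_]; lra.
    exists 1 => //; exists 0 => x /andP[x0 x1] _ sx; exfalso; apply: nsd.
    case: hz sx => -> sx; [apply: Or32|apply: Or33]; split=> //; apply/andP; split; lra.
  have [e1 e10 [B1 h1]] := half 1 (or_introl erefl).
  have [e2 e20 [B2 h2]] := half (-1) (or_intror erefl).
  exists (Num.min e1 e2); first by rewrite lt_min e10.
  move=> x y x0 xt ty y1; rewrite !lt_min => /andP[x1 x2] /andP[y2 y3].
  exists (`|B1| + `|B2| + speed g c t) => w /andP[w1 w2].
  have n1 := normr_ge0 B1; have n2 := normr_ge0 B2; have l1 := ler_norm B1; have l2 := ler_norm B2.
  have n3 := speed_ge0 g c t.
  have wI : 0 <= w <= 1 by apply/andP; split; lra.
  have [wt|tw|->] := ltgtP w t; last by rewrite lerDr addr_ge0.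
    have : speed g c w <= B2 by apply: h2 => //; [rewrite ltr_norml; apply/andP; split; lra|lra].
    by move=> h; apply: (le_trans h); apply: (le_trans l2); rewrite addrAC lerDr addr_ge0.
  have : speed g c w <= B1 by apply: h1 => //; [rewrite ltr_norml; apply/andP; split; lra|lra].
  by move=> h; apply: (le_trans h); apply: (le_trans l1); rewrite -addrA lerDl addr_ge0.
move=> x y w _ xy yw _ [B hB] [B' hB']; exists (Num.max B B') => t /andP[t0 t1].
rewrite le_max; have [ty|yt] := leP t y; first by rewrite hB // t0.
by rewrite hB' ?orbT // (ltW yt).
Qed.

Lemma finite_measurable_fun (f : R -> R) (s : seq R) :
  measurable ([set` s] : set R) /\ measurable_fun [set` s] f.
Proof.
elim: s => [|y s [ms mf]].
  by rewrite set_nil; split; [exact: measurable0|exact: measurable_fun_set0].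
have -> : [set` y :: s] = [set y] `|` [set` s].
  apply/seteqP; split=> x /=; rewrite in_cons.
    by case/orP => [/eqP->|]; [left|right].
  by case=> [->|->]; rewrite ?eqxx ?orbT.
split; first exact: measurableU.
by apply/measurable_funU => //; split=> //; exact: measurable_fun_set1.
Qed.

(** The speed is bounded; it is continuous on the open interval minus the exceptional points, and on
    the remaining finite set measurability is automatic. *)
Lemma speed_integrable c s : admissible c 0 1 s ->
  (@lebesgue_measure R).-integrable `[0, 1] (EFin \o speed g c).
Proof.
move=> ad; have [B hB] := speed_bounded ad.
apply: measurable_bounded_integrable => //.
- by rewrite /= lebesgue_measure_itv /= lte_fin ltr01 oppr0 adde0 ltry.
- pose s' := 0 :: 1 :: s; have [ms mf] := finite_measurable_fun (speed g c) s'.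
  pose D := [set t : R | 0 < t < 1 /\ t \notin s].
  have Dop : open D.
    rewrite openE => t [/andP[t0 t1] ts]; have [e e0 he] := seq_avoid s t.
    apply/nbhs_ballP; exists (Num.min e (Num.min t (1 - t))).
      by rewrite /= !lt_min e0 t0 subr_gt0.
    move=> x; rewrite /ball /= distrC !lt_min => /and3P[x1 x2 x3].
    split; first by move: x2 x3; rewrite !ltr_norml => /andP[? ?] /andP[? ?]; apply/andP; split; lra.
    by have [->//|xt] := eqVneq x t; apply: he.
  have mD : measurable_fun D (speed g c).
    apply: open_continuous_measurable_fun => // t; rewrite inE => -[tI ts].
    exact: speed_continuous ad tI ts.
  have mU : measurable_fun (D `|` [set` s']) (speed g c).
    by apply/measurable_funU => //; exact: open_measurable.
  apply: measurable_funS mU; first by apply: measurableU => //; exact: open_measurable.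
  move=> t; rewrite /= in_itv /= => /andP[t0 t1].
  have [ts|ts] := boolP (t \in s'); [by right|left].
  move: ts; rewrite /s' !in_cons !negb_or => /and3P[n0 n1 ns]; split=> //.
  by rewrite !lt_neqAle t0 t1 n1 eq_sym n0.
- exists `|B|; split; first exact: num_real.
  move=> y By t; rewrite /= in_itv /= => tI; rewrite ger0_norm ?speed_ge0 //.
  by apply: le_trans (hB t tI) (le_trans (ler_norm B) (ltW By)).
Qed.

Lemma tame_exists c : piecewise_C1 A c ->
  exists L, tame g c L 0 1 /\ L 1 - L 0 = curve_length g c.
Proof.
move=> /piecewise_C1P[s ad]; have I := speed_integrable ad; have [cc h1 h2] := ad.
pose L (x : R) := (\int[@lebesgue_measure R]_(t in [set` Interval (BLeft 0) (BRight x)]) speed g c t)%R.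
exists L; split; last by rewrite /L set_itv1 Rintegral_set1 subr0.
split=> //.
  by apply/cont_onP; exact: parameterized_integral_continuous ler01 I.
exists s; split=> // t tI ts; have /andP[t0 t1] := tI.
have [d dE] := continuous_FTC1 t1 I t0 (speed_continuous ad tI ts).
by apply: DeriveDef; [exact: d|rewrite -derive1E; exact: dE].
Qed.

Lemma tame_admissible c L a b : tame g c L a b -> exists s, admissible c a b s.
Proof. by move=> [cc Lc [s [h1 h2 h3]]]; exists s. Qed.

Lemma tame_length c L : tame g c L 0 1 -> piecewise_C1 A c /\ curve_length g c = L 1 - L 0.
Proof.
move=> tm; have pc : piecewise_C1 A c by apply/piecewise_C1P; apply: tame_admissible tm.
split=> //; have [L' [tm' <-]] := tame_exists pc.
exact: tame_unique ler01 tm' tm.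
Qed.

Lemma tame_shift c L r a b : tame g c L a b -> tame g c (fun t => L t + r) a b.
Proof.
move=> [cc Lc [s [h1 h2 h3]]]; split=> //.
  move/cont_onP : Lc => Lc; apply/cont_onP => t.
  by apply: cvgD; [exact: Lc|exact: cvg_cst].
exists s; split=> // t tI ts; have D := h2 t tI ts.
have -> : (fun t => L t + r) = L \+ cst r by [].
by apply: is_derive_eq; rewrite addr0.
Qed.

(** The length [r] is exact, so links can be reversed, added and cut at a prescribed length; from
    here on they mostly stand for curves. *)
Definition link p q r := exists c L, [/\ tame g c L 0 1, c 0 = p, c 1 = q & L 1 - L 0 = r].

Lemma link_ge0 p q r : link p q r -> 0 <= r.
Proof. by move=> [c [L [tm _ _ <-]]]; rewrite subr_ge0; apply: tame_le tm. Qed.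

Lemma tame_link c L a b : a < b -> tame g c L a b -> link (c a) (c b) (L b - L a).
Proof.
move=> ab tm; have k0 : 0 < b - a by rewrite subr_gt0.
have := tame_affine (k := b - a) (m := a) (a' := 0) (b' := 1) (lt0r_neq0 k0) _ tm.
move=> H; exists (fun t => c ((b - a) * t + a)), (fun t => Num.sg (b - a) * L ((b - a) * t + a)).
have e0 : (b - a) * 0 + a = a by ring.
have e1 : (b - a) * 1 + a = b by ring.
split; rewrite ?e0 ?e1 //; last by rewrite gtr0_sg // !mul1r.
by apply: H; left; rewrite e0 e1.
Qed.

Lemma tame_cst p r a b : tame g (fun=> p) (fun=> r) a b.
Proof.
have d0 (i : chart A) t : derive1 (coord i \o (fun=> p)) t = 0.
  by rewrite derive1E; exact: derive_cst.
split; first by move=> t _ U pU; exists 1 => // *; apply: nbhs_singleton pU.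
  by move=> t _ U pU; exists 1 => // *; apply: nbhs_singleton pU.
exists [::]; split=> [t i _ _ _|t _ _|z t i _ _].
- exact: derivable_cst.
- rewrite /speed d0 bilin2 !mxE !(mul0r, mulr0, addr0) sqrtr0.
  exact: is_derive_cst.
- by exists 0 => e e0; exists 1 => // x _ _; rewrite d0 subrr normr0.
Qed.

Lemma link_refl p : link p p 0.
Proof. by exists (fun=> p), (fun=> 0); split=> //; [exact: tame_cst|rewrite subrr]. Qed.

Lemma link_sym p q r : link p q r -> link q p r.
Proof.
move=> [c [L [tm <- <- <-]]].
have := tame_affine (k := -1) (m := 1) (a' := 0) (b' := 1) _ _ tm.
move=> H; exists (fun t => c (-1 * t + 1)), (fun t => Num.sg (-1) * L (-1 * t + 1)).
have e0 : -1 * 0 + 1 = 1 :> R by ring.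
have e1 : -1 * 1 + 1 = 0 :> R by ring.
split; rewrite ?e0 ?e1 //; last by rewrite ltr0_sg ?ltrN10 //; ring.
by apply: H; [rewrite oppr_eq0 oner_eq0|right; rewrite e0 e1 ltrN10].
Qed.

Lemma link_trans p q o r r' : link p q r -> link q o r' -> link p o (r + r').
Proof.
move=> [c [L [tm c0 c1 Lr]]] [c' [L' [tm' c0' c1' Lr']]].
have k0 : (2 : R) != 0 by rewrite pnatr_eq0.
have h0 : 2 * 0 + 0 = 0 :> R by ring.
have h1 : 2 * (1 / 2) + 0 = 1 :> R by field.
have h2 : 2 * (1 / 2) + -1 = 0 :> R by field.
have h3 : 2 * 1 + -1 = 1 :> R by ring.
have tA := tame_affine (k := 2) (m := 0) (a' := 0) (b' := 1 / 2) k0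
  (or_introl (conj (ltr0Sn _ _) (conj h0 h1))) tm.
have tB := tame_affine (k := 2) (m := -1) (a' := 1 / 2) (b' := 1) k0
  (or_introl (conj (ltr0Sn _ _) (conj h2 h3))) tm'.
have sg2 : Num.sg (2 : R) = 1 by rewrite gtr0_sg.
rewrite sg2 in tA tB; have tB' := tame_shift (L 1 - L' 0) tB.
have ha : (0 : R) < 1 / 2 by lra.
have hb : (1 : R) / 2 < 1 by lra.
pose cc := glue (1 / 2) (fun t => c (2 * t + 0)) (fun t => c' (2 * t + -1)).
pose LL := glue (1 / 2) (fun t => 1 * L (2 * t + 0)) (fun t => 1 * L' (2 * t + -1) + (L 1 - L' 0)).
have ec : c (2 * (1 / 2) + 0) = c' (2 * (1 / 2) + -1) by rewrite h1 h2 c1 c0'.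
have eL : 1 * L (2 * (1 / 2) + 0) = 1 * L' (2 * (1 / 2) + -1) + (L 1 - L' 0) by rewrite h1 h2; ring.
exists cc, LL; split.
- exact: tame_glue ha hb ec eL tA tB'.
- by rewrite /cc glue_l ?(ltW ha) // h0.
- by rewrite /cc glue_r ?(ltW hb) // h3.
- rewrite /LL (glue_r _ (ltW hb)) // glue_l ?(ltW ha) // h0 h3 -Lr -Lr'; ring.
Qed.

Lemma link_split p q r r1 : link p q r -> 0 <= r1 <= r ->
  exists o, link p o r1 /\ link o q (r - r1).
Proof.
move=> [c [L [tm <- <- <-]]] /andP[r0 r1r].
have [_ Lc _] := tm; move/cont_onP : Lc => Lc.
have [|t] := @IVT R L 0 1 (L 0 + r1) ler01 Lc.
  by rewrite minElt maxElt; case: ifP => h; apply/andP; split; lra.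
rewrite in_itv /= => /andP[t0 t1] Lt; exists (c t).
have [t00|tp] : t = 0 \/ 0 < t by lra.
  have -> : r1 = 0 by rewrite t00 in Lt; lra.
  by rewrite t00 subr0; split; [exact: link_refl|exists c, L].
have [t11|tq] : t = 1 \/ t < 1 by lra.
  have -> : r1 = L 1 - L 0 by rewrite t11 in Lt; lra.
  by rewrite t11 subrr; split; [exists c, L|exact: link_refl].
split.
  have -> : r1 = L t - L 0 by lra.
  by apply: tame_link => //; apply: tame_sub tm.
have -> : L 1 - L 0 - r1 = L 1 - L t by lra.
by apply: tame_link => //; apply: tame_sub tm.
Qed.

Local Notation d := (riemannian_dist g).

Lemma dist_link p q : d p q = inf [set r | link p q r].
Proof.
rewrite /riemannian_dist; congr inf; apply/seteqP; split=> r /=.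
  move=> [c [pc c0 c1] <-]; have [L [tm Lr]] := tame_exists pc.
  by exists c, L.
by move=> [c [L [tm c0 c1 <-]]]; have [pc le] := tame_length tm; exists c.
Qed.

Lemma dist_le p q r : link p q r -> d p q <= r.
Proof.
move=> h; rewrite dist_link; apply: ge_inf => //.
by exists 0 => x; exact: link_ge0.
Qed.

Lemma dist_ge0 p q : 0 <= d p q.
Proof.
rewrite dist_link; have [[r hr]|nr] := pselect (exists r, link p q r).
  by apply: lb_le_inf; [exists r|move=> x; exact: link_ge0].
(* Without any curve, the infimum of the empty set is 0 by convention. *)
by rewrite inf_out // => -[[r hr] _]; apply: nr; exists r.
Qed.

Lemma dist_sym p q : d p q = d q p.
Proof.
by rewrite !dist_link; congr inf; apply/seteqP; split=> r; exact: link_sym.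
Qed.

Lemma dist_refl p : d p p = 0.
Proof. by apply/eqP; rewrite eq_le dist_ge0 andbT; exact: dist_le (link_refl p). Qed.

Definition reach p q := exists r, link p q r.

Lemma dist_lt p q r : reach p q -> d p q < r -> exists2 r', r' < r & link p q r'.
Proof.
move=> [r0 h0]; rewrite dist_link => /inf_lt[|r' h' r'r]; last by exists r'.
by exists r0.
Qed.

Lemma dist_triangle p q o : reach p q -> reach q o -> d p o <= d p q + d q o.
Proof.
move=> pq qo; apply/ler_addgt0Pr => e e0.
have [|r1 h1 l1] := dist_lt (r := d p q + e / 2) pq; first lra.
have [|r2 h2 l2] := dist_lt (r := d q o + e / 2) qo; first lra.
by apply: le_trans (dist_le (link_trans l1 l2)) _; lra.
Qed.

Lemma dist_split p q r1 r : reach p q -> 0 <= r1 -> d p q < r1 + r -> 0 <= r ->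
  exists o, d p o <= r1 /\ d o q <= r.
Proof.
move=> pq r10 dr r0; have [r' r'r l] := dist_lt pq dr.
have [r1r'|r'r1] := leP r1 r'.
  have [|o [l1 l2]] := link_split (r1 := r1) l; first by rewrite r10.
  exists o; split; first exact: dist_le.
  by apply: le_trans (dist_le l2) _; lra.
exists q; split; first by apply: le_trans (dist_le l) (ltW r'r1).
by rewrite dist_refl.
Qed.

End Lengths.

(** * Balls of a complete Riemannian plane are bounded *)

Section Properness.
Local Open Scope ring_scope.
Variables (R : realType) (M : topologicalType) (A : smooth_atlas R M) (g : riemannian_metric A).
Implicit Types (a b t x e : R) (c : R -> M) (L : R -> R) (s : seq R).
Local Notation d := (riemannian_dist g).

Lemma norm_ball (y y' : 'rV[R]_2) r : `|y - y'| < r <-> ball y r y'.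
Proof. by rewrite -ball_normE. Qed.

Lemma compact_nat_cover (K : set 'rV[R]_2) (O : nat -> set 'rV[R]_2) : compact K ->
  (forall n, open (O n)) -> K `<=` \bigcup_n O n ->
  exists n, forall y, K y -> exists2 k, (k <= n)%N & O k y.
Proof.
rewrite compact_cover => Kc Oo KO; have [D' _ hD'] := Kc nat setT O (fun n _ => Oo n) KO.
exists (\max_(k <- finmap.enum_fset D') k)%N => x /hD'[k /= kD Okx]; exists k => //.
by apply: (@leq_bigmax_seq _ _ xpredT (fun k => k)).
Qed.

Lemma entry_le m n (v : 'M[R]_(m, n)) (j : 'I_m) (k : 'I_n) : `|v j k| <= `|v|.
Proof.
rewrite [X in _ <= X](_ : _ = mx_norm v) // mx_normrE; apply: (@le_bigmax _ _ _ 0 (fun ij : 'I_m * 'I_n => `|v ij.1 ij.2|) (j, k)).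
Qed.

Lemma norm_le2 (v : 'rV[R]_2) r : `|v 0 0| <= r -> `|v 0 1| <= r -> `|v| <= r.
Proof.
move=> h0 h1; rewrite (_ : `|v| = mx_norm v) // mx_normrE; apply: bigmax_le => [|[j k] _ /=].
  exact: le_trans (normr_ge0 _) h0.
rewrite ord1; case: (unliftP 0 k) => [k'|] -> //.
by have -> : lift 0 k' = 1 by apply/val_inj; rewrite /= ord1.
Qed.

Lemma derive_line (W : normedModType R) (f : 'rV[R]_2 -> W) (x0 v : 'rV[R]_2) x :
  derive1 (fun t => f (x0 + t *: v)) x = 'D_v f (x0 + x *: v) /\
  (derivable f (x0 + x *: v) v -> derivable (fun t => f (x0 + t *: v)) x 1).
Proof.
have e : (fun h : R => h^-1 *: (((fun t => f (x0 + t *: v)) \o shift x) (h *: (1 : R)) - f (x0 + x *: v)))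
   = (fun h : R => h^-1 *: ((f \o shift (x0 + x *: v)) (h *: v) - f (x0 + x *: v))).
  apply/funext => h /=; congr (_ *: (f _ - _)).
  have -> : h *: (1 : R) = h by rewrite /GRing.scale /= mulr1.
  by rewrite scalerDl addrCA.
by rewrite derive1E /derive /derivable e.
Qed.

Lemma dom_overlap_near (i j : chart A) p : dom i p -> dom j p ->
  nbhs (coord i p) (coord i @` (dom i `&` dom j)).
Proof.
move=> di dj.
have n1 : nbhs (coord i p) (coord i @` dom i).
  by apply: open_nbhs_nbhs; split; [exact: cod_open|exists p].
have n2 : nbhs (coord i p) (param i @^-1` dom j).
  apply: (param_continuous di); rewrite coordK //; apply: open_nbhs_nbhs; split=> //.
  exact: dom_open.
apply: filterS (filterI n1 n2) => y [[q dq <-] dj']; exists q => //; split=> //.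
by move: dj'; rewrite /= coordK.
Qed.

Lemma line_link (i : chart A) (x0 v : 'rV[R]_2) r :
  (forall t, 0 <= t <= 1 -> (coord i @` dom i) (x0 + t *: v)) -> 0 <= r ->
  (forall t, 0 <= t <= 1 -> bilin (gram g i (x0 + t *: v)) v v <= r ^+ 2) ->
  exists2 r', r' <= r & link g (param i x0) (param i (x0 + v)) r'.
Proof.
move=> ln r0 bd; pose l t := x0 + t *: v; pose c t := param i (l t).
have lc : continuous l.
  by move=> t; apply: cvgD; [exact: cvg_cst|apply: cvgZ; [exact: cvg_id|exact: cvg_cst]].
have ci t : 0 <= t <= 1 -> dom i (c t) /\ coord i (c t) = l t.
  by move=> tI; have [q dq qE] := ln t tI; rewrite /c -[l t]qE coordK.
have near_t t (j : chart A) : 0 <= t <= 1 -> dom j (c t) ->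
    exists2 e, 0 < e & forall x, `|x - t| < e -> (coord i @` (dom i `&` dom j)) (l x).
  move=> tI dj; have [di ce] := ci t tI; have := dom_overlap_near di dj.
  rewrite ce => nn; have /nbhs_ballP[e e0 he] := lc t _ nn.
  by exists e => // x xt; apply: he; rewrite /ball /= distrC.
have dv (j : chart A) x : (coord i @` (dom i `&` dom j)) (l x) ->
    derive1 (coord j \o c) x = 'D_v (coord j \o param i) (l x) /\
    derivable (coord j \o c) x 1.
  move=> lx; have [h1 h2] := derive_line (coord j \o param i) x0 v x.
  split; first exact: h1.
  apply: h2; apply: diff_derivable; have [dt _] := transition_smooth i j 1.
  exact: dt.
have ad : admissible A c 0 1 [::].
  split.
  - move=> t tI U cU; have [di ce] := ci t tI.
    have pc := param_continuous di; rewrite ce in pc.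
    have /nbhs_ballP[e e0 he] := lc t _ (pc U cU).
    by exists e => // x _ xt; apply: he; rewrite /ball /= distrC.
  - move=> t j /andP[t0 t1] _ dj; have tI : 0 <= t <= 1 by rewrite !ltW.
    have [e e0 he] := near_t t j tI dj.
    by have [] := dv j t (he t _); rewrite // subrr normr0.
  - move=> z t j /sidable_itv tI dj; have [e e0 he] := near_t t j tI dj.
    have lt0 : (coord i @` (dom i `&` dom j)) (l t) by apply: he; rewrite subrr normr0.
    have [_ cts] := transition_smooth i j 1.
    have /cvgrPdist_lt cv := @continuous_comp _ _ _ l (fun y => 'D_v (coord j \o param i) y) t (lc t) (cts v _ lt0).
    exists ('D_v (coord j \o param i) (l t)) => r1 r10.
    have /nbhs_ballP[e1 e10 he1] := cv r1 r10.
    exists (Num.min e e1); first by rewrite lt_min e0.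
    move=> x; rewrite lt_min => /andP[x1 x2] _; have [-> _] := dv j x (he x x1).
    by apply: he1; rewrite /ball /= distrC.
have pc : piecewise_C1 A c by apply/piecewise_C1P; exists [::].
have [L [tm Lr]] := tame_exists g pc; exists (L 1 - L 0); last first.
  by exists c, L; split; rewrite // /c /l ?scale0r ?addr0 ?scale1r.
have [_ Lc [s [_ Ld _]]] := tm.
suff : r * 0 + -1 * L 0 <= r * 1 + -1 * L 1 by lra.
have := @monotone_off_finite R (fun t => r * t + -1 * L t) (fun t => r + -1 * speed g c t) s 0 1 ler01.
apply.
- apply: cont_onD; last exact: cont_onZ.
  by apply: cont_onZ => t _ U tU; have /nbhs_ballP[e e0 he] := tU; exists e => // x _ xt; apply: he; rewrite /ball /= distrC.
- move=> t tI ts; have D := Ld t tI ts.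
  have -> : (fun t => r * t + -1 * L t) = (r \*: id) \+ ((-1) \*: L) by [].
  by apply: is_derive_eq; rewrite /GRing.scale /= mulr1.
move=> t tI ts; have tI' : 0 <= t <= 1 by case/andP: tI => *; rewrite !ltW.
have [di ce] := ci t tI'; have [e e0 he] := near_t t i tI' di.
have di' x : `|x - t| < e -> dom i (c x) /\ (coord i \o c) x = l x.
  by move=> xt; have [q [dq _] qE] := he x xt; rewrite /= /c -qE coordK.
have [dE _] := near_eq_derivable1 (f := coord i \o c) (h := l) e0 (fun x xt => (di' x xt).2).
have lE : derive1 l t = v.
  have [h _] := derive_line (@id 'rV[R]_2) x0 v t.
  by rewrite h derive_id.
rewrite (speed_chart g e0 (fun x xt => (di' x xt).1)).
  rewrite dE lE ce mulN1r subr_ge0 -[leRHS]ger0_norm // -sqrtr_sqr.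
  by apply: ler_wsqrtr; exact: bd.
have h0 : `|t - t| < e by rewrite subrr normr0.
by have [_] := dv i t (he t h0).
Qed.

(** Near [p] the entries of the metric are bounded in a chart, so coordinate segments are short. *)
Lemma dist_upper p e : 0 < e -> nbhs p [set q | exists2 r, r < e & link g p q r].
Proof.
move=> e0; pose i := chart_at A p; have dp : dom i p by apply: chart_atP.
pose x0 := coord i p; pose B := `|gram g i x0| + 1.
have B0 : 0 < B by rewrite ltr_pwDr.
have n1 : nbhs x0 (coord i @` dom i).
  by apply: open_nbhs_nbhs; split; [exact: cod_open|exists p].
have n2 : nbhs x0 [set y | `|gram g i y| < B].
  have gc : {for x0, continuous (gram g i)} by apply: (gram_smooth g i 0); exists p.
  have : `|gram g i y| @[y --> x0] --> `|gram g i x0| by exact: (cvg_norm gc).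
  by move/cvgr_lt; apply; rewrite /B ltrDl.
have nn : nbhs x0 ((coord i @` dom i) `&` [set y | `|gram g i y| < B]) by apply: filterI.
have /nbhs_ballP[r0 r00 hr0] := nn.
pose r1 := Num.min r0 (e / (2 * B + 2)).
have B2 : 0 < 2 * B + 2 by lra.
have r10 : 0 < r1 by rewrite lt_min r00 divr_gt0.
have bl : nbhs x0 (ball x0 r1) by apply: nbhsx_ballx.
have n3 : nbhs p (dom i) by apply: open_nbhs_nbhs; split=> //; exact: dom_open.
apply: filterS (filterI n3 (coord_continuous dp bl)) => q [dq].
move=> /norm_ball; rewrite lt_min => /andP[q1 q2].
pose v := coord i q - x0; have nv : `|v| < r0 by rewrite distrC.
have inb t : 0 <= t <= 1 -> ball x0 r0 (x0 + t *: v).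
  move=> /andP[t0 t1]; apply/norm_ball; rewrite opprD addNKr normrN normrZ ger0_norm //.
  by apply: le_lt_trans nv; rewrite ler_piMl.
(* Each of the four terms of the quadratic form is at most [B] times the squared norm of [v], and
   [4 * B] is at most the square of [2 * B + 1]. *)
have [|||r' r'r] := @line_link i x0 v ((2 * B + 1) * `|v|).
- by move=> t tI; have [] := hr0 _ (inb t tI).
- by rewrite mulr_ge0 //; lra.
- move=> t tI; have [_ gB] := hr0 _ (inb t tI).
  have G00 := entry_le (gram g i (x0 + t *: v)) 0 0.
  have G01 := entry_le (gram g i (x0 + t *: v)) 0 1.
  have G10 := entry_le (gram g i (x0 + t *: v)) 1 0.
  have G11 := entry_le (gram g i (x0 + t *: v)) 1 1.
  have v0 := entry_le v 0 0; have v1 := entry_le v 0 1.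
  have ent (a b w : R) : `|w| <= B -> `|a| <= `|v| -> `|b| <= `|v| -> a * w * b <= B * `|v| ^+ 2.
    move=> h1 h2 h3; apply: le_trans (ler_norm _) _; rewrite !normrM expr2.
    by rewrite -mulrA mulrCA; do 2 (rewrite ler_pM ?mulr_ge0 //).
  have gB' := ltW gB.
  rewrite bilin2 ![in X in X <= _]mulrDl.
  have a1 := ent _ _ _ (le_trans G00 gB') v0 v0; have a2 := ent _ _ _ (le_trans G10 gB') v1 v0.
  have a3 := ent _ _ _ (le_trans G01 gB') v0 v1; have a4 := ent _ _ _ (le_trans G11 gB') v1 v1.
  apply: le_trans (lerD (lerD a1 a2) (lerD a3 a4)) _.
  rewrite exprMn -!mulrDl ler_wpM2r ?sqr_ge0 //; nra.
have -> : param i x0 = p by rewrite coordK.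
have -> : param i (x0 + v) = q by rewrite /v addrC subrK coordK.
move=> lk; exists r' => //; apply: le_lt_trans r'r _.
have : `|v| * (2 * B + 2) < e by rewrite -ltr_pdivlMr // distrC.
by have := normr_ge0 v; nra.
Qed.

(** By Cayley-Hamilton, trace times [G] minus determinant is the square of [G], so the trace times
    the difference of the two sides is the squared length of the image of [v]. The quotient
    determinant over trace is a lower bound of the spectrum that is visibly continuous in [G]. *)
Lemma bilin_lower (G : 'M[R]_2) (v : 'rV[R]_2) : G^T = G -> 0 < G 0 0 + G 1 1 ->
  (G 0 0 * G 1 1 - G 0 1 * G 1 0) / (G 0 0 + G 1 1) * (v 0 0 ^+ 2 + v 0 1 ^+ 2) <= bilin G v v.
Proof.
move=> sy tr; have s10 : G 1 0 = G 0 1 by rewrite -[in LHS]sy mxE.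
rewrite mulrAC ler_pdivrMr // bilin2 s10 -subr_ge0.
have -> : ((v 0 0 * G 0 0 + v 0 1 * G 0 1) * v 0 0 + (v 0 0 * G 0 1 + v 0 1 * G 1 1) * v 0 1) *
    (G 0 0 + G 1 1) - (G 0 0 * G 1 1 - G 0 1 * G 0 1) * (v 0 0 ^+ 2 + v 0 1 ^+ 2) =
    (G 0 0 * v 0 0 + G 0 1 * v 0 1) ^+ 2 + (G 0 1 * v 0 0 + G 1 1 * v 0 1) ^+ 2 by ring.
by rewrite addr_ge0 // sqr_ge0.
Qed.

Lemma posdef_det (G : 'M[R]_2) : G^T = G -> (forall v, v != 0 -> 0 < bilin G v v) ->
  0 < G 0 0 + G 1 1 /\ 0 < G 0 0 * G 1 1 - G 0 1 * G 1 0.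
Proof.
move=> sy pd; have s10 : G 1 0 = G 0 1 by rewrite -[in LHS]sy mxE.
pose mk (a b : R) : 'rV[R]_2 := \row_j (if j == 0 then a else b).
have mk0 a b : mk a b 0 0 = a by rewrite mxE.
have mk1 a b : mk a b 0 1 = b by rewrite mxE.
have nz a b : a != 0 \/ b != 0 -> mk a b != 0.
  move=> ab; apply/eqP => /rowP e; have := e 0; have := e 1; rewrite !mxE /= => e1 e0.
  by case: ab => /eqP.
have a0 : 0 < G 0 0.
  by have := pd _ (nz 1 0 (or_introl (oner_neq0 _))); rewrite bilin2 mk0 mk1; lra.
have a1 : 0 < G 1 1.
  by have := pd _ (nz 0 1 (or_intror (oner_neq0 _))); rewrite bilin2 mk0 mk1; lra.
split; first exact: addr_gt0.
(* On this vector the quadratic form equals [G 0 0] times the determinant. *)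
have := pd _ (nz (- G 0 1) (G 0 0) (or_intror (lt0r_neq0 a0))).
rewrite bilin2 mk0 mk1 s10.
have -> : (- G 0 1 * G 0 0 + G 0 0 * G 0 1) * - G 0 1 +
  (- G 0 1 * G 0 1 + G 0 0 * G 1 1) * G 0 0 = G 0 0 * (G 0 0 * G 1 1 - G 0 1 * G 0 1) by ring.
by rewrite pmulr_rgt0.
Qed.

Lemma speed_lower_near (i : chart A) p : dom i p -> exists2 k, 0 < k & nbhs (coord i p)
  [set y | forall v : 'rV[R]_2, k * `|v| <= Num.sqrt (bilin (gram g i y) v v)].
Proof.
move=> dp; pose x0 := coord i p; pose G y := gram g i y.
pose dt (y : 'rV[R]_2) := G y 0 0 * G y 1 1 - G y 0 1 * G y 1 0.
pose tr (y : 'rV[R]_2) := G y 0 0 + G y 1 1.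
have [t0 d0] : 0 < tr x0 /\ 0 < dt x0 by apply: posdef_det; [exact: gram_sym|exact: gram_posdef].
have gc : {for x0, continuous G} by apply: (gram_smooth g i 0); exists p.
have ge (j k : 'I_2) : (fun y => G y j k) @ x0 --> G x0 j k.
  exact: (@entry_cvg R _ _ 2 2 G).
have n0 : nbhs x0 (coord i @` dom i).
  by apply: open_nbhs_nbhs; split; [exact: cod_open|exists p].
have n1 : nbhs x0 [set y | dt x0 / 2 < dt y].
  have : dt @ x0 --> dt x0 by exact: (cvgB (cvgM (ge 0 0) (ge 1 1)) (cvgM (ge 0 1) (ge 1 0))).
  by move/cvgr_gt; apply; lra.
have n2 : nbhs x0 [set y | tr y < 2 * tr x0].
  have : tr @ x0 --> tr x0 by exact: (cvgD (ge 0 0) (ge 1 1)).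
  by move/cvgr_lt; apply; lra.
pose k2 := dt x0 / 2 / (2 * tr x0); have k20 : 0 < k2 by rewrite !divr_gt0 // mulr_gt0.
exists (Num.sqrt k2); first by rewrite sqrtr_gt0.
apply: filterS (filterI n0 (filterI n1 n2)) => y [[q dq qE] [y1 y2]] v.
have sy : (G y)^T = G y by rewrite /G -qE; exact: gram_sym.
have [ty _] : 0 < tr y /\ 0 < dt y.
  by rewrite /tr /dt /G -qE; apply: posdef_det; [exact: gram_sym|exact: gram_posdef].
have bl := bilin_lower v sy ty.
have kd : k2 <= dt y / tr y.
  rewrite /k2; apply: ler_pM; [by rewrite divr_ge0 // ltW| |exact: ltW y1|].
    by rewrite invr_ge0 mulr_ge0 // ltW.
  by rewrite lef_pV2 ?posrE ?mulr_gt0 //; exact: ltW y2.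
have sq (a b : R) : k2 * a ^+ 2 <= dt y / tr y * (a ^+ 2 + b ^+ 2).
  by apply: ler_pM; rewrite ?sqr_ge0 ?(ltW k20) // lerDl sqr_ge0.
have ent (j : 'I_2) : j = 0 \/ j = 1 -> Num.sqrt k2 * `|v 0 j| <= Num.sqrt (bilin (G y) v v).
  move=> hj; rewrite -sqrtr_sqr -sqrtrM ?(ltW k20) //; apply: ler_wsqrtr.
  apply: le_trans bl; case: hj => ->; first exact: sq.
  by rewrite [v 0 0 ^+ 2 + _]addrC; exact: sq.
have s0 : 0 < Num.sqrt k2 by rewrite sqrtr_gt0.
rewrite mulrC -ler_pdivlMr //; apply: norm_le2; rewrite ler_pdivlMr // mulrC; apply: ent;
  by [left|right].
Qed.

Lemma real_induction (P : R -> Prop) : P 0 ->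
  (forall t, 0 <= t < 1 -> P t -> exists2 e, 0 < e & forall x, t < x -> x < t + e -> x <= 1 -> P x) ->
  (forall t, 0 < t <= 1 -> (forall x, 0 <= x < t -> P x) -> P t) -> forall t, 0 <= t <= 1 -> P t.
Proof.
move=> P0 st cl; pose S := [set y | 0 <= y <= 1 /\ forall x, 0 <= x <= y -> P x].
have S0 : S 0.
  by split; rewrite ?lexx ?ler01 // => x xI; have -> : x = 0 by apply/eqP; rewrite eq_le andbC.
have Sub : has_ubound S by exists 1 => y [/andP[]].
have Ssup : has_sup S by split=> //; exists 0.
have T0 : 0 <= sup S by apply: ub_le_sup.
have T1 : sup S <= 1 by apply: ge_sup; [exists 0|move=> y [/andP[]]].
have below x : 0 <= x < sup S -> P x.
  move=> /andP[x0 xS]; have e0 : 0 < sup S - x by rewrite subr_gt0.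
  have [y [_ Py] yx] := sup_adherent e0 Ssup; apply: Py; rewrite x0 /=.
  by apply: ltW; move: yx; rewrite opprB addrC subrK.
have PS : P (sup S).
  have [->//|Sp] : sup S = 0 \/ 0 < sup S by move: T0; rewrite le_eqVlt => /orP[/eqP->|]; [left|right].
  by apply: cl; rewrite ?Sp.
have upto x : 0 <= x <= sup S -> P x.
  by move=> /andP[x0]; rewrite le_eqVlt => /orP[/eqP->//|xS]; apply: below; rewrite x0.
suff H : forall t, 0 <= t <= 1 -> 0 <= t <= sup S by move=> t /H/upto.
have [S1|S1] := leP 1 (sup S).
  by move=> t /andP[-> /= t1]; exact: le_trans t1 S1.
have [|e e0 he] := st (sup S) _ PS; first by rewrite T0.
pose w := Num.min 1 (sup S + e / 2).
have e2 : 0 < e / 2 by rewrite divr_gt0.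
have w1 : w <= 1 by rewrite ge_min lexx.
have w2 : w <= sup S + e / 2 by rewrite ge_min lexx orbT.
have wS : sup S < w by rewrite lt_min S1 ltrDl.
suff : w <= sup S by rewrite leNgt wS.
apply: ub_le_sup => //; split; first by rewrite w1 (le_trans T0 (ltW wS)).
move=> x /andP[x0 xw]; have [xS|Sx] := leP x (sup S); first by apply: upto; rewrite x0.
apply: he => //; last exact: le_trans xw w1.
apply: le_lt_trans xw (le_lt_trans w2 _); by rewrite ltrD2l ltr_pdivrMr // ltr_pMr // ltr1n.
Qed.

Variables (phi : M -> 'rV[R]_2) (phi' : 'rV[R]_2 -> M).
Hypotheses (phiK : cancel phi phi') (phi'K : cancel phi' phi).
Hypotheses (phi_c : continuous phi) (phi'_c : continuous phi').

Lemma plane_hausdorff : hausdorff_space M.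
Proof.
move=> p q pq; apply: (can_inj phiK); apply: (@norm_hausdorff R 'rV[R]_2).
move=> U V pU qV; have [x [Ux Vx]] := pq _ _ (phi_c pU) (phi_c qV).
by exists (phi x).
Qed.

(** The image of a segment under [phi'] is only a continuous path, but nearby points of it are
    linked by [dist_upper]. *)
Lemma reach_all p q : reach g p q.
Proof.
pose c t := phi' (phi p + t *: (phi q - phi p)).
have cc : continuous c.
  move=> t; apply: continuous_comp; last exact: phi'_c.
  by apply: cvgD; [exact: cvg_cst|apply: cvgZ; [exact: cvg_id|exact: cvg_cst]].
have c0 : c 0 = p by rewrite /c scale0r addr0 phiK.
have c1 : c 1 = q by rewrite /c scale1r addrC subrK phiK.
rewrite -c0 -c1; apply: (@cousin R (fun x y => reach g (c x) (c y))) => //.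
  move=> t _; have /nbhs_ballP[e e0 he] := cc t _ (dist_upper (c t) ltr01).
  exists e => // x y _ xt ty _ xe ye.
  have [|r1 _ l1] := he x; first by rewrite /ball /= ger0_norm // subr_ge0.
  have [|r2 _ l2] := he y; first by rewrite /ball /= distrC ger0_norm // subr_ge0.
  by exists (r1 + r2); apply: link_trans (link_sym l1) l2.
by move=> x y w _ _ _ _ [r1 l1] [r2 l2]; exists (r1 + r2); apply: link_trans l1 l2.
Qed.

Lemma dist_tri p q o : d p o <= d p q + d q o.
Proof. by apply: dist_triangle; exact: reach_all. Qed.

(** A curve from [p] shorter than [k * r] cannot leave the coordinate ball [W]: while inside, its
    coordinates move at most [1 / k] times its length, so it stays in the closed ball of radius
    [r2 < r]. This is propagated by real induction; at a limit time one uses that the image [K] of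
    that closed ball is compact, hence closed in the Hausdorff space [M]. *)
Lemma dist_lower p (U : set M) : nbhs p U -> exists2 e, 0 < e & forall q, d p q < e -> U q.
Proof.
move=> pU; pose i := chart_at A p; have dp : dom i p by apply: chart_atP.
pose x0 := coord i p; have [k k0 nk] := speed_lower_near dp.
have n1 : nbhs x0 (coord i @` dom i).
  by apply: open_nbhs_nbhs; split; [exact: cod_open|exists p].
have n2 : nbhs x0 (param i @^-1` U) by apply: (param_continuous dp); rewrite coordK.
have nn : nbhs x0 ((coord i @` dom i) `&` ((param i @^-1` U) `&` [set y | forall v : 'rV[R]_2,
    k * `|v| <= Num.sqrt (bilin (gram g i y) v v)])) by apply: filterI => //; apply: filterI.
have /nbhs_ballP[r r0 hr0] := nn.
have hr y (yr : `|x0 - y| < r) := hr0 y ((norm_ball _ _ _).1 yr).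
pose W := [set q | dom i q /\ `|x0 - coord i q| < r].
have Wop q : W q -> nbhs q W.
  move=> [dq qr]; have n3 : nbhs q (dom i) by apply: open_nbhs_nbhs; split=> //; exact: dom_open.
  have n4 : nbhs (coord i q) (ball x0 r).
    by apply: open_nbhs_nbhs; split; [exact: ball_open|exact/norm_ball].
  by apply: filterS (filterI n3 (coord_continuous dq n4)) => q' [dq' /norm_ball].
exists (k * r); first exact: mulr_gt0.
move=> q dpq; suff [dq qr] : W q by have [_ [] ] := hr _ qr; rewrite /= coordK.
have [r' r'r [c [L [tm c0 c1 Lr]]]] := dist_lt (reach_all p q) dpq.
have [cc Lc [s [h1 h2 h3]]] := tm; rewrite -c1.
have rk : r' / k < r by rewrite ltr_pdivrMr // mulrC.
pose r2 := (r' / k + r) / 2.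
have r'0 : 0 <= r' by rewrite -Lr subr_ge0; apply: tame_le tm.
have rk0 : 0 <= r' / k by rewrite divr_ge0 // ltW.
have r20 : 0 < r2 by rewrite /r2; lra.
have r2r : r2 < r by rewrite /r2; lra.
pose K := param i @` closed_ball x0 r2.
have KW y : closed_ball x0 r2 y -> (coord i @` dom i) y /\ `|x0 - y| < r.
  rewrite closed_ballE // /closed_ball_ /= => yr; have yr' := le_lt_trans yr r2r.
  by have [] := hr y yr'.
have Kc : closed K.
  apply: compact_closed; first exact: plane_hausdorff.
  apply: continuous_compact.
    apply: continuous_in_subspaceT => y; rewrite inE => /KW[[q' dq' <-] _].
    exact: param_continuous.
  apply: bounded_closed_compact; last exact: closed_ball_closed.
  exists (`|x0| + r2); split; first exact: num_real.
  move=> y yB z; rewrite closed_ballE // /closed_ball_ /= => zr.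
  apply: le_trans (ltW yB); rewrite -[z](subKr x0) (le_trans (ler_normB _ _)) // lerD2l //.
apply: (@real_induction (fun t => W (c t))); rewrite ?ler01 ?lexx //.
- by rewrite c0; split=> //; rewrite subrr normr0.
- move=> t /andP[t0 t1] Wt; have [|e e0 he] := cc t _ _ (Wop _ Wt); first by rewrite t0 ltW.
  exists e => // x tx xe x1; apply: he; first by rewrite x1 (le_trans t0 (ltW tx)).
  by rewrite ger0_norm ?subr_ge0 ?ltW // ltrBlDl.
move=> t /andP[t0 t1] Wb.
have KB x : 0 <= x < t -> K (c x).
  move=> /andP[x0' xt]; have [dx xr] : W (c x) by apply: Wb; rewrite x0' xt.
  exists (coord i (c x)); last by rewrite coordK.
  rewrite closed_ballE // /closed_ball_ /=.
  have Wy y : 0 <= y <= x -> W (c y) by move=> /andP[y0 yx]; apply: Wb; rewrite y0 (le_lt_trans yx).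
  have x1 : x <= 1 by apply: le_trans (ltW xt) t1.
  have dy y : 0 < y < x -> y \notin s -> derivable (coord i \o c) y 1 /\
      forall j, `|derive1 (coord i \o c) y 0 j| <= speed g c y / k.
    move=> /andP[y0 yx] ys; have yI : 0 < y < 1 by rewrite y0 (lt_le_trans yx).
    have [dcy yr] : W (c y) by apply: Wy; rewrite !ltW.
    have dd := h1 y i yI ys dcy; split=> // j.
    have yI' : 0 <= y <= 1 by case/andP: yI => *; rewrite !ltW.
    have [e1 e10 he1] := dom_near cc yI' dcy.
    have /andP[_ y1] := yI.
    have em0 : 0 < Num.min e1 (Num.min y (1 - y)) by rewrite !lt_min e10 y0 subr_gt0.
    rewrite (@speed_chart R M A g c y _ i em0); last 2 first.
    - move=> w; rewrite !lt_min => /and3P[w1 w2 w3]; apply: he1 => //.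
      by move: w2 w3; rewrite !ltr_norml => /andP[? ?] /andP[? ?]; apply/andP; split; lra.
    - exact: dd.
    have [_ [_ low]] := hr _ yr; rewrite ler_pdivlMr // mulrC.
    by apply: le_trans (low _); rewrite ler_pM2l //; exact: entry_le.
  have cuj j (z : R) : cont_on (fun y => z * (coord i (c y)) 0 j) 0 x.
    apply: cont_onZ => y yI V yV; have [dcy _] := Wy y yI.
    have nV : nbhs (c y) [set q' | V (coord i q' 0 j)].
      have n5 : nbhs (coord i (c y)) [set w : 'rV[R]_2 | V (w 0 j)].
        exact: (@matrix_normedtype.coord_continuous R 1 2 0 j (coord i (c y)) V yV).
      exact: (coord_continuous dcy n5).
    have yI' : 0 <= y <= 1 by case/andP: yI => -> yx; exact: le_trans yx x1.
    have [e e0 he] := cc y yI' _ nV; exists e => // w /andP[w0 wx]; apply: he.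
    by rewrite w0 (le_trans wx).
  have Lx : L x - L 0 <= r'.
    have : L x <= L 1 by apply: tame_le x1 _; apply: tame_sub tm.
    by rewrite -Lr => h; rewrite lerD2r.
  have est (j : 'I_2) (z : R) : z = 1 \/ z = -1 -> z * (coord i (c x) 0 j - x0 0 j) <= r' / k.
    move=> hz.
    have mono : k^-1 * L 0 + (- z) * coord i (c 0) 0 j <= k^-1 * L x + (- z) * coord i (c x) 0 j.
      apply: (@monotone_off_finite R (fun y => k^-1 * L y + (- z) * coord i (c y) 0 j)
        (fun y => k^-1 * speed g c y + (- z) * derive1 (coord i \o c) y 0 j) s 0 x x0').
      - by apply: cont_onD; [apply: cont_onZ; exact: cont_on_sub (lexx _) x1 Lc|exact: cuj].
      - move=> y yI ys; have [dd _] := dy y yI ys.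
        have yI' : 0 < y < 1 by case/andP: yI => -> /= yx; exact: lt_le_trans yx x1.
        have D1 := h2 y yI' ys.
        have D2 : is_derive y (1 : R) (fun y => coord i (c y) 0 j) (derive1 (coord i \o c) y 0 j).
          apply: DeriveDef; first by move/derivable_mxP : dd; apply.
          by rewrite derive1E derive_mx // mxE.
        have -> : (fun y => k^-1 * L y + - z * coord i (c y) 0 j) =
          (k^-1 \*: L) \+ ((- z) \*: (fun y => coord i (c y) 0 j)) by [].
        by apply: is_derive_eq.
      - move=> y yI ys; have [_ /(_ j)] := dy y yI ys; rewrite ler_norml => /andP[l1 l2].
        by rewrite mulrC; case: hz => ->; lra.
    rewrite c0 -/x0 in mono.
    have : k^-1 * (L x - L 0) <= k^-1 * r' by rewrite ler_pM2l ?invr_gt0.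
    by rewrite [r' / k]mulrC; lra.
  have ab (j : 'I_2) : `|(x0 - coord i (c x)) 0 j| <= r2.
    have e1 := est j 1 (or_introl erefl); have e2 := est j (-1) (or_intror erefl).
    by rewrite !mxE ler_norml /r2; apply/andP; split; lra.
  by apply: norm_le2; apply: ab.
have : K (c t).
  apply: Kc => V cV; have [|e e0 he] := cc t _ V cV; first by rewrite t1 ltW.
  pose x := Num.max 0 (t - e / 2).
  have e2 : 0 < e / 2 by rewrite divr_gt0.
  have xt : x < t by rewrite gt_max t0 ltrBlDr ltrDl.
  have x0' : 0 <= x by rewrite le_max lexx.
  exists (c x); split; first by apply: KB; rewrite x0'.
  apply: he; first by rewrite x0' (le_trans (ltW xt)).
  rewrite distrC ger0_norm ?subr_ge0 ?ltW // ltrBlDr -ltrBlDl.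
  apply: lt_le_trans (_ : t - e / 2 <= _); last by rewrite le_max lexx orbT.
  by rewrite ltrD2l ltrN2 ltr_pdivrMr // ltr_pMr // ltr1n.
by move=> [y /KW[[q' dq' <-] yr] <-]; rewrite coordK.
Qed.

Lemma halving a e : 0 < e -> exists N : nat, a / 2 ^+ N < e.
Proof.
move=> e0; exists (Num.bound (`|a| / e)); set N := Num.bound _.
have h : `|a| / e < N%:R by apply: archi_boundP; rewrite divr_ge0 // ltW.
have p2 : 0 < (2 : R) ^+ N by apply: exprn_gt0.
rewrite ltr_pdivrMr //; apply: le_lt_trans (ler_norm a) _; rewrite mulrC -ltr_pdivrMr //.
apply: lt_le_trans h _; rewrite -natrX ler_nat; exact/ltnW/ltn_expl.
Qed.

Definition unbounded_ball p r := forall B, exists q, d p q <= r /\ B < `|phi q|.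

(** Otherwise all balls of radius [r / 2] around points of the ball are bounded. A bounded ball
    around [p] is then covered, by compactness in the plane, by neighbourhoods with a common bound,
    and a larger radius is still bounded: the supremum of the bounded radii can be pushed up to
    [r]. *)
Lemma unbounded_half p r : 0 < r -> unbounded_ball p r ->
  exists q, d p q <= r /\ unbounded_ball q (r / 2).
Proof.
move=> r0 ub; apply: contrapT => hn.
have bdd q : d p q <= r -> exists B, forall o, d q o <= r / 2 -> `|phi o| <= B.
  move=> pq; apply: contrapT => nb; apply: hn; exists q; split=> // B.
  apply: contrapT => nB; apply: nb; exists B => o qo; rewrite leNgt; apply/negP => Bo.
  by apply: nB; exists o.
pose S := [set s | 0 <= s <= r /\ exists B, forall o, d p o <= s -> `|phi o| <= B].
have dpp : d p p <= r by rewrite dist_refl ltW.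
have S0 : S (r / 2).
  split; last exact: bdd.
  by apply/andP; split; lra.
have Sub : has_ubound S by exists r => y [/andP[]].
have Ssup : has_sup S by split=> //; exists (r / 2).
(* A point at distance at most [s + 2 * e] from [p] is within [3 * e] of some [m] in the ball of
   radius [s], hence within [4 * e = r / 2] of a covering point [w] at distance less than [e] from
   [m]. *)
pose e := r / 8; have e0 : 0 < e by rewrite /e; lra.
have [s1 [/andP[s10 s1r] [B1 hB1]] s1S] := sup_adherent e0 Ssup.
pose s := Num.min s1 (r - e).
have ss1 : s <= s1 by rewrite ge_min lexx.
have sr : s <= r - e by rewrite ge_min lexx orbT.
have s0 : 0 <= s by rewrite le_min s10; rewrite /e; lra.
(* Points [w] far from the ball of radius [s] get the dummy bound 0; the bound is only read for a
   [w] close to some [m] of that ball. *)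
have /choice[b bP] : forall w, exists n : nat, (exists m, d w m < e /\ d p m <= s) ->
    forall q, d w q <= r / 2 -> `|phi q| <= n%:R.
  move=> w; have [[m [wm pm]]|nm] := pselect (exists m, d w m < e /\ d p m <= s); last by exists 0%N.
  have [|B hB] := bdd w.
    by apply: le_trans (dist_tri p m w) _; rewrite (dist_sym g m w); lra.
  exists (Num.bound `|B|) => _ q wq; apply: le_trans (hB q wq) _.
  by apply: le_trans (ler_norm B) (ltW (archi_boundP (normr_ge0 _))).
pose N w := [set q | d w q < e].
have Nn w : nbhs w (N w).
  apply: filterS (dist_upper w e0) => q [r' r'e l]; exact: le_lt_trans (dist_le l) r'e.
pose O (n : nat) := phi' @^-1` (\bigcup_(w in [set w | (b w <= n)%N]) (N w)°).
have Oo n : open (O n).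
  apply: open_comp => [y _|]; first exact: phi'_c.
  by apply: bigcup_open => w _; exact: open_interior.
pose K : set 'rV[R]_2 := closed_ball 0 (`|B1| + 1).
have B10 : 0 < `|B1| + 1 by rewrite ltr_pwDr.
have Kc : compact K.
  apply: bounded_closed_compact; last exact: closed_ball_closed.
  exists (`|B1| + 1); split; first exact: num_real.
  move=> y yB z; rewrite /K closed_ballE // /closed_ball_ /= sub0r normrN => zr.
  exact: le_trans zr (ltW yB).
have Kcov : K `<=` \bigcup_n O n.
  by move=> y _; exists (b (phi' y)) => //; exists (phi' y) => //=; exact: Nn.
have [n ncov] := compact_nat_cover Kc Oo Kcov.
have main q : d p q <= s + 2 * e -> `|phi q| <= n%:R.
  move=> pq; have [||m [pm mq]] := @dist_split R M A g p q s (3 * e) (reach_all p q) s0; [lra|lra|].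
  have Km : K (phi m).
    rewrite /K closed_ballE // /closed_ball_ /= sub0r normrN.
    apply: le_trans (hB1 m (le_trans pm ss1)) _.
    by apply: le_trans (ler_norm B1) _; rewrite lerDl.
  have [k kn [w /= bk]] := ncov _ Km; rewrite phiK => /interior_subset /= wm.
  have wq : d w q <= r / 2.
    by apply: le_trans (dist_tri w m q) _; rewrite /N /= in wm; rewrite /e in wm mq; lra.
  apply: le_trans (bP w _ q wq) _; first by exists m.
  by rewrite ler_nat (leq_trans bk).
have [rs|sr'] := leP r (s + 2 * e).
  have [q [pq Bq]] := ub n%:R; have := main q (le_trans pq rs).
  by rewrite leNgt Bq.
have sE : s = s1.
  by move: sr'; rewrite /s minElt; case: ifP => // _; rewrite /e; lra.
have : s + 2 * e <= sup S.
  apply: ub_le_sup => //; split; last by exists n%:R.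
  by apply/andP; split; lra.
by rewrite sE; lra.
Qed.

Hypothesis d_complete : complete_dist d.

(** Halving an unbounded ball again and again gives a Cauchy sequence of centers. Its limit has a
    bounded neighbourhood, which by [dist_lower] contains one of the small unbounded balls. *)
Lemma balls_bounded p r : exists B, forall q, d p q <= r -> `|phi q| <= B.
Proof.
apply: contrapT => nb.
pose r0 := Num.max r 1.
have r00 : 0 < r0 by rewrite lt_max ltr01 orbT.
have ub0 : unbounded_ball p r0.
  move=> B; apply: contrapT => nB; apply: nb; exists B => q pq.
  rewrite leNgt; apply/negP => Bq; apply: nB; exists q; split=> //.
  by rewrite le_max pq.
have /choice[f fP] : forall xr : M * R, exists q, 0 < xr.2 -> unbounded_ball xr.1 xr.2 ->
    d xr.1 q <= xr.2 /\ unbounded_ball q (xr.2 / 2).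
  move=> [x t]; have [[t0 ut]|nt] := pselect (0 < t /\ unbounded_ball x t).
    by have [q hq] := unbounded_half t0 ut; exists q.
  by exists x => /= t0 ut; case: nt.
pose X := fix X n := if n is n'.+1 then f (X n', r0 / 2 ^+ n') else p.
have pos n : 0 < r0 / 2 ^+ n by rewrite divr_gt0 // exprn_gt0.
have Xu n : unbounded_ball (X n) (r0 / 2 ^+ n).
  elim: n => [|n IHn]; first by rewrite expr0 divr1.
  have [_] := fP (X n, r0 / 2 ^+ n) (pos n) IHn.
  by rewrite /= exprS invfM mulrA mulrAC.
have Xd n : d (X n) (X n.+1) <= r0 / 2 ^+ n by have [] := fP (X n, r0 / 2 ^+ n) (pos n) (Xu n).
have Xk n k : d (X n) (X (n + k)%N) <= 2 * (r0 / 2 ^+ n) - 2 * (r0 / 2 ^+ (n + k)).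
  elim: k => [|k IHk]; first by rewrite addn0 dist_refl subrr.
  rewrite addnS; apply: le_trans (dist_tri _ (X (n + k)%N) _) _.
  have -> : 2 * (r0 / 2 ^+ (n + k).+1) = r0 / 2 ^+ (n + k) by rewrite exprS invfM; field; rewrite expf_neq0.
  by have := Xd (n + k)%N; lra.
have Xk' N n : (N <= n)%N -> d (X N) (X n) <= 2 * (r0 / 2 ^+ N).
  move=> Nn; rewrite -(subnKC Nn); apply: le_trans (Xk _ _) _.
  by have := pos (N + (n - N))%N; lra.
have [e e0|x hx] := d_complete (u := X).
  have [N hN] := halving (4 * r0) e0; exists N => m n Nm Nn.
  apply: le_lt_trans (dist_tri _ (X N) _) _; rewrite (dist_sym g (X m)).
  have h1 := Xk' N m Nm; have h2 := Xk' N n Nn.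
  by apply: le_lt_trans (lerD h1 h2) _; rewrite -mulrDl -mulrA in hN *; lra.
have nU : nbhs x [set q | `|phi q| < `|phi x| + 1].
  have : `|phi q| @[q --> x] --> `|phi x| by apply: cvg_norm; exact: phi_c.
  by move/cvgr_lt; apply; rewrite ltrDl.
have [e e0 he] := dist_lower nU.
have e2 : 0 < e / 2 by rewrite divr_gt0.
have [N1 hN1] := hx _ e2; have [N2 hN2] := halving r0 e2.
pose n := maxn N1 N2.
have [q [Xq Bq]] := Xu n (`|phi x| + 1).
have : `|phi q| < `|phi x| + 1.
  apply: he; apply: le_lt_trans (dist_tri _ (X n) _) _; rewrite dist_sym.
  have a1 := hN1 n (leq_maxl _ _).
  have a2 : r0 / 2 ^+ n <= r0 / 2 ^+ N2.
    rewrite ler_pM2l // lef_pV2 ?posrE ?exprn_gt0 // ler_weXn2l ?ler1n // leq_maxr //.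
  by lra.
by rewrite ltNge (ltW Bq).
Qed.

End Properness.

(** * Transfer to the square grid *)

Section Grid.
Local Open Scope ring_scope.
Variables (R : realType) (M : topologicalType) (A : smooth_atlas R M) (g : riemannian_metric A).
Local Notation d := (riemannian_dist g).
Local Notation E := 'rV[R]_2.
Local Notation Z2 := (int * int)%type.
Variables (phi : M -> E) (phi' : E -> M).
Hypotheses (phiK : cancel phi phi') (phi'K : cancel phi' phi).
Hypotheses (phi_c : continuous phi) (phi'_c : continuous phi').
Implicit Types (r e : R) (u v w : E).

Lemma uniform_modulus r : exists2 e, 0 < e &
  forall u v, `|u| <= r -> `|u - v| <= e -> d (phi' u) (phi' v) <= 1.
Proof.
have /choice[rho rhoP] : forall w, exists k : R, 0 < k /\
    forall v, `|w - v| < 2 * k -> d (phi' w) (phi' v) < 1 / 2.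
  move=> w; have h2 : (0 : R) < 1 / 2 by lra.
  have /nbhs_ballP[e e0 he] := phi'_c (dist_upper g (phi' w) h2).
  exists (e / 2); split; first by rewrite divr_gt0.
  move=> v wv; have [|k k2 l] := he v; last exact: le_lt_trans (dist_le l) k2.
  by apply/norm_ball; move: wv; rewrite mulrC divfK.
have /choice[b bP] : forall w, exists n : nat, 1 / 2 ^+ n < rho w.
  by move=> w; apply: halving; have [] := rhoP w.
pose O (n : nat) := \bigcup_(w in [set w : E | (b w <= n)%N]) ball w (rho w).
have Oo n : open (O n).
  by apply: bigcup_open => w _; apply: ball_open; have [] := rhoP w.
have r0 : 0 < `|r| + 1 by rewrite ltr_pwDr.
have Kc : compact (closed_ball (0 : E) (`|r| + 1)).
  apply: bounded_closed_compact; last exact: closed_ball_closed.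
  exists (`|r| + 1); split; first exact: num_real.
  move=> y yB z; rewrite closed_ballE // /closed_ball_ /= sub0r normrN => zr.
  exact: le_trans zr (ltW yB).
have Kcov : closed_ball (0 : E) (`|r| + 1) `<=` \bigcup_n O n.
  by move=> y _; exists (b y) => //; exists y; [exact: leqnn|apply/norm_ball; rewrite subrr normr0; have [] := rhoP y].
have [n hn] := compact_nat_cover Kc Oo Kcov.
exists (1 / 2 ^+ n); first by rewrite divr_gt0 // exprn_gt0.
move=> u v ur uv.
have Ku : closed_ball (0 : E) (`|r| + 1) u.
  rewrite closed_ballE // /closed_ball_ /= sub0r normrN; apply: le_trans ur _.
  by apply: le_trans (ler_norm r) _; rewrite lerDl.
have [k kn [w /= bk wu]] := hn _ Ku; have [w0 hw] := rhoP w.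
have pw : 1 / 2 ^+ n <= 1 / 2 ^+ b w :> R.
  by rewrite ler_pM2l // lef_pV2 ?posrE ?exprn_gt0 // ler_weXn2l ?ler1n // (leq_trans bk).
have bw := bP w; move/norm_ball : wu => wu.
have d1 : d (phi' w) (phi' u) < 1 / 2 by apply: hw; lra.
have d2 : d (phi' w) (phi' v) < 1 / 2.
  by apply: hw; have := ler_distD u w v; lra.
have := dist_tri g phiK phi'_c (phi' u) (phi' w) (phi' v).
by rewrite (dist_sym g (phi' u) (phi' w)); lra.
Qed.

(** The bound [r + e], rather than [r], makes [gauge] Lipschitz with constant 1: an increase of [r]
    can be paid by an equal decrease of [e]. *)
Definition tight r e := forall u v, `|u| <= r + e -> `|u - v| <= e -> d (phi' u) (phi' v) <= 1.

Definition tight_set r := [set e : R | 0 <= e <= 1 /\ tight r e].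

Definition gauge r : R := sup (tight_set r).

Lemma tight_pos r : exists2 e, 0 < e & tight_set r e.
Proof.
have [e e0 he] := uniform_modulus (r + 1); exists (Num.min e 1); first by rewrite lt_min e0 ltr01.
have h1 : Num.min e 1 <= e by rewrite ge_min lexx.
have h2 : Num.min e 1 <= 1 by rewrite ge_min lexx orbT.
split; first by rewrite h2 le_min (ltW e0) ler01.
by move=> u v ur uv; apply: he; lra.
Qed.

Lemma tight_sup r : has_sup (tight_set r).
Proof.
by have [e _ he] := tight_pos r; split; [exists e|exists 1 => y [/andP[]]].
Qed.

Lemma gauge_ub r e : tight_set r e -> e <= gauge r.
Proof. by move=> h; apply: ub_le_sup => //; have [] := tight_sup r. Qed.

Lemma gauge_gt0 r : 0 < gauge r.
Proof. by have [e e0 /gauge_ub] := tight_pos r; exact: lt_le_trans. Qed.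

Lemma gauge_le1 r : gauge r <= 1.
Proof. by apply: ge_sup; [have [] := tight_sup r|move=> y [/andP[]]]. Qed.

Lemma gauge_spec r u v : `|u| <= r -> `|u - v| < gauge r -> d (phi' u) (phi' v) <= 1.
Proof.
move=> ur uv; have [ne _] := tight_sup r.
have [e [/andP[e0 _] he] ue] := sup_gt ne uv.
by apply: he; [lra|exact: ltW].
Qed.

Lemma gauge_mono r r' : r <= r' -> gauge r' <= gauge r.
Proof.
move=> rr; apply: ge_sup => [|e [eI he]]; first by have [] := tight_sup r'.
by apply: gauge_ub; split=> // u v ur uv; apply: he => //; lra.
Qed.

Lemma gauge_lip r r' : r <= r' -> gauge r <= gauge r' + (r' - r).
Proof.
move=> rr; apply: ge_sup => [|e [/andP[e0 e1] he]]; first by have [] := tight_sup r.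
have g0 := gauge_gt0 r'; have [el|le] := leP e (r' - r); first lra.
have : e - (r' - r) <= gauge r'; last lra.
apply: gauge_ub; split; first by apply/andP; split; lra.
by move=> u v ur uv; apply: he; lra.
Qed.

Lemma gauge_continuous : continuous gauge.
Proof.
move=> r; apply/cvgrPdist_lt => e e0; apply/nbhs_ballP; exists e => // r'; rewrite /ball /=.
have [rr|rr] := leP r r'.
  have h1 := gauge_mono rr; have h2 := gauge_lip rr.
  by rewrite ler0_norm ?subr_le0 // => h; rewrite ger0_norm ?subr_ge0 //; lra.
have h1 := gauge_mono (ltW rr); have h2 := gauge_lip (ltW rr).
by rewrite gtr0_norm ?subr_gt0 // => h; rewrite ler0_norm ?subr_le0 //; lra.
Qed.

(** The constant 5 beats the bound 4 on the stretched displacement in [psi_dist]. *)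
Definition stretch r : R := 5 / gauge r.

Lemma stretch_ge1 r : 1 <= stretch r.
Proof. by rewrite /stretch ler_pdivlMr ?gauge_gt0 //; have := gauge_le1 r; lra. Qed.

Lemma stretch_mono r r' : r <= r' -> stretch r <= stretch r'.
Proof.
move=> rr; rewrite /stretch ler_pM2l ?lef_pV2 ?posrE ?gauge_gt0 //; exact: gauge_mono.
Qed.

Lemma stretch_continuous : continuous stretch.
Proof.
move=> r; apply: cvgM; first exact: cvg_cst.
by apply: cvgV; [rewrite gt_eqF // gauge_gt0|exact: gauge_continuous].
Qed.

Definition psi (x : E) : E := stretch `|x| *: x.

Lemma psi_continuous : continuous psi.
Proof.
have c2 : continuous (stretch \o (fun y : E => `|y|)).
  by move=> y; exact: (continuous_comp (@norm_continuous R E y) (@stretch_continuous _)).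
by move=> x; exact: (cvgZ (c2 x) (@cvg_id _ (nbhs x))).
Qed.

Lemma psi_norm x : `|psi x| = stretch `|x| * `|x|.
Proof. by rewrite /psi normrZ ger0_norm // (le_trans ler01) // stretch_ge1. Qed.

(** For the point [x] of smaller norm, the displacement stretched by the factor of [x] is
    [psi x' - psi x] minus a radial term. That term is at most the difference of the norms of
    [psi x'] and [psi x], so both are at most 2. *)
Lemma psi_dist x x' : `|psi x - psi x'| <= 2 -> d (phi' x) (phi' x') <= 1.
Proof.
wlog xx : x x' / `|x| <= `|x'|.
  move=> H h; have [/H|/ltW/H] := leP `|x| `|x'|; first exact.
  by rewrite dist_sym; apply; rewrite distrC.
move=> h; apply: (gauge_spec (lexx _)).
have s1 := stretch_ge1 `|x|; have sm := stretch_mono xx; have g0 := gauge_gt0 `|x|.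
have e : stretch `|x| *: (x' - x) = (psi x' - psi x) - (stretch `|x'| - stretch `|x|) *: x'.
  rewrite /psi scalerBr scalerBl; rewrite opprB addrCA -!addrA; congr (_ + _).
  by rewrite [in RHS]addrC addrNK.
have n1 : `|(stretch `|x'| - stretch `|x|) *: x'| <= `|psi x' - psi x|.
  rewrite normrZ ger0_norm ?subr_ge0 // mulrBl; apply: le_trans (lerB_dist _ _).
  by rewrite !psi_norm lerD2l lerN2 ler_pM2l // (lt_le_trans ltr01).
have n2 : stretch `|x| * `|x' - x| <= 4.
  rewrite -[stretch _ in X in X <= _]ger0_norm ?(le_trans ler01) // -normrZ e.
  apply: le_trans (ler_normB _ _) _; rewrite distrC in h; lra.
have : 5 * `|x - x'| <= 4 * gauge `|x|.
  by move: n2; rewrite /stretch mulrAC ler_pdivrMr // distrC.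
lra.
Qed.

Lemma psi_surj w : exists x, psi x = w.
Proof.
have [||s] := @IVT R (fun s => stretch (s * `|w|) * s) 0 1 1 ler01.
- have c1 : continuous (fun s : R => s * `|w|).
    by move=> s; apply: cvgM; [exact: cvg_id|exact: cvg_cst].
  have c2 : continuous (stretch \o (fun s : R => s * `|w|)).
    by move=> s; exact: (continuous_comp (c1 s) (@stretch_continuous _)).
  by apply: continuous_subspaceT => s; exact: (cvgM (c2 s) (@cvg_id _ (nbhs s))).
- rewrite mulr0 mul1r mulr1; have h := stretch_ge1 `|w|.
  have p := le_trans ler01 h; by rewrite (min_idPl p) (max_idPr p) ler01 h.
rewrite in_itv /= => /andP[s0 _] hs; exists (s *: w).
by rewrite /psi normrZ ger0_norm // scalerA hs scale1r.
Qed.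

Definition scaled p : E := psi (phi p).

Lemma scaled_continuous : continuous scaled.
Proof. by move=> p; apply: continuous_comp; [exact: phi_c|exact: psi_continuous]. Qed.

Lemma scaled_dist p q : `|scaled p - scaled q| <= 2 -> d p q <= 1.
Proof. by move/psi_dist; rewrite !phiK. Qed.

Lemma grid_point_ex (z : Z2) : exists p, scaled p = ctr R z.
Proof. by have [x xE] := psi_surj (ctr R z); exists (phi' x); rewrite /scaled phi'K. Qed.

Variable grid_point : Z2 -> M.
Hypothesis grid_pointP : forall z, scaled (grid_point z) = ctr R z.

Definition cell p : Z2 := (Num.floor (scaled p 0 0), Num.floor (scaled p 0 1)).

Definition about p (z : Z2) := `|scaled p - ctr R z| <= 1.

(** The bound is 1 + 1 + 1: from a grid point to a curve, along a curve of length at most 1, and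
    from the curve to another grid point. *)
Definition close (z z' : Z2) := d (grid_point z) (grid_point z') <= 3.

Lemma aboutP p (z : Z2) : about p z <->
  `|scaled p 0 0 - z.1%:~R| <= 1 /\ `|scaled p 0 1 - z.2%:~R| <= 1.
Proof.
rewrite /about; split=> [h|[h1 h2]].
  have := entry_le (scaled p - ctr R z) 0 0; have := entry_le (scaled p - ctr R z) 0 1.
  by rewrite !mxE /= => h1 h2; split; [exact: le_trans h2 h|exact: le_trans h1 h].
have e0 : (scaled p - ctr R z) 0 0 = scaled p 0 0 - z.1%:~R by rewrite !mxE /=.
have e1 : (scaled p - ctr R z) 0 1 = scaled p 0 1 - z.2%:~R by rewrite !mxE /=.
by apply: norm_le2; rewrite ?e0 ?e1.
Qed.

Lemma floor_near (a : R) : 0 <= a - (Num.floor a)%:~R < 1.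
Proof. by have /andP[h1 h2] := floor_itv a; rewrite intrD in h2; apply/andP; split; lra. Qed.

Lemma about_cell p : about p (cell p).
Proof.
apply/aboutP; have /andP[h1 h2] := floor_near (scaled p 0 0).
by have /andP[h3 h4] := floor_near (scaled p 0 1); split; rewrite ger0_norm //= ltW.
Qed.

Lemma about_dist p z : about p z -> d p (grid_point z) <= 1.
Proof. by move=> h; apply: scaled_dist; rewrite grid_pointP; apply: le_trans h _; lra. Qed.

Lemma cell_grid_point z : cell (grid_point z) = z.
Proof.
by rewrite /cell grid_pointP /ctr mk0 mk1 !intrKfloor; case: z.
Qed.

Lemma close_refl z : close z z.
Proof. by rewrite /close dist_refl. Qed.

Lemma close_sym z z' : close z z' -> close z' z.
Proof. by rewrite /close dist_sym. Qed.

Lemma gadj_close z z' : gadj z z' -> close z z'.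
Proof.
move=> zz; suff h : d (grid_point z) (grid_point z') <= 1 by rewrite /close; lra.
apply: scaled_dist; rewrite !grid_pointP; have [dr hd ->] := gadj_dir zz.
apply: (@norm_le2 R); rewrite !mxE /= /mv /= !intrD opprD addNKr normrN.
  by case: hd => ->; rewrite /= ?mulrNz ?mulr0z ?mulr1z ?normrN ?normr0 ?normr1; lra.
by case: hd => ->; rewrite /= ?mulrNz ?mulr0z ?mulr1z ?normrN ?normr0 ?normr1; lra.
Qed.

Lemma near_floor (a : R) (n : int) : `|a - n%:~R| <= 1 ->
  [\/ n = Num.floor a, n = Num.floor a + 1 | Num.floor a = n + 1].
Proof.
rewrite ler_norml => /andP[h1 h2]; have /andP[h3 h4] := floor_near a.
have k1 : (n < Num.floor a + 2)%R by rewrite -(ltr_int R) intrD; lra.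
have k2 : (Num.floor a < n + 2)%R by rewrite -(ltr_int R) intrD; lra.
have [->|[->|->]] : n = Num.floor a \/ n = Num.floor a + 1 \/ Num.floor a = n + 1 by lia.
- exact: Or31.
- exact: Or32.
- exact: Or33.
Qed.

Lemma about_conn p z : about p z -> conn gadj (about p) z (cell p).
Proof.
move=> az; have /aboutP[h1 h2] := az; have /aboutP[h3 h4] := about_cell p.
case: z az h1 h2 => [m n] az /= h1 h2; rewrite /cell /= in h3 h4 *.
have am : about p (Num.floor (scaled p 0 0), n) by apply/aboutP.
apply: (@conn_trans _ _ _ _ (Num.floor (scaled p 0 0), n)).
  have [e|e|e] := near_floor h1; first by rewrite e; exact: conn_refl.
    by apply: conn_adj => //; right; split=> //; right.
  by apply: conn_adj => //; right; split=> //; left.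
have ac := about_cell p; rewrite /cell in ac.
have [e|e|e] := near_floor h2; first by rewrite e; exact: conn_refl.
  by apply: conn_adj => //; left; split=> //; right.
by apply: conn_adj => //; left; split=> //; left.
Qed.

(** Take all grid points within 1 of the scaled curve. A point is at distance strictly less than 1
    from its floor, so the cell of [c t] remains [about] the curve for nearby times; this overlap
    makes the set connected. *)
Lemma link_small p q r : r <= 1 -> link g p q r -> exists K : set Z2,
  [/\ small gadj close K, K (cell p) & K (cell q)].
Proof.
move=> r1 [c [L [tm c0 c1 Lr]]]; have [cc _ _] := tm.
pose K := [set z | exists2 t : R, 0 <= t <= 1 & about (c t) z].
have Kab t : 0 <= t <= 1 -> about (c t) `<=` K by move=> tI z; exists t.
have cd s t : 0 <= s <= 1 -> 0 <= t <= 1 -> d (c s) (c t) <= 1.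
  wlog st : s t / s <= t.
    move=> H sI tI; have [st|/ltW ts] := leP s t; first exact: H.
    by rewrite dist_sym; apply: H.
  move=> /andP[s0 s1] /andP[t0 t1]; move: st; rewrite le_eqVlt => /orP[/eqP->|st].
    by rewrite dist_refl.
  have l := tame_link st (tame_sub s0 t1 tm); apply: le_trans (dist_le l) _.
  have h1 := tame_le s0 (tame_sub (lexx 0) s1 tm).
  have h2 := tame_le t1 (tame_sub t0 (lexx 1) tm).
  lra.
exists K; split; last 2 first.
- by exists 0; [rewrite lexx ler01|rewrite c0; exact: about_cell].
- by exists 1; [rewrite lexx ler01|rewrite c1; exact: about_cell].
split; last first.
  move=> z z' [s sI az] [t tI az']; rewrite /close.
  have := dist_tri g phiK phi'_c (grid_point z) (c s) (grid_point z').
  have := dist_tri g phiK phi'_c (c s) (c t) (grid_point z').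
  have := about_dist az; have := about_dist az'; have := cd s t sI tI.
  by rewrite (dist_sym g (grid_point z) (c s)); lra.
have ends a b : 0 <= a -> a <= b -> b <= 1 ->
    forall z z', about (c a) z -> about (c b) z' -> conn gadj K z z'.
  move=> a0 ab b1; apply: (@cousin R (fun x y => forall z z', about (c x) z -> about (c y) z' -> conn gadj K z z')) => //.
    move=> t /andP[at_ tb]; have tI : 0 <= t <= 1 by apply/andP; split; lra.
    have nb : nbhs (c t) [set p' | about p' (cell (c t))].
      have cj j : (fun p' => scaled p' 0 j) @ (c t) --> scaled (c t) 0 j.
        by apply: (@entry_cvg R _ _ 1 2 scaled); exact: scaled_continuous.
      have bd j : nbhs (c t) [set p' | `|scaled p' 0 j - (Num.floor (scaled (c t) 0 j))%:~R| < 1].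
        have /andP[f1 f2] := floor_near (scaled (c t) 0 j).
        have : (fun p' => `|scaled p' 0 j - (Num.floor (scaled (c t) 0 j))%:~R|) @ (c t) -->
            `|scaled (c t) 0 j - (Num.floor (scaled (c t) 0 j))%:~R|.
          by apply: cvg_norm; exact: (cvgB (cj j) (cvg_cst _)).
        by move/cvgr_lt; apply; rewrite ger0_norm.
      apply: filterS (filterI (bd 0) (bd 1)) => p' [b0 b1'].
      by apply/aboutP; split; apply: ltW.
    have [e e0 he] := cc t tI _ nb; exists e => // x y ax xt ty yb xe ye z z' az az'.
    have xI : 0 <= x <= 1 by apply/andP; split; lra.
    have yI : 0 <= y <= 1 by apply/andP; split; lra.
    have hx : about (c x) (cell (c t)) by apply: he => //; rewrite ler0_norm ?subr_le0 // opprB.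
    have hy : about (c y) (cell (c t)) by apply: he => //; rewrite ger0_norm ?subr_ge0.
    have loc s z1 : 0 <= s <= 1 -> about (c s) z1 -> conn gadj K z1 (cell (c s)).
      by move=> sI a1; apply: conn_sub (Kab s sI) (about_conn a1).
    apply: conn_trans (loc x z xI az) _.
    apply: conn_trans (conn_sym gadj_sym (loc x _ xI hx)) _.
    apply: conn_trans (loc y _ yI hy) _.
    exact: (conn_sym gadj_sym (loc y _ yI az')).
  move=> x y w _ _ _ _ h1 h2 z z' az az'.
  exact: (conn_trans (h1 z _ az (about_cell (c y))) (h2 _ z' (about_cell (c y)) az')).
move=> z z' [s /andP[s0 s1] az] [t /andP[t0 t1] az'].
have [st|/ltW ts] := leP s t; first exact: (ends s t).
by apply: (conn_sym gadj_sym); exact: (ends t s).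
Qed.

Hypothesis d_complete : complete_dist d.

Lemma box_finite (N : nat) : finite_set [set z : Z2 | `|z.1| <= N%:Z /\ `|z.2| <= N%:Z].
Proof.
pose s := [seq (i%:Z - N%:Z, j%:Z - N%:Z) | i <- iota 0 (2 * N).+1, j <- iota 0 (2 * N).+1].
apply: sub_finite_set (finite_seq s) => -[a b] /= [ha hb].
have ma : `|(a + N%:Z)%R|%N \in iota 0 (2 * N).+1 by rewrite mem_iota; lia.
have mb : `|(b + N%:Z)%R|%N \in iota 0 (2 * N).+1 by rewrite mem_iota; lia.
have ea : `|(a + N%:Z)%R|%N%:Z - N%:Z = a by lia.
have eb : `|(b + N%:Z)%R|%N%:Z - N%:Z = b by lia.
apply/allpairsP; exists (`|(a + N%:Z)%R|%N, `|(b + N%:Z)%R|%N).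
by split=> //; rewrite [_.1]/= [_.2]/= ea eb.
Qed.

Lemma close_finite z : finite_set [set z' | close z z'].
Proof.
have [B hB] := balls_bounded phiK phi_c phi'_c d_complete (grid_point z) 3.
pose C := stretch `|B| * `|B|; pose N := (Num.bound `|C|).
apply: sub_finite_set (box_finite N) => z' cz.
have h := hB _ cz.
have hC : `|scaled (grid_point z')| <= C.
  rewrite /scaled psi_norm; have hb := le_trans h (ler_norm B).
  by apply: ler_pM => //; [rewrite (le_trans ler01) // stretch_ge1|exact: stretch_mono].
have CN : C < N%:R by apply: le_lt_trans (ler_norm _) (archi_boundP (normr_ge0 _)).
rewrite grid_pointP in hC.
have ent (j : 'I_2) (n : int) : ctr R z' 0 j = n%:~R -> `|n| <= N%:Z.
  move=> e; have := entry_le (ctr R z') 0 j; rewrite e -intr_norm => h1.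
  by rewrite -(ler_int R); apply: le_trans h1 (le_trans hC (ltW CN)).
by split; [apply: (ent 0)|apply: (ent 1)]; rewrite mxE.
Qed.

End Grid.

(** * The cluster graph *)

Section ClusterWalks.
Local Open Scope ring_scope.
Local Notation Z2 := (int * int)%type.

Lemma walk_step (G : graph) n (u v w : vertex G) : walk n u v -> adj v w -> walk n.+1 u w.
Proof.
move=> [f [f0 fn fa]] vw; exists (fun k => if (k <= n)%N then f k else w).
split=> //; first by rewrite ltnn.
move=> k; rewrite ltnS => kn; rewrite kn; case: ltngtP kn => // [kn _|-> _]; first exact: fa.
by rewrite fn.
Qed.

Lemma walk_last (G : graph) n (u w : vertex G) : walk n.+1 u w -> exists2 v, walk n u v & adj v w.
Proof.
move=> [f [f0 fn fa]]; exists (f n); last by rewrite -fn; exact: fa.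
by exists f; split=> // k kn; apply: fa; exact: ltnW.
Qed.

Lemma walk0 (G : graph) (u v : vertex G) : walk 0 u v -> u = v.
Proof. by move=> [f [<- <-]]. Qed.

Lemma graph_dist_le (R : realType) (G : graph) n (u v : vertex G) : walk n u v ->
  graph_dist R u v <= n%:R.
Proof.
move=> h; apply: ge_inf; last by exists n.
by exists 0 => _ [m _ <-]; exact: ler0n.
Qed.

Lemma graph_dist_ge (R : realType) (G : graph) (u v : vertex G) (a : R) : (exists n, walk n u v) ->
  (forall n, walk n u v -> a <= n%:R) -> a <= graph_dist R u v.
Proof.
move=> [n hn] h; apply: lb_le_inf; first by exists n%:R, n.
by move=> _ [m hm <-]; exact: h.
Qed.

Variable cen : Z2 -> Z2.
Hypothesis cen_idem : forall z, cen (cen z) = cen z.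

Definition cluster (x : Z2) : vertex (cluster_graph cen) :=
  exist (fun z => cen z == z) (cen x) (introT eqP (cen_idem x)).

Lemma cluster_val (v : vertex (cluster_graph cen)) : cluster (val v) = v.
Proof. by apply: val_inj; apply/eqP; exact: (valP v). Qed.

Lemma hop_walk n x y : hop gadj cen n x y -> exists2 m, (m <= n)%N & walk m (cluster x) (cluster y).
Proof.
elim: n y => [y /= xy|n IHn y [z /IHn[m mn wm] zy]].
  exists 0%N => //; exists (fun=> cluster x); split=> //.
  exact: val_inj.
have [e|ne] := pselect (cen z = cen y).
  have -> : cluster y = cluster z by apply: val_inj.
  by exists m => //; exact: leqW.
exists m.+1 => //; apply: walk_step wm _.
by case: zy => [/ne//|[x' [y' [h1 h2 h3]]]]; split=> //; exists x', y'.
Qed.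

End ClusterWalks.

Local Open Scope ring_scope.

Theorem theorem1p7 (R : realType) (M : topologicalType)
    (A : smooth_atlas R M) (g : riemannian_metric A)
    (M_plane : homeomorphic M 'rV[R]_2)
    (g_complete : complete_dist (riemannian_dist g)) :
  exists G : graph,
    [/\ connected_graph G, locally_finite_graph G, planar_graph R G &
        quasi_isometric (riemannian_dist g) (@graph_dist R G)].
Proof.
have [phi [phi' [phiK phi'K phi_c phi'_c]]] := M_plane.
set d := riemannian_dist g.
have tri p q r : d p r <= d p q + d q r := dist_tri g phiK phi'_c p q r.
have /choice[e eP] := grid_point_ex g phiK phi'K phi'_c.
pose cl := close g e.
have clsym : forall x y, cl x y -> cl y x := @close_sym _ _ _ g e.
have clrefl : forall x, cl x x := @close_refl _ _ _ g e.
have adjcl : forall x y, gadj x y -> cl x y := gadj_close phiK phi'_c eP.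
have clfin : forall x, finite_set [set y | cl x y] := close_finite phiK phi_c phi'_c eP g_complete.
have inf : ~ finite_set [set: int * int].
  move=> /(finite_image (fun z => `|z.1|%N)) fin; apply: infinite_nat.
  by apply: sub_finite_set fin => n _; exists (n%:Z, 0).
have [cen [Rd [Lp [idem cconn cdle chop]]]] :=
  @cluster_decomposition (int * int)%type gadj cl gadj_sym clrefl clsym adjcl clfin inf no_K5.
(* Centers of adjacent clusters are at distance at most [K]: [3 * Rd] inside each cluster and 3
   between two adjacent cells. *)
pose G := cluster_graph cen; pose K : R := (6 * Rd + 3)%:R.
pose cel := cell g phi phi'.
pose f p : vertex G := cluster idem (cel p).
have cele z : cel (e z) = z := cell_grid_point eP z.
(* The curve is cut into pieces of length at most 1; each runs through a small set, which costs [Lp]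
   hops. *)
have link_hop n : forall p q r, link g p q r -> r <= n.+1%:R -> hop gadj cen (Lp * n.+1) (cel p) (cel q).
  elim: n => [|n IHn] p q r l rn.
    have [P [sP Pp Pq]] := link_small phiK phi_c phi'_c eP rn l.
    by rewrite muln1; exact: (chop P).
  have [r1|r1] := leP r 1.
    apply: (@hop_leq _ _ _ Lp); first by rewrite leq_pmulr.
    have [P [sP Pp Pq]] := link_small phiK phi_c phi'_c eP r1 l.
    exact: (chop P).
  have [|q1 [l1 l2]] := link_split (r1 := 1) l; first by rewrite ler01 ltW.
  rewrite mulnS; apply: hop_trans (_ : hop _ _ Lp _ (cel q1)) (IHn q1 q _ l2 _).
    have [P [sP Pp Pq]] := link_small phiK phi_c phi'_c eP (lexx 1) l1.
    exact: (chop P).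
  by rewrite lerBlDr -natr1 in rn *.
have dwalk p q : exists2 m, walk m (f p) (f q) & m%:R <= Lp%:R * (d p q + 1).
  have d0 : 0 <= d p q := dist_ge0 g p q.
  have /andP[t1 t2] := truncn_itv d0.
  have [r rt l] := dist_lt (reach_all g phiK phi'_c p q) t2.
  have [m mn w] := hop_walk idem (link_hop _ _ _ _ l (ltW rt)).
  exists m => //; apply: le_trans (_ : (Lp * (Num.truncn (d p q)).+1)%:R <= _).
    by rewrite ler_nat.
  by rewrite natrM ler_wpM2l // -natr1 lerD2r.
have natS (n : nat) : n.+1%:R = n%:R + 1 :> R by rewrite -natr1.
have ddle n x y : dle gadj cl setT n x y -> d (e x) (e y) <= 3 * n%:R.
  elim: n y => [y /= <-|n IHn y [z /IHn h /st_cl zy]]; first by rewrite /d dist_refl mulr0.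
  by apply: le_trans (tri _ (e z) _) _; rewrite (natS n) mulrDr mulr1 lerD.
have dcen x : d (e (cen x)) (e x) <= 3 * Rd%:R := ddle _ _ _ (cdle x).
have dsym p q : d p q = d q p := dist_sym g p q.
have dadj (u v : vertex G) : adj u v -> d (e (val u)) (e (val v)) <= K.
  move=> [_ [x [y [<- <- xy]]]].
  have h1 := dcen x; have h2 := dcen y; have h3 : d (e x) (e y) <= 3 := adjcl _ _ xy.
  have h4 := tri (e (cen x)) (e x) (e (cen y)); have h5 := tri (e x) (e y) (e (cen y)).
  rewrite (dsym (e y)) in h5; have -> : K = 6 * Rd%:R + 3 by rewrite /K natrD natrM.
  lra.
have dwalk_le n (u v : vertex G) : walk n u v -> d (e (val u)) (e (val v)) <= K * n%:R.
  elim: n v => [v /walk0->|n IHn v /walk_last[w /IHn h /dadj h']].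
    by rewrite /d dist_refl mulr0.
  by apply: le_trans (tri _ (e (val w)) _) _; rewrite (natS n) mulrDr mulr1 lerD.
have dcel p : d p (e (cen (cel p))) <= 1 + 3 * Rd%:R.
  have h1 : d p (e (cel p)) <= 1 by apply: (about_dist phiK phi'_c eP); exact: about_cell.
  have h2 := tri p (e (cel p)) (e (cen (cel p))); have h3 := dcen (cel p).
  by rewrite (dsym (e (cel p))) in h2; lra.
have conn_G : connected_graph G.
  move=> u v; have [m w _] := dwalk (e (val u)) (e (val v)).
  by exists m; rewrite -(cluster_val idem u) -(cluster_val idem v) -[val u]cele -[val v]cele.
exists G; split=> //; last 1 first.
(* Here [a] dominates both [Lp] and [K], while [b] dominates [Lp] and [2 * (1 + 3 * Rd)], the cost
   of replacing two points by the centers of their clusters. *)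
- pose a : R := (Lp + (6 * Rd + 3))%:R; pose b : R := (Lp + (6 * Rd + 2))%:R.
  have a1 : 1 <= a by rewrite /a ler1n; lia.
  have a0 : 0 < a := lt_le_trans ltr01 a1.
  exists f, a, b, 0; split=> //.
  + move=> p q; have d0 : 0 <= d p q := dist_ge0 g p q; apply/andP; split.
      have [m w _] := dwalk p q; apply: graph_dist_ge => [|n wn]; first by exists m.
      have h1 := dwalk_le n _ _ wn; rewrite /= in h1.
      have h2 := dcel p; have h3 := dcel q.
      have h4 := tri p (e (cen (cel p))) q; have h5 := tri (e (cen (cel p))) (e (cen (cel q))) q.
      rewrite (dsym (e (cen (cel q))) q) in h5.
      have Ka : K * n%:R <= a * n%:R by rewrite ler_wpM2r // /K /a ler_nat leq_addl.
      have bE : 2 + 6 * Rd%:R <= b.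
        have -> : b = Lp%:R + (6 * Rd%:R + 2) by rewrite /b natrD natrD natrM.
        by have := ler0n R Lp; lra.
      rewrite lerBlDr mulrC ler_pdivrMr // mulrDl.
      have ba : b <= b * a by rewrite ler_peMr // ler0n.
      by rewrite -/d [n%:R * a]mulrC; lra.
    have [m w hm] := dwalk p q; apply: le_trans (graph_dist_le R w) (le_trans hm _).
    rewrite mulrDr mulr1; apply: lerD; last by rewrite /b ler_nat leq_addr.
    by rewrite ler_wpM2r // /a ler_nat leq_addr.
  + move=> v; exists (e (val v)); rewrite /f cele cluster_val.
    rewrite -[leRHS](_ : 0%:R = 0) //; apply: graph_dist_le.
    by exists (fun=> v).
(* A neighbouring cluster contains a cell adjacent to a cell of [v], hence at most [Rd + 1] steps
   away from the center. *)
- move=> v; have fin : finite_set (cen @` [set y | dle gadj cl setT Rd.+1 (val v) y]).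
    by apply: finite_image; exact: dle_finite.
  apply: sub_finite_set (finite_preimage _ fin : finite_set (val @^-1` _)); last first.
    by move=> x y _ _; exact: val_inj.
  move=> w [_ [x [y [xv yw xy]]]]; exists y => //=.
  apply: dle_st (_ : dle _ _ _ _ _ x) _; first by rewrite -xv; exact: cdle.
  by apply: st_adj => //; exact: gadj_sym.
- exact: planar_cluster_graph.
Qed.
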